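(* Let $d \geq 9$ and let $Q$ be a real symmetric positive definite $d\times d$ matrix. For $s>0$ let $E_s=\{x\in\mathbb{R}^d : \langle Qx,x\rangle \leq s\}$ and $$\Delta(s,Q,a)=\left|\frac{\mathrm{vol}_{\mathbb{Z}}(E_s+a)-\mathrm{vol}\,E_s}{\mathrm{vol}\,E_s}\right|,\qquad a\in\mathbb{R}^d .$$ Then $$\sup_{a\in\mathbb{R}^d}\Delta(s,Q,a)=o(s^{-1})\quad\text{as } s\to\infty$$ if and only if $Q$ is irrational.
   Context: $\mathrm{vol}$ denotes Lebesgue measure on $\mathbb{R}^d$ and $\mathrm{vol}_{\mathbb{Z}}B$ denotes the number of points of $B\cap\mathbb{Z}^d$. A nonzero real symmetric matrix $Q$ (equivalently the quadratic form $Q[x]=\langle Qx,x\rangle$) is called rational if there is a real $M\neq 0$ such that $MQ$ has only integer entries, and irrational otherwise. *)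

(* Defs.v *)
From mathcomp Require Import all_boot all_order all_algebra.
From mathcomp Require Import all_classical all_reals all_analysis.
Import Order.TTheory GRing.Theory Num.Theory.
Import numFieldNormedType.Exports.

Set Implicit Arguments.
Unset Strict Implicit.
Unset Printing Implicit Defensive.

Local Open Scope classical_set_scope.
Local Open Scope ring_scope.

Section LebesgueMeasureRn.
Context {R : realType}.

(* The n-fold product of the Lebesgue measure of R, transported along
   R * R^n -> R^(n+1), (x, t) |-> x :: t; on R^0 it is the unit mass. *)
Fixpoint lebesgue_tuple (n : nat) : set (n.-tuple (measurableTypeR R)) -> \bar R :=
  match n return set (n.-tuple (measurableTypeR R)) -> \bar R with
  | 0 => dirac [tuple]
  | m.+1 => pushforward (@lebesgue_measure R \x @lebesgue_tuple m)%E
              (fun p => [tuple of p.1 :: p.2])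
  end.

(* [fine] sends an infinite value to 0; [vol] and [volZ] are only meant for
   bounded sets, where both quantities are finite. *)
Definition vol (d : nat) (B : set 'cV[R]_d) : R :=
  fine (lebesgue_tuple [set t : d.-tuple R | B (\col_i tnth t i)]).

End LebesgueMeasureRn.

(* The little-o notation wants a [filter_on], and the library packages none
   for [pinfty_nbhs]. *)
Definition pinfty_filter_on (R : realType) : filter_on R :=
  FilterType (pinfty_nbhs R) _.

Section Lattice.
Context {R : realType} (d : nat).
Implicit Types (Q : 'M[R]_d) (B : set 'cV[R]_d) (x a : 'cV[R]_d) (s : R).

Definition int_lattice : set 'cV[R]_d :=
  [set x | forall i, x i 0 \is a Num.int].

Definition volZ B : R := fine (counting (B `&` int_lattice)).

Definition qform Q x : R := ((Q *m x)^T *m x) 0 0.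

Definition posdefmx Q : Prop :=
  Q^T = Q /\ forall x, x != 0 -> 0 < qform Q x.

Definition rational_mx Q : Prop :=
  exists2 M : R, M != 0 & forall i j, M * Q i j \is a Num.int.

Definition irrational_mx Q : Prop := ~ rational_mx Q.

Definition ellipsoid Q s : set 'cV[R]_d := [set x | qform Q x <= s].

Definition Delta s Q a : R :=
  `|(volZ [set x + a | x in ellipsoid Q s] - vol (ellipsoid Q s))
    / vol (ellipsoid Q s)|.

End Lattice.

(* Main.v *)
(** Write e(x) = exp(2 i pi x), let W be a smooth weight that is 1 on [-N, N]^d,
    where N^2 is a large multiple of s, and let theta_a(t) be the sum of
    W(m - a) e(t Q[m - a]) over m in Z^d.  Expanding a trapezoidal majorant and
    minorant of the indicator function of [0, s] into Fejer kernels of period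
    L ~ N^2 bounds the difference of the numbers of lattice points in E_s + a and
    E_(s + del) + b by sum_k g_k |theta_a(k / L) - theta_b(k / L)|, where
    g_k = O(min(1 / k, L / k^2)), and this sum is o(N^(d - 2)):
    - for k <= eta sqrt N, theta_a is Z^d-periodic in a and its fourth differences
      in a are small, hence so is theta_a - theta_b;
    - Weyl differencing and a count of the lattice points h for which 2 eps Q h is
      close to Z^d give, with eps = |t - t'|,
        |theta_a(t) theta_a(t')|^2 <= C (N^4 (eps + 1 / (N^2 eps)))^d,
      so that the frequencies where |theta_a| exceeds a given level form sparse
      clusters; for d >= 9 the sum over dyadic levels converges, and comparison
      with theta_a(0) handles the range eta sqrt N <= k <= N;
    - if Q is irrational, then theta_a(t) = o(N^d) uniformly in a and in t in a
      compact subset of ]0, +oo[, which makes all remaining levels small.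
    The average over b of the number of lattice points of E_s + b is the volume,
    so that lattice points and volume are within o(s^(d/2 - 1)).  Conversely, if
    M Q is integral, then the number of lattice points of E_s is constant for s in
    [k / |M|, (k + 1) / |M|[, whereas the volume varies by a multiple of
    s^(d/2 - 1). *)

Require Import Defs.
From HB Require Import structures.
From mathcomp Require Import all_boot all_order all_algebra.
From mathcomp Require Import all_classical all_reals all_analysis.
From mathcomp Require Import measurable_realfun complex ring lra zify.
Import Order.TTheory GRing.Theory Num.Theory.
Import numFieldNormedType.Exports.
Import Normc.

Set Implicit Arguments.
Unset Strict Implicit.
Unset Printing Implicit Defensive.

Local Open Scope classical_set_scope.
Local Open Scope ring_scope.
Local Open Scope complex_scope.


(** * Exponentials and the distance to the integers *)

(** Comparing two translates, instead of lattice points with volume, makes the peak of the theta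
    sums at frequency 0 cancel rather than having to be evaluated, and it keeps every bound uniform
    in a. Why 9: as |theta_a(0)| has order N^d, pairing t = k / L with t' = 0 gives |theta_a(k / L)|
    = O(N^d k^(-d/2)) for k <= N. Fourth differences bound the part k <= K of the sum by N^(d - 4)
    K^4, which is small against N^(d - 2) exactly up to K = eta sqrt N; beyond that point the sum of
    k^(-1 - d/2) has order N^(-d/4), and this beats N^(-2) only for d > 8. The level sets show the
    same threshold: at level lam the clusters are governed by kap = lam^(4/d), a range of L
    frequencies contains O(kap^(-2)) members of the level, and the sum of lam kap^(-2) = lam^(1 -
    8/d) over dyadic levels converges only for d > 8. For larger d the exponent is simply lowered to
    9. *)

Section ComplexModulus.
Context {R : realType}.
Implicit Types z w : R[i].

Lemma normc_ge0 z : 0 <= normc z.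
Proof. by case: z => a b; exact: sqrtr_ge0. Qed.

Lemma normcR (x : R) : normc x%:C = `|x|.
Proof. by rewrite /= expr0n addr0 sqrtr_sqr. Qed.

Lemma normc_triangle z w : normc (z + w) <= normc z + normc w.
Proof. exact: le_normcD. Qed.

Lemma normcB z w : normc (z - w) = normc (w - z).
Proof. by rewrite -(opprB w z) normcN. Qed.

Lemma normc_conj z : normc (conjc z) = normc z.
Proof. by case: z => a b /=; rewrite sqrrN. Qed.

Lemma conjcM z w : conjc (z * w) = conjc z * conjc w.
Proof. exact: rmorphM. Qed.

Lemma realcM (x y : R) : (x * y)%:C = x%:C * y%:C.
Proof. exact: rmorphM. Qed.

Lemma realc_prod (I : Type) (r : seq I) (P : pred I) (f : I -> R) :
  (\prod_(i <- r | P i) f i)%:C = \prod_(i <- r | P i) (f i)%:C.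
Proof. exact: rmorph_prod. Qed.

Lemma realc_sum (I : Type) (r : seq I) (P : pred I) (f : I -> R) :
  (\sum_(i <- r | P i) f i)%:C = \sum_(i <- r | P i) (f i)%:C.
Proof. exact: rmorph_sum. Qed.

Lemma normcX z n : normc (z ^+ n) = normc z ^+ n.
Proof. by elim: n => [|n IH]; rewrite ?normc1 // !exprS normcM IH. Qed.

Lemma normc_prod (I : Type) (r : seq I) (P : pred I) (f : I -> R[i]) :
  normc (\prod_(i <- r | P i) f i) = \prod_(i <- r | P i) normc (f i).
Proof.
by elim/big_rec2: _ => [|i y1 y2 _ <-]; rewrite ?normc1 // normcM.
Qed.

Lemma normc_sum (I : Type) (r : seq I) (P : pred I) (f : I -> R[i]) :
  normc (\sum_(i <- r | P i) f i) <= \sum_(i <- r | P i) normc (f i).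
Proof.
elim/big_rec2: _ => [|i y1 y2 _ IH]; first by rewrite normc0.
by apply: le_trans (normc_triangle _ _) _; rewrite lerD2l.
Qed.

Lemma normc_sqr z : (normc z ^+ 2)%:C = z * conjc z.
Proof.
case: z => a b; rewrite /= sqr_sqrtr ?addr_ge0 ?sqr_ge0//.
by simpc; congr (_ +i* _); ring.
Qed.

End ComplexModulus.

Section Exponential.
Context {R : realType}.
Implicit Types (x y : R) (n : int).

Definition ex x : R[i] := cos (2 * pi * x) +i* sin (2 * pi * x).

Lemma exD x y : ex (x + y) = ex x * ex y.
Proof. by rewrite /ex mulrDr cosD sinD; simpc; congr (_ +i* _); ring. Qed.

Lemma ex0 : ex 0 = 1.
Proof. by rewrite /ex mulr0 cos0 sin0. Qed.

Lemma exN x : ex (- x) = conjc (ex x).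
Proof. by rewrite /ex mulrN cosN sinN. Qed.

Lemma normc_ex x : normc (ex x) = 1.
Proof. by rewrite /= cos2Dsin2 sqrtr1. Qed.

Lemma ex_nat (n : nat) : ex n%:R = 1.
Proof.
elim: n => [|n IH]; first exact: ex0.
rewrite -natr1 exD IH mul1r /ex mulr1 (_ : 2 * pi = pi *+ 2); last by ring.
by rewrite cos2pi sin2pi.
Qed.

Lemma ex_int n : ex n%:~R = 1.
Proof.
case: n => n; first exact: ex_nat.
by rewrite NegzE mulrNz exN ex_nat conjc1.
Qed.

(** Stands in for the distance to the nearest integer: 1-periodic, even, subadditive, and comparable
    to |x| for |x| <= 1/2 by [nu_le] and [nu_ge]. *)
Definition nu x : R := normc (1 - ex x).

Lemma nu_ge0 x : 0 <= nu x. Proof. exact: normc_ge0. Qed.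

Lemma nu_sqr x : nu x ^+ 2 = 2 - 2 * cos (2 * pi * x).
Proof.
rewrite /nu /ex; have -> : 1 - (cos (2 * pi * x) +i* sin (2 * pi * x)) =
  (1 - cos (2 * pi * x)) +i* (- sin (2 * pi * x)).
  by rewrite -[1]/(1 +i* 0); simpc.
rewrite /= sqr_sqrtr ?addr_ge0 ?sqr_ge0//.
have := cos2Dsin2 (2 * pi * x) => h.
by rewrite sqrrN sqrrB; lra.
Qed.

Lemma nuE x : nu x = 2 * `|sin (pi * x)|.
Proof.
apply/eqP; rewrite -(@eqrXn2 _ 2) ?nu_ge0 ?mulr_ge0 //.
rewrite nu_sqr exprMn real_normK ?num_real //.
have -> : 2 * pi * x = (pi * x) *+ 2 by ring.
by rewrite cos_mulr2n cos2sin2; apply/eqP; ring.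
Qed.

Lemma nuN x : nu (- x) = nu x.
Proof. by rewrite !nuE mulrN sinN normrN. Qed.

Lemma nuDint x n : nu (x + n%:~R) = nu x.
Proof. by rewrite /nu exD ex_int mulr1. Qed.

Lemma nuD x y : nu (x + y) <= nu x + nu y.
Proof.
rewrite /nu exD.
have -> : 1 - ex x * ex y = (1 - ex x) + ex x * (1 - ex y) by ring.
by apply: le_trans (normc_triangle _ _) _; rewrite normcM normc_ex mul1r.
Qed.

Lemma nuMn x (n : nat) : nu (x * n%:R) <= nu x * n%:R.
Proof.
elim: n => [|n IH]; first by rewrite !mulr0 /nu ex0 subrr normc0.
by rewrite -natr1 !mulrDr !mulr1 (le_trans (nuD _ _)) // lerD2r.
Qed.

Lemma sin_cos_mvt x : 0 < x -> exists2 c, 0 < c < x & sin x = cos c * x.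
Proof.
move=> x0; have [|c] := @MVT R sin cos 0 x x0.
  by apply: continuous_subspaceT => y; exact: continuous_sin.
by rewrite sin0 !subr0 in_itv /= => cx ->; exists c.
Qed.

Lemma nu_le x : nu x <= 2 * pi * `|x|.
Proof.
wlog x0 : x / 0 < x.
  move=> H; have [|x0|->] := ltgtP x 0; last first.
  - by rewrite /nu ex0 subrr normc0 normr0 mulr0.
  - exact: H.
  by rewrite -oppr_gt0 => /H; rewrite nuN normrN.
have px := mulr_gt0 (pi_gt0 R) x0.
have [c _ sE] := sin_cos_mvt px.
rewrite nuE sE normrM (gtr0_norm px) (gtr0_norm x0) -mulrA ler_wpM2l //.
by rewrite ler_piMl ?(ltW px) ?cos_max.
Qed.

Lemma cos_piquarter_sqr : cos (pi / 4) ^+ 2 = 2^-1 :> R.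
Proof.
have := cos_mulr2n (pi / 4 : R).
have -> : (pi / 4 : R) *+ 2 = pi / 2 by field.
by rewrite cos_pihalf; lra.
Qed.

(** It suffices that sin(pi x) >= x on [0, 1/2]. Up to 1/4 the mean value theorem applies with cos
    >= 1/2 and pi >= 2; beyond 1/4 the sine is already at least 1/2. *)
Lemma nu_ge x : `|x| <= 2^-1 -> 2 * `|x| <= nu x.
Proof.
wlog x0 : x / 0 < x.
  move=> H; have [x0|x0|->] := ltgtP x 0; last first.
  - by rewrite normr0 mulr0 nu_ge0.
  - exact: H.
  by rewrite -nuN -normrN; apply: H; rewrite oppr_gt0.
have p0 := pi_gt0 R; have p2 := pi_ge2 R.
rewrite gtr0_norm // nuE => x2; apply: ler_wpM2l => //.
have c4 : 2^-1 <= cos (pi / 4) :> R.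
  rewrite -(@ler_pXn2r _ 2) ?nnegrE ?invr_ge0 ?cos_ge0_pihalf ?cos_piquarter_sqr//.
    lra.
  by apply/andP; split; lra.
have [xq|xq] := leP x (4^-1).
  have [c /andP[c0 cx] ->] := sin_cos_mvt (mulr_gt0 p0 x0).
  have cq : c <= pi / 4 by apply: le_trans (ltW cx) _; rewrite ler_wpM2l// ltW.
  have h : cos (pi / 4) <= cos c.
    move: cq; rewrite le_eqVlt => /orP[/eqP->//|cq].
    by apply/ltW; rewrite ltr_cos // in_itv /=; apply/andP; split; nra.
  apply: le_trans (ler_norm _).
  have h1 : 0 <= (pi - 2) * x by rewrite mulr_ge0 ?subr_ge0 // ltW.
  have h2 : 0 <= (cos c - 2^-1) * (pi * x).
    by rewrite mulr_ge0 ?mulr_ge0 ?(ltW p0) ?(ltW x0)// subr_ge0 (le_trans c4).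
  by lra.
have s4 : 2^-1 <= sin (pi / 4) :> R.
  rewrite -(@ler_pXn2r _ 2) ?nnegrE ?invr_ge0 ?sin_ge0_pi ?sin2cos2 ?cos_piquarter_sqr//.
    by lra.
  by apply/andP; split; lra.
apply: le_trans (ler_norm _); apply: (le_trans x2); apply: le_trans s4 _.
have : pi / 4 <= pi * x by rewrite ler_wpM2l// ltW.
rewrite le_eqVlt => /orP[/eqP h|h]; first by rewrite -h lexx.
have h2 : pi * x <= pi * 2^-1 by rewrite ler_wpM2l// ltW.
by apply: ltW; rewrite ltr_sin // in_itv /=; apply/andP; split; lra.
Qed.

(** The representative of x modulo 1 of least absolute value. *)
Definition cfrac x : R := x - (Num.floor (x + 2^-1))%:~R.

Lemma cfrac_bound x : `|cfrac x| <= 2^-1.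
Proof.
have /andP[] := floor_itv (x + 2^-1); rewrite /cfrac intrD.
by rewrite ler_norml; lra.
Qed.

Lemma nu_cfrac x : nu (cfrac x) = nu x.
Proof. by rewrite /cfrac -intrN nuDint. Qed.

Lemma nu_ge_cfrac x : 2 * `|cfrac x| <= nu x.
Proof. by rewrite -nu_cfrac nu_ge // cfrac_bound. Qed.

End Exponential.


(** Sums over Z^d appear as sums over finite lists; this lets the list be exchanged for any other
    one that contains the support. *)
Lemma sum_supp (V : zmodType) (T : eqType) (r1 r2 : seq T) (f : T -> V) :
  uniq r1 -> uniq r2 ->
  {in r1, forall x, f x != 0 -> x \in r2} ->
  {in r2, forall x, f x != 0 -> x \in r1} ->
  \sum_(x <- r1) f x = \sum_(x <- r2) f x.
Proof.
move=> u1 u2 s12 s21.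
have E (r : seq T) : \sum_(x <- r) f x = \sum_(x <- [seq x <- r | f x != 0]) f x.
  rewrite big_filter [LHS](bigID (fun x => f x != 0)) /= [X in _ + X]big1 ?addr0 //.
  by move=> x /negPn/eqP.
rewrite E [RHS]E; apply: perm_big; apply: uniq_perm; rewrite ?filter_uniq // => x.
rewrite !mem_filter; case fx: (f x != 0) => //=.
by apply/idP/idP => xr; [apply: s12|apply: s21].
Qed.

Lemma sumr_size (V : nmodType) (T : Type) (r : seq T) (x : V) :
  \sum_(i <- r) x = x *+ size r.
Proof. by rewrite big_const_seq count_predT iter_addr_0. Qed.

Lemma sum_shift (V T : zmodType) (r : seq T) (g : T -> V) (u : T) :
  uniq r -> (forall x, g x != 0 -> x \in r) ->
  (forall x, g x != 0 -> x - u \in r) ->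
  \sum_(x <- r) g (x + u) = \sum_(x <- r) g x.
Proof.
move=> ur s1 s2; rewrite -[LHS](big_map (fun x => x + u) xpredT g).
apply: sum_supp => //.
- by rewrite map_inj_uniq //; exact: addIr.
- by move=> x _ /s1.
- by move=> x _ /s2 xr; apply/mapP; exists (x - u) => //; rewrite subrK.
Qed.

(** * Sums over boxes and Weyl differencing *)

Section Boxes.

Definition ibox (c : int) (B : nat) : seq int :=
  [seq c + (i%:Z - B%:Z) | i <- iota 0 (2 * B).+1].

Lemma ibox_uniq c B : uniq (ibox c B).
Proof.
by rewrite map_inj_uniq ?iota_uniq // => i j /addrI/addIr[].
Qed.

Lemma size_ibox c B : size (ibox c B) = (2 * B).+1.
Proof. by rewrite size_map size_iota. Qed.

Lemma mem_ibox c B n : (n \in ibox c B) = (`|n - c| <= B%:Z).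
Proof.
apply/mapP/idP => [ [j] | h].
  by rewrite mem_iota => /andP[_ h] ->; lia.
by exists (absz (n - c + B%:Z)); [rewrite mem_iota|]; lia.
Qed.

Context {d : nat}.
Implicit Types c n : 'cV[int]_d.

Definition box c (B : nat) : seq 'cV[int]_d :=
  [seq \col_i (c i 0 + ((f i : nat)%:Z - B%:Z))
    | f : {ffun 'I_d -> 'I_(2 * B).+1}].

Lemma box_uniq c B : uniq (box c B).
Proof.
rewrite map_inj_uniq ?enum_uniq // => f g /colP fg.
by apply/ffunP => i; move: (fg i); rewrite !mxE => /addrI/addIr[] /val_inj.
Qed.

Lemma size_box c B : size (box c B) = ((2 * B).+1 ^ d)%N.
Proof. by rewrite size_map -cardE card_ffun !card_ord. Qed.

Lemma mem_box c B n :
  reflect (forall i, `|n i 0 - c i 0| <= B%:Z) (n \in box c B).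
Proof.
apply: (iffP mapP) => [ [f _ -> i] | h].
  have H (k : nat) : (k < (2 * B).+1)%N -> `|k%:Z - B%:Z| <= B%:Z by lia.
  by rewrite mxE [X in X - _]addrC addrK; apply: H; exact: ltn_ord.
have hi i : (absz (n i 0 - c i 0 + B%:Z)%R < (2 * B).+1)%N by have := h i; lia.
exists [ffun i => Ordinal (hi i)]; first by rewrite mem_enum.
by apply/colP => i; rewrite mxE ffunE /=; have := h i; lia.
Qed.

Lemma sum_box_prod (V : comNzRingType) c B (g : 'I_d -> int -> V) :
  \sum_(n <- box c B) \prod_i g i (n i 0) =
  \prod_i \sum_(k <- ibox (c i 0) B) g i k.
Proof.
rewrite big_map big_enum /=.
under [RHS]eq_bigr => i _.
  rewrite big_map -{1}(subn0 (2 * B).+1) -/(index_iota 0 _) big_mkord.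
  over.
rewrite bigA_distr_bigA /=; apply: eq_bigr => f _.
by apply: eq_bigr => i _; rewrite mxE.
Qed.

End Boxes.

Section Weyl.
Context {R : realType}.

(* Expand the product of sums and collect the terms with m - n = u. *)
Lemma weyl (T : zmodType) (r D : seq T) (w1 w2 : T -> R[i]) :
  uniq r -> uniq D -> {in r &, forall m n, m - n \in D} ->
  (forall m, w1 m != 0 -> m \in r) ->
  normc (\sum_(m <- r) w1 m) * normc (\sum_(n <- r) w2 n) <=
  \sum_(u <- D) normc (\sum_(n <- r) w1 (n + u) * conjc (w2 n)).
Proof.
move=> ur uD rD s1; rewrite -(normc_conj (\sum_(n <- r) w2 n)) -normcM.
apply: le_trans (normc_sum _ _ _); rewrite le_eqVlt; apply/orP; left; apply/eqP; congr normc.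
rewrite rmorph_sum /= mulr_sumr exchange_big /= big_seq [RHS]big_seq.
apply: eq_bigr => n nr; rewrite mulr_suml.
rewrite -(big_map (fun u => n + u) xpredT (fun m => w1 m * conjc (w2 n))).
apply: sum_supp => //.
- by rewrite map_inj_uniq //; exact: addrI.
- move=> m mr _; apply/mapP; exists (m - n); first exact: rD.
  by rewrite addrC subrK.
- move=> m _; case: (eqVneq (w1 m) 0) => [->|/s1 //]; by rewrite mul0r eqxx.
Qed.

End Weyl.

(** * Second differences and linear exponential sums *)

Section SmoothSequences.
Context {R : realType}.
Implicit Types a b : int -> R.

(** The bounds satisfied by the samples at step 1/N of a fixed smooth function; order two is what
    two summations by parts consume. *)
Definition smooth2 (N K : R) a := forall n,
  [/\ `|a n| <= K, `|a (n + 1) - a n| <= K / N &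
      `|a (n + 2) - 2 * a (n + 1) + a n| <= K / N ^+ 2].

Lemma smooth2M N K L a b : 0 < N -> 0 <= K -> 0 <= L ->
  smooth2 N K a -> smooth2 N L b -> smooth2 N (4 * K * L) (fun n => a n * b n).
Proof.
move=> N0 K0 L0 sa sb n.
have [a0 a1 a2] := sa n; have [b0 b1 b2] := sb n.
have [a0' a1' _] := sa (n + 1); have [b0' b1' _] := sb (n + 1).
have [b0'' _ _] := sb (n + 2).
have {}b1' : `|b (n + 2) - b (n + 1)| <= L / N.
  by rewrite (_ : n + 2 = n + 1 + 1) // -addrA.
have M x y (X Y : R) : `|x| <= X -> `|y| <= Y -> `|x * y| <= X * Y.
  by move=> hx hy; rewrite normrM ler_pM.
have KL : 0 <= K * L by rewrite mulr_ge0.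
have E3 : K * L / N ^+ 2 = (K / N) * (L / N) by field; rewrite gt_eqF.
split.
- by apply: le_trans (M _ _ _ _ a0 b0) _; rewrite -mulrA; lra.
- have -> : a (n + 1) * b (n + 1) - a n * b n =
     (a (n + 1) - a n) * b (n + 1) + a n * (b (n + 1) - b n) by ring.
  apply: le_trans (ler_normD _ _) _.
  apply: le_trans (lerD (M _ _ _ _ a1 b0') (M _ _ _ _ a0 b1)) _.
  have -> : K / N * L + K * (L / N) = 2 * K * L / N by ring.
  rewrite ler_wpM2r ?invr_ge0 ?(ltW N0) //; lra.
- have -> : a (n + 2) * b (n + 2) - 2 * (a (n + 1) * b (n + 1)) + a n * b n =
     (a (n + 2) - 2 * a (n + 1) + a n) * b (n + 2) +
     2 * ((a (n + 1) - a n) * (b (n + 2) - b (n + 1))) +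
     a n * (b (n + 2) - 2 * b (n + 1) + b n) by ring.
  apply: le_trans (ler_normD _ _) _.
  apply: le_trans (lerD (ler_normD _ _) (lexx _)) _.
  have := M _ _ _ _ a1 b1'; have := M _ _ _ _ a2 b0''; have := M _ _ _ _ a0 b2.
  rewrite [`|2 * _|]normrM (ger0_norm (ler0n _ 2)).
  have -> : K / N ^+ 2 * L = K * L / N ^+ 2 by ring.
  have -> : K * (L / N ^+ 2) = K * L / N ^+ 2 by ring.
  rewrite -E3.
  have -> : 4 * K * L / N ^+ 2 = 4 * (K * L / N ^+ 2) by ring.
  lra.
Qed.

Lemma smooth2_shift N K a h : smooth2 N K a -> smooth2 N K (fun n => a (n + h)).
Proof. by move=> sa n; have := sa (n + h); rewrite !(addrAC n _ h). Qed.

(** The trivial bound 1 and the bound (N nu(b))^(-2) from two summations by parts, merged into one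
    formula. *)
Definition psi (N : R) (b : R) : R := (1 + N ^+ 2 * nu b ^+ 2)^-1.

Lemma psi_den_ge1 N (b : R) : 1 <= 1 + N ^+ 2 * nu b ^+ 2.
Proof. by rewrite lerDl mulr_ge0 ?sqr_ge0. Qed.

Lemma psi_den_gt0 N (b : R) : 0 < 1 + N ^+ 2 * nu b ^+ 2.
Proof. exact: lt_le_trans ltr01 (psi_den_ge1 _ _). Qed.

Lemma psi_gt0 N (b : R) : 0 < psi N b.
Proof. by rewrite invr_gt0 psi_den_gt0. Qed.

Lemma psi_le1 N (b : R) : psi N b <= 1.
Proof. by rewrite invf_le1 ?psi_den_ge1 // psi_den_gt0. Qed.

(* Summation by parts, twice. *)
Lemma lin_sum N K a (c : int) (B : nat) (b : R) : 0 < N -> 0 <= K ->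
  smooth2 N K a -> (forall n, a n != 0 -> n \in ibox c B) ->
  normc (\sum_(n <- ibox c B) (a n)%:C * ex (b * n%:~R)) <=
  2 * K * (2 * B + 5)%:R * psi N b.
Proof.
move=> N0 K0 sa supp.
set S := \sum_(n <- _) _.
(* A margin of 2 keeps the sequences shifted by 1 and 2 inside the range of summation. *)
have iboxS : {subset ibox c B <= ibox c (B + 2)}.
  by move=> n; rewrite !mem_ibox; lia.
have SE : S = \sum_(n <- ibox c (B + 2)) (a n)%:C * ex (b * n%:~R).
  apply: sum_supp; rewrite ?ibox_uniq//; first by move=> n /iboxS.
  move=> n _; case: (eqVneq (a n) 0) => [->|/supp //].
  by rewrite rmorph0 mul0r eqxx.
have sz : (size (ibox c (B + 2)))%:R = (2 * B + 5)%:R :> R.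
  by rewrite size_ibox; congr (_ %:R); lia.
have S1 : normc S <= K * (2 * B + 5)%:R.
  rewrite SE; apply: le_trans (normc_sum _ _ _) _.
  apply: (@le_trans _ _ (\sum_(n <- ibox c (B + 2)) K)).
    by apply: ler_sum => n _; rewrite normcM normc_ex mulr1 normcR; case: (sa n).
  by rewrite sumr_size -[_ *+ size _]mulr_natr; rewrite sz.
have S2 : N ^+ 2 * nu b ^+ 2 * normc S <= K * (2 * B + 5)%:R.
  (* Multiplication by (1 - e(b))^2 transfers a second difference to the coefficients. Adding the
     resulting bound to the trivial one produces [psi]. *)
  have E : (1 - ex b) ^+ 2 * S =
      \sum_(n <- ibox c (B + 2)) (a (n - 2 + 2) - 2 * a (n - 2 + 1) + a (n - 2))%:C
        * ex (b * n%:~R).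
    rewrite SE.
    under [RHS]eq_bigr => n _ do rewrite subrK rmorphD rmorphB rmorphM /= !mulrDl mulNr.
    rewrite big_split sumrB /=.
    have sh (k : int) : (0 <= k <= 2) ->
      \sum_(n <- ibox c (B + 2)) (a (n - k))%:C * ex (b * n%:~R) =
      ex (b * k%:~R) * \sum_(n <- ibox c (B + 2)) (a n)%:C * ex (b * n%:~R).
      move=> k2; rewrite mulr_sumr.
      rewrite -(@sum_shift _ _ _ (fun n => (a (n - k))%:C * ex (b * n%:~R)) k).
      - apply: eq_bigr => n _; rewrite addrK intrD mulrDr exD; ring.
      - exact: ibox_uniq.
      - move=> n; case: (eqVneq (a (n - k)) 0) => [->|/supp h _].
          by rewrite rmorph0 mul0r eqxx.
        by move: h; rewrite !mem_ibox; lia.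
      - move=> n; case: (eqVneq (a (n - k)) 0) => [->|/supp h _].
          by rewrite rmorph0 mul0r eqxx.
        by move: h; rewrite !mem_ibox; lia.
    have -> : \sum_(n <- ibox c (B + 2)) (2%:C * (a (n - 2 + 1))%:C) * ex (b * n%:~R)
       = 2 * (\sum_(n <- ibox c (B + 2)) (a (n - 1))%:C * ex (b * n%:~R)).
      rewrite mulr_sumr; apply: eq_bigr => n _.
      have -> : n - 2 + 1 = n - 1 by rewrite -addrA.
      by rewrite -mulrA; congr (_ * _); rewrite -(rmorph_nat (real_complex R)).
    have -> : \sum_(n <- ibox c (B + 2)) (a n)%:C * ex (b * n%:~R) = 
      \sum_(n <- ibox c (B + 2)) (a (n - 0))%:C * ex (b * n%:~R).
      by apply: eq_bigr => n _; rewrite subr0.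
    rewrite !sh // mulr0 ex0 mulr1 (_ : b * 2%:~R = b + b); last by ring.
    rewrite exD; ring.
  rewrite -mulrA -normcX -normcM E.
  apply: (@le_trans _ _ (N ^+ 2 * \sum_(n <- ibox c (B + 2)) K / N ^+ 2)).
    rewrite ler_wpM2l ?sqr_ge0 //; apply: le_trans (normc_sum _ _ _) _.
    apply: ler_sum => n _; rewrite normcM normc_ex mulr1 normcR.
    by have [] := sa (n - 2).
  rewrite sumr_size -[_ *+ size _]mulr_natr sz.
  by rewrite le_eqVlt; apply/orP; left; apply/eqP; field; rewrite gt_eqF.
rewrite /psi ler_pdivlMr ?psi_den_gt0 //.
by rewrite mulrDr mulr1 [normc S * _]mulrC; lra.
Qed.

End SmoothSequences.


(** * Quadratic phases *)

Section QuadraticForms.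
Context {R : realType} {d : nat}.
Implicit Types (Q : 'M[R]_d) (x y a : 'cV[R]_d) (n h u : 'cV[int]_d).

Definition emb n : 'cV[R]_d := map_mx intr n.

Lemma embE n j : emb n j 0 = (n j 0)%:~R. Proof. by rewrite mxE. Qed.

Lemma embD n h : emb (n + h) = emb n + emb h.
Proof. by apply/colP => j; rewrite !mxE intrD. Qed.

Lemma embN n : emb (- n) = - emb n.
Proof. by apply/colP => j; rewrite !mxE intrN. Qed.

Definition bil Q x y : R := \sum_j (Q *m x) j 0 * y j 0.

Lemma qform_bil Q x : qform Q x = bil Q x x.
Proof. by rewrite /qform mxE; apply: eq_bigr => j _; rewrite mxE. Qed.

Lemma bilDr Q x y z : bil Q x (y + z) = bil Q x y + bil Q x z.
Proof. by rewrite -big_split; apply: eq_bigr => j _; rewrite [(y + z) j 0]mxE mulrDr. Qed.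

Lemma bilNr Q x y : bil Q x (- y) = - bil Q x y.
Proof. by rewrite -sumrN; apply: eq_bigr => j _; rewrite [(- y) j 0]mxE mulrN. Qed.

Lemma bilZr Q x c y : bil Q x (c *: y) = c * bil Q x y.
Proof. by rewrite mulr_sumr; apply: eq_bigr => j _; rewrite [(c *: y) j 0]mxE mulrCA. Qed.

Lemma bilC Q x y : Q^T = Q -> bil Q x y = bil Q y x.
Proof.
move=> Qs; rewrite /bil.
under eq_bigr => j _ do rewrite mxE mulr_suml.
rewrite exchange_big /=; apply: eq_bigr => k _.
rewrite mxE mulr_suml; apply: eq_bigr => j _.
by rewrite -[in RHS]Qs [in RHS]mxE; ring.
Qed.

Lemma qformD Q x y : Q^T = Q ->
  qform Q (x + y) = qform Q x + 2 * bil Q x y + qform Q y.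
Proof.
move=> Qs; rewrite !qform_bil bilDr (bilC (x + y) x Qs) (bilC (x + y) y Qs) !bilDr.
by rewrite (bilC y x Qs); ring.
Qed.

(* The Weyl step for a smooth sum with a quadratic phase. *)
Lemma quad_sum (N K : R) (c : 'cV[int]_d) (B : nat) (w : 'I_d -> int -> R)
    (phi : 'cV[int]_d -> R) (beta : 'cV[int]_d -> 'I_d -> R)
    (gam : 'cV[int]_d -> R) :
  0 < N -> 0 <= K -> (forall j, smooth2 N K (w j)) ->
  (forall j (k : int), w j k != 0 -> k \in ibox (c j 0) B) ->
  (forall n h, phi (n + h) = phi n + \sum_j beta h j * (n j 0)%:~R + gam h) ->
  normc (\sum_(n <- box c B) (\prod_j w j (n j 0))%:C * ex (phi n)) ^+ 2 <=
  (8 * K * K * (2 * B + 5)%:R) ^+ d *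
  \sum_(h <- box 0 (2 * B)) \prod_j psi N (beta h j).
Proof.
move=> N0 K0 sw supp phiE.
set W := fun n : 'cV[int]_d => (\prod_j w j (n j 0))%:C * ex (phi n).
have Wsupp n : W n != 0 -> n \in box c B.
  move=> Wn; apply/mem_box => j; rewrite -mem_ibox; apply: supp.
  apply: contra Wn => /eqP wj0; rewrite /W (bigD1 j) //= wj0 mul0r.
  by rewrite rmorph0 mul0r.
rewrite (eq_bigr W) // expr2.
apply: le_trans (weyl W _ _ (D := box 0 (2 * B)) _ Wsupp) _.
- exact: box_uniq.
- exact: box_uniq.
- move=> m n /mem_box hm /mem_box hn; apply/mem_box => j; rewrite !mxE.
  have H (a b e : int) : `|a - e| <= B%:Z -> `|b - e| <= B%:Z ->
    `|a - b - 0| <= (2 * B)%:Z by lia.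
  exact: H (hm j) (hn j).
rewrite mulr_sumr; apply: ler_sum => h _.
(* Differencing leaves a phase that is linear in n, so that the sum over the box factors into
   one-dimensional sums. *)
have WE n : W (n + h) * conjc (W n) =
    ex (gam h) * \prod_j ((w j (n j 0 + h j 0) * w j (n j 0))%:C
                          * ex (beta h j * (n j 0)%:~R)).
  have WD m : W m = (\prod_j w j (m j 0))%:C * ex (phi m) by [].
  rewrite !WD; set p1 := \prod_j _; set p2 := \prod_j w j (n j 0).
  rewrite conjcM [conjc _%:C]conjc_real -exN mulrACA -realcM -exD phiE.
  rewrite big_split /= -realc_prod big_split /=.
  have -> : \prod_j w j (n j 0 + h j 0) = p1.
    by apply: eq_bigr => j _; rewrite mxE.
  have -> : \prod_j ex (beta h j * (n j 0)%:~R) = ex (\sum_j beta h j * (n j 0)%:~R).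
    elim/big_rec2: _ => [|j y1 y2 _ ->]; first by rewrite ex0.
    by rewrite exD.
  rewrite mulrCA -exD; congr (_ * ex _); ring.
under [X in normc X]eq_bigr => n _ do rewrite WE.
rewrite -mulr_sumr normcM normc_ex mul1r.
rewrite (sum_box_prod c B (fun j k => (w j (k + h j 0) * w j k)%:C
           * ex (beta h j * k%:~R))).
rewrite normc_prod -[X in X ^+ d]mul1r.
have -> : (1 * (8 * K * K * (2 * B + 5)%:R)) ^+ d =
    \prod_(j < d) (8 * K * K * (2 * B + 5)%:R).
  by rewrite prodr_const card_ord mul1r.
rewrite -big_split /=; apply: ler_prod => j _; rewrite normc_ge0 /=.
apply: le_trans (lin_sum (N := N) (K := 4 * K * K) _ _ _ _ _) _ => //.
- by rewrite !mulr_ge0.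
- by apply: smooth2M => //; exact: smooth2_shift.
- move=> n; case: (eqVneq (w j n) 0) => [->|/supp //].
  by rewrite mulr0 eqxx.
- by rewrite !mulrA -!natrM.
Qed.

End QuadraticForms.

Lemma sum_fiber (R : numDomainType) (T U : eqType) (r : seq T) (Y : seq U)
    (phi : T -> U) (v : U -> R) (K : nat) :
  uniq Y -> {in r, forall h, phi h \in Y} ->
  {in Y, forall y, (count (fun h => phi h == y) r <= K)%N} ->
  (forall y, 0 <= v y) ->
  \sum_(h <- r) v (phi h) <= K%:R * \sum_(y <- Y) v y.
Proof.
move=> uY rY cK v0.
have E : \sum_(h <- r) v (phi h) =
    \sum_(y <- Y) \sum_(h <- r) (if phi h == y then v y else 0).
  rewrite exchange_big /= big_seq [RHS]big_seq; apply: eq_bigr => h hr.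
  rewrite (bigD1_seq (phi h)) ?rY //= eqxx big1 ?addr0 // => y.
  by rewrite eq_sym => /negPf ->.
rewrite E mulr_sumr big_seq [leRHS]big_seq; apply: ler_sum => y yY.
rewrite -big_mkcond /= big_const_seq iter_addr_0 -[leLHS]mulr_natl.
by rewrite ler_wpM2r // ler_nat cK.
Qed.

Lemma sum_iboxS (V : nmodType) (B : nat) (f : int -> V) :
  \sum_(j <- ibox 0 B.+1) f j =
  f (- B.+1%:Z) + \sum_(j <- ibox 0 B) f j + f B.+1%:Z.
Proof.
rewrite /ibox !big_map.
have -> : (2 * B.+1).+1 = (1 + (2 * B).+1 + 1)%N by lia.
rewrite !iotaD !big_cat -[iota 0 1]/[:: 0%N].
rewrite -[iota (0 + (1 + (2 * B).+1)) 1]/[:: (1 + (2 * B).+1)%N] !big_seq1 !add0n.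
congr (f _ + _ + f _); [by rewrite !add0r | | by lia].
rewrite (iotaDl 1 0) big_map; apply: eq_bigr => k _.
by congr f; lia.
Qed.

Lemma sum_inv_sqr (R : realFieldType) (B : nat) :
  \sum_(j <- ibox 0 B) 3 / (1 + (j%:~R : R) ^+ 2) <= 15.
Proof.
rewrite -mulr_sumr.
(* Strengthened for the induction: the terms for n and -n are absorbed by 2 / (n - 1/2) - 2 / (n +
   1/2) = 2 / (n^2 - 1/4). The constant 5 gives equality at B = 0. *)
suff : \sum_(j <- ibox 0 B) (1 + (j%:~R : R) ^+ 2)^-1 <= 5 - 2 / (B%:R + 2^-1).
  have : 0 <= 2 / (B%:R + 2^-1) :> R by rewrite divr_ge0 ?addr_ge0.
  by lra.
elim: B => [|B IH].
  by rewrite -[ibox 0 0]/[:: 0] big_seq1 mulr0z expr0n addr0 invr1 mulr0n add0r invrK; lra.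
rewrite sum_iboxS mulrNz sqrrN addrAC.
apply: le_trans (lerD (lexx _) IH) _; rewrite -mulr2n -mulr_natl.
set n : R := (Posz B.+1)%:~R.
have nE : n = B%:R + 1 by rewrite natr1.
have B0 : (0 : R) <= B%:R by [].
have -> : (B.+1%:R : R) = n by [].
have -> : B%:R = n - 1 by rewrite nE; ring.
have n1 : 1 <= n by lra.
have -> : n - 1 + 2^-1 = n - 2^-1 by lra.
have h : 0 < n ^+ 2 - 4^-1 by nra.
have h' : 0 < 1 + n ^+ 2 by nra.
have E : 2 / (n - 2^-1) - 2 / (n + 2^-1) = 2 / (n ^+ 2 - 4^-1).
  by field; apply/and3P; split; apply: lt0r_neq0; nra.
suff : 2 * (1 + n ^+ 2)^-1 <= 2 / (n ^+ 2 - 4^-1) by lra.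
by rewrite ler_wpM2l // lef_pV2 ?posrE //; lra.
Qed.


(** * Counting lattice points h with 2 e Q h close to Z^d *)

Section Counting.
Context {R : realType} {d : nat}.
Implicit Types (Q : 'M[R]_d) (n h : 'cV[int]_d).

Lemma mulmx_bound (A : 'M[R]_d) : exists2 M : R, 0 < M &
  forall (x : 'cV[R]_d) (D : R), (forall j, `|x j 0| <= D) ->
    forall j, `|(A *m x) j 0| <= M * D.
Proof.
exists (1 + \sum_k \sum_j `|A k j|).
  by rewrite ltr_pwDl // sumr_ge0 // => k _; rewrite sumr_ge0.
move=> x D xD k; rewrite mxE.
have D0 : 0 <= D := le_trans (normr_ge0 _) (xD k).
apply: le_trans (ler_norm_sum _ _ _) _.
apply: (@le_trans _ _ ((\sum_j `|A k j|) * D)).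
  by rewrite mulr_suml; apply: ler_sum => j _; rewrite normrM ler_wpM2l.
have H : \sum_j `|A k j| <= \sum_k \sum_j `|A k j|.
  by rewrite [leRHS](bigD1 k) //= lerDl sumr_ge0 // => j _; rewrite sumr_ge0.
by rewrite ler_wpM2r // (le_trans H) // lerDr.
Qed.

Lemma size_close (r : seq 'cV[int]_d) (D : nat) : uniq r ->
  {in r &, forall h n, forall j, `|n j 0 - h j 0| <= D%:Z} ->
  (size r <= (2 * D).+1 ^ d)%N.
Proof.
case: r => [//|h0 r] ur close; rewrite -(size_box h0).
by apply: uniq_leq_size => // h hr; apply/mem_box; apply: close; rewrite ?mem_head.
Qed.

(** Replaces [psi] by a summable function of the cell of width 1/N that contains b modulo 1. A cell
    with negative index k only ensures |N * cfrac b| >= |k + 1|; the factor 3 pays for this. *)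
Lemma psi_cell (N b : R) (k : int) : 2 <= N -> Num.floor (N * cfrac b) = k ->
  psi N b <= 3 / (1 + k%:~R ^+ 2).
Proof.
move=> N2 <-; set x := N * cfrac b; set j := Num.floor x.
have /andP[jx xj] : j%:~R <= x < j%:~R + 1 by rewrite -intrD1 floor_itv.
have h : 4 * x ^+ 2 <= N ^+ 2 * nu b ^+ 2.
  rewrite /x exprMn mulrCA ler_wpM2l ?sqr_ge0 //.
  have h2 : (2 * `|cfrac b|) ^+ 2 <= nu b ^+ 2.
    by rewrite ler_pXn2r ?nnegrE ?nu_ge0 ?mulr_ge0 // nu_ge_cfrac.
  by apply: le_trans h2; rewrite exprMn real_normK ?num_real // -natrX.
rewrite ler_pdivlMr; last by rewrite ltr_wpDr ?sqr_ge0.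
rewrite mulrC ler_pdivrMr ?psi_den_gt0 //.
have : j <= -1 \/ 0 <= j by lia.
move: (N ^+ 2 * nu b ^+ 2) h => T h.
case; rewrite -(ler_int R) => j1.
  have : (j%:~R + 1) ^+ 2 <= x ^+ 2 by nra.
  by nra.
have : (j%:~R : R) ^+ 2 <= x ^+ 2 by nra.
by nra.
Qed.

(** What Weyl differencing leaves: up to constants and rapidly decaying tails, the number of h in
    the box for which 2 e Q h lies within 1/N of Z^d. *)
Definition cnt Q (N : R) (B : nat) (e : R) : R :=
  \sum_(h <- box 0 B) \prod_j psi N (2 * e * (Q *m emb h) j 0).

(** The points h are sorted by a spatial cell [bt] and by the cell [cl] of 2 e Q h modulo 1. There
    are O(1 + N e) spatial cells per coordinate. Two points with both cells in common differ by some
    g with 2 e Q g = O(1/N) as a real vector, so g = O(1/(N e)) by inverting Q. The sum over [cl]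
    converges by [sum_inv_sqr]. *)
Lemma cnt_bound Q (b0 : R) : Q \in unitmx -> 0 < b0 ->
  exists2 C : R, 0 < C & forall (N : R) (B : nat) (e : R), 2 <= N -> B%:R <= b0 * N -> 0 < e ->
    cnt Q N B e <= C * ((1 + N * e) * (1 + (N * e)^-1)) ^+ d.
Proof.
move=> Qu b00.
have [M M0 QM] := mulmx_bound Q.
have [M' M'0 QM'] := mulmx_bound (invmx Q).
pose C1 := 8 * b0 * M + 5; pose C2 := M' + 1.
have C10 : 0 < C1 by have := mulr_gt0 b00 M0; rewrite /C1; lra.
have C20 : 0 < C2 by rewrite /C2; lra.
exists ((C1 * C2 * 15) ^+ d); first by rewrite exprn_gt0 // !mulr_gt0.
move=> N B e N2 BN e0.
have N0 : 0 < N by lra.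
have Ne0 : 0 < N * e by rewrite mulr_gt0.
(* The spatial cells have side 1/e1, so small that 2 e Q g stays within 1/2 for the difference g of
   two points of a cell: residues modulo 1 then determine real differences. *)
pose e1 := 4 * M * e.
have e10 : 0 < e1 by rewrite !mulr_gt0.
pose bt h : 'cV[int]_d := \col_j Num.floor ((h j 0)%:~R * e1).
pose cl h : 'cV[int]_d := \col_j Num.floor (N * cfrac (2 * e * (Q *m emb h) j 0)).
pose B1 := (Num.truncn (B%:R * e1) + 2)%N.
pose B2 := (Num.truncn N + 1)%N.
pose D := Num.truncn (M' / (2 * e * N)).
pose Y := [seq (x, y) | x <- (box 0 B1 : seq 'cV[int]_d), y <- (box 0 B2 : seq 'cV[int]_d)].
pose v (y : 'cV[int]_d * 'cV[int]_d) : R := \prod_j (3 / (1 + (y.2 j 0)%:~R ^+ 2)).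
have B1E : (2 * B1).+1%:R <= C1 * (1 + N * e).
  have : (Num.truncn (B%:R * e1))%:R <= B%:R * e1 by rewrite truncn_le mulr_ge0 // ltW.
  have : B%:R * e1 <= b0 * N * e1 by rewrite ler_wpM2r // ltW.
  have : 0 <= b0 * M by rewrite mulr_ge0 // ltW.
  have -> : (2 * B1).+1%:R = 2 * (Num.truncn (B%:R * e1))%:R + 5 :> R.
    by rewrite -natrM -natrD; congr _%:R; rewrite /B1; clear; lia.
  by rewrite /C1 /e1; lra.
have DE : (2 * D).+1%:R <= C2 * (1 + (N * e)^-1).
  have : D%:R <= M' / (2 * e * N) by rewrite truncn_le divr_ge0 ?ltW // ?mulr_gt0.
  have -> : M' / (2 * e * N) = 2^-1 * M' * (N * e)^-1.
    by field; rewrite !gt_eqF.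
  have : 0 <= (N * e)^-1 by rewrite invr_ge0 ltW.
  have -> : (2 * D).+1%:R = 2 * D%:R + 1 :> R by rewrite -natrM natr1.
  by rewrite /C2; lra.
have v0 y : 0 <= v y.
  by apply: prodr_ge0 => j _; rewrite divr_ge0 // addr_ge0 ?sqr_ge0.
have step1 : cnt Q N B e <= \sum_(h <- box 0 B) v (bt h, cl h).
  apply: ler_sum => h _; apply: ler_prod => j _.
  by rewrite ltW ?psi_gt0 //=; apply: psi_cell => //; rewrite [RHS]mxE.
have step2 : \sum_(h <- box 0 B) v (bt h, cl h) <=
    ((2 * D).+1 ^ d)%:R * \sum_(y <- Y) v y.
  apply: (@sum_fiber R _ _ (box 0 B) Y (fun h => (bt h, cl h)) v) => //.
  - by apply: allpairs_uniq; rewrite ?box_uniq // => -[? ?] [? ?] _ _ /= [-> ->].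
  - move=> k /mem_box hB; apply/allpairsP; exists (bt k, cl k); split => //=.
      apply/mem_box => j; rewrite !mxE subr0.
      have := hB j; rewrite mxE subr0 => hj.
      have hj' : `|(k j 0)%:~R| <= B%:R :> R.
        by rewrite -intr_norm; move: hj; rewrite -(ler_int R).
      have hj1 : `|(k j 0)%:~R * e1| <= B%:R * e1.
        by rewrite normrM (gtr0_norm e10) ler_wpM2r // ltW.
      have := truncnS_gt (B%:R * e1); rewrite -natr1 => ht.
      rewrite -(ler_int R) intr_norm.
      have /andP[f1 f2] := floor_itv ((k j 0)%:~R * e1).
      move: f2 hj1; rewrite intrD ler_norml => f2 /andP[f3 f4].
      rewrite ler_norml /B1 PoszD intrD /=; apply/andP; split; rewrite -?[(Posz _)%:~R]/(_%:R); lra.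
    apply/mem_box => j; rewrite !mxE subr0.
    set x := cfrac _; have xb : `|x| <= 2^-1 by exact: cfrac_bound.
    have hj1 : `|N * x| <= N.
      by rewrite normrM (gtr0_norm N0) ler_piMr ?ltW //; lra.
    have := truncnS_gt N; rewrite -natr1 => ht.
    rewrite -(ler_int R) intr_norm.
    have /andP[f1 f2] := floor_itv (N * x).
    move: f2 hj1; rewrite intrD ler_norml => f2 /andP[f3 f4].
    have : `|N * x| <= N * 2^-1 by rewrite normrM (gtr0_norm N0) ler_wpM2l // ltW.
    rewrite ler_norml => /andP[g1 g2].
    by rewrite ler_norml /B2 PoszD intrD /=; apply/andP; split; rewrite -?[(Posz _)%:~R]/(_%:R); lra.
  - move=> y _; rewrite -size_filter; apply: size_close; first by rewrite filter_uniq ?box_uniq.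
    move=> h n; rewrite !mem_filter => /andP[/eqP <- _] /andP[/eqP [/colP bE /colP cE] _].
    pose g : 'cV[R]_d := emb n - emb h.
    have gE j : g j 0 = (n j 0 - h j 0)%:~R by rewrite !mxE intrB.
    have fl (x z : R) : Num.floor x = Num.floor z -> `|x - z| < 1.
      move=> xz; have /andP[x1 x2] := floor_itv x; have /andP[z1 z2] := floor_itv z.
      by move: x2 z2; rewrite xz in x1 *; rewrite intrD ltr_norml; lra.
    have g1 j : `|g j 0| <= e1^-1.
      have := bE j; rewrite !mxE => /fl; rewrite -mulrBl -intrB -gE normrM.
      by rewrite (gtr0_norm e10) -ltr_pdivlMr // div1r => /ltW.
    have g2 j : `|2 * e * (Q *m g) j 0| <= 2^-1.
      have := QM _ _ g1 j; rewrite normrM gtr0_norm ?mulr_gt0 // => /(ler_wpM2l (ltW e0)).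
      have -> : e * (M * e1^-1) = 4^-1 by rewrite /e1; field; rewrite !gt_eqF.
      lra.
    have g3 j : `|(Q *m g) j 0| <= (2 * e * N)^-1.
      set b1 := 2 * e * (Q *m emb n) j 0; set b2 := 2 * e * (Q *m emb h) j 0.
      have := cE j; rewrite [cl n j 0]mxE [cl h j 0]mxE -/b1 -/b2 => /fl.
      rewrite -mulrBr normrM (gtr0_norm N0) -ltr_pdivlMl // mulr1 => clt.
      have E : 2 * e * (Q *m g) j 0 = b1 - b2.
        have mxB (x1 x2 : 'cV[R]_d) : (x1 - x2) j 0 = x1 j 0 - x2 j 0 by rewrite !mxE.
        by rewrite /b1 /b2 /g mulmxBr mxB mulrBr.
      have [z zE] : exists z : int, b1 - b2 = cfrac b1 - cfrac b2 + z%:~R.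
        exists (Num.floor (b1 + 2^-1) - Num.floor (b2 + 2^-1)).
        by rewrite /cfrac intrB; ring.
      (* The phases differ by at most 1/2 and their centred residues by less than 1/N <= 1/2, which
         leaves no room for a nonzero integer. *)
      have z0 : z = 0.
        have Ninv : N^-1 <= 2^-1 by rewrite lef_pV2 ?posrE.
        have zlt : `|z%:~R| < 1 :> R.
          have -> : z%:~R = (b1 - b2) - (cfrac b1 - cfrac b2) by rewrite zE; ring.
          apply: le_lt_trans (ler_normB _ _) _.
          by have := g2 j; rewrite E; lra.
        by move: zlt; rewrite -intr_norm -[1]/(1%:~R) ltr_int; clear; lia.
      move: zE; rewrite z0 addr0 -E => zE; move: clt; rewrite -zE normrM gtr0_norm ?mulr_gt0 //.
      by rewrite -ltr_pdivlMl ?mulr_gt0 // -invfM => /ltW.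
    move=> j; have := QM' _ _ g3 j; rewrite mulKmx // gE.
    rewrite -intr_norm => hh.
    have hD := truncnS_gt (M' / (2 * e * N)).
    move: (le_lt_trans hh hD); rewrite -/D pmulrn ltr_int.
    have H (z : int) (k : nat) : `|z| < k.+1%:Z -> `|z| <= k%:Z by clear; lia.
    exact: H.
have step3 : \sum_(y <- Y) v y <= ((2 * B1).+1 ^ d)%:R * 15 ^+ d.
  rewrite big_allpairs_dep /=.
  under eq_bigr => x _ do rewrite (sum_box_prod 0 B2 (fun j k => 3 / (1 + (k%:~R : R) ^+ 2))).
  rewrite sumr_size size_box mulr_natl lerMn2r; apply/orP; right.
  rewrite -[X in 15 ^+ X]card_ord -prodr_const; apply: ler_prod => j _.
  rewrite sumr_ge0 /= => [|k _]; last by rewrite divr_ge0 // addr_ge0 ?sqr_ge0.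
  by rewrite mxE sum_inv_sqr.
apply: (le_trans step1); apply: (le_trans step2).
apply: (@le_trans _ _ (((2 * D).+1 ^ d)%:R * (((2 * B1).+1 ^ d)%:R * 15 ^+ d))).
  by rewrite ler_wpM2l.
have P0 : 0 <= 1 + N * e by rewrite addr_ge0 // ltW.
have S0 : 0 <= 1 + (N * e)^-1 by rewrite addr_ge0 // invr_ge0 ltW.
rewrite !natrX -!exprMn; apply: lerXn2r; rewrite ?nnegrE.
- by rewrite !mulr_ge0.
- by rewrite !mulr_ge0 // ltW.
have := ler_pM (ler0n _ _) (ler0n _ _) B1E DE.
set X := (2 * D).+1%:R; set X' := (2 * B1).+1%:R => h.
have -> : X * (X' * 15) = X' * X * 15 by ring.
have -> : C1 * C2 * 15 * ((1 + N * e) * (1 + (N * e)^-1)) =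
  C1 * (1 + N * e) * (C2 * (1 + (N * e)^-1)) * 15 by ring.
by rewrite ler_wpM2r.
Qed.

End Counting.


(** * The smooth weight *)

Section DifferenceBounds.
Context {R : realType}.
Implicit Types (A B r : R) (y z : nat -> R[i]) (p n : nat).

(* [db p A r y]: the iterated differences of [y 0, ..., y p] of order j are
   bounded by [A * r ^ j]. *)
Fixpoint db p A r y : Prop :=
  (forall n, (n <= p)%N -> normc (y n) <= A) /\
  match p with
  | 0 => True
  | p'.+1 => db p' (A * r) r (fun n => y n.+1 - y n)
  end.

Lemma db_norm p A r y n : db p A r y -> (n <= p)%N -> normc (y n) <= A.
Proof. by case: p => [|p] [h _]; exact: h. Qed.

Lemma db_ge0 p A r y : db p A r y -> 0 <= A.
Proof. by move=> /db_norm h; exact: le_trans (normc_ge0 _) (h 0%N _). Qed.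

Lemma db_ext p A r y z : (forall n, (n <= p)%N -> y n = z n) ->
  db p A r y -> db p A r z.
Proof.
elim: p A y z => [|p IH] A y z yz /= [h1 h2].
  by split=> // n np; rewrite -yz // h1.
split=> [n np|]; first by rewrite -yz // h1.
by apply: IH h2 => n np; rewrite !yz // ltnW.
Qed.

Lemma db_le p A r B s y : 0 <= r -> A <= B -> r <= s ->
  db p A r y -> db p B s y.
Proof.
move=> r0; elim: p A B y => [|p IH] A B y AB rs /= [h1 h2].
  by split=> // n np; apply: le_trans (h1 n np) AB.
split=> [n np|]; first exact: le_trans (h1 n np) AB.
by apply: IH h2 => //; apply: ler_pM => //; exact: le_trans (normc_ge0 _) (h1 0%N _).
Qed.

Lemma dbD p A B r y z : db p A r y -> db p B r z ->
  db p (A + B) r (fun n => y n + z n).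
Proof.
elim: p A B y z => [|p IH] A B y z /= [y1 y2] [z1 z2].
  split=> // n np; apply: le_trans (normc_triangle _ _) (lerD _ _); auto.
split=> [n np|].
  by apply: le_trans (normc_triangle _ _) (lerD _ _); auto.
rewrite mulrDl; apply: db_ext (IH _ _ _ _ y2 z2) => n _; ring.
Qed.

Lemma db_pred p A r y : db p.+1 A r y -> db p A r y.
Proof.
elim: p A y => [|p IH] A y [h1 h2].
  by split=> // n np; apply: h1; exact: leqW.
by split=> [n np|]; [apply: h1; exact: leqW|exact: IH].
Qed.

Lemma db_shift p A r y : db p.+1 A r y -> db p A r (fun n => y n.+1).
Proof.
elim: p A y => [|p IH] A y [h1 h2]; first by split=> // n np; exact: h1.
by split=> [n np|]; [exact: h1|exact: (IH _ (fun n => y n.+1 - y n))].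
Qed.

(** Discrete Leibniz rule: each differencing splits a product into two products, whence 2 ^ p. *)
Lemma dbM p A B r y z : 0 <= r -> db p A r y -> db p B r z ->
  db p (2 ^+ p * (A * B)) r (fun n => y n * z n).
Proof.
move=> r0; elim: p A B y z => [|p IH] A B y z hy hz.
  split=> // n np; rewrite expr0 mul1r normcM.
  by apply: ler_pM; rewrite ?normc_ge0 // ?(db_norm hy) ?(db_norm hz).
have A0 := db_ge0 hy; have B0 := db_ge0 hz.
split=> [n np|].
  rewrite normcM; apply: (@le_trans _ _ (A * B)).
    by apply: ler_pM; rewrite ?normc_ge0 // ?(db_norm hy) ?(db_norm hz).
  by rewrite ler_peMl ?mulr_ge0 // exprn_ege1 // ler1n.
have -> : 2 ^+ p.+1 * (A * B) * r =
    2 ^+ p * (A * r * B) + 2 ^+ p * (A * (B * r)) by rewrite exprS; ring.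
apply: db_ext (dbD (IH _ _ _ _ hy.2 (db_shift hz)) (IH _ _ _ _ (db_pred hy) hz.2)).
by move=> n _ /=; ring.
Qed.

Lemma db0 p A r : 0 <= A -> 0 <= r -> db p A r (fun=> 0).
Proof.
elim: p A => [|p IH] A A0 r0; first by split=> // n _; rewrite normc0.
split=> [n _|]; first by rewrite normc0.
by apply: db_ext (IH _ (mulr_ge0 A0 r0) r0) => n _; rewrite subrr.
Qed.

Lemma db_const p A r (c : R[i]) : normc c <= A -> 0 <= r -> db p A r (fun=> c).
Proof.
move=> cA r0; have A0 : 0 <= A := le_trans (normc_ge0 _) cA.
case: p => [|p]; first by split.
split=> //; apply: db_ext (db0 p (mulr_ge0 A0 r0) r0) => n _.
by rewrite subrr.
Qed.

(** Each differencing at most doubles the supremum while the permitted bound shrinks by r <= 1, so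
    the condition at the top order p implies the others. *)
Lemma db_small p A r e y : 0 <= r <= 1 -> 0 <= A ->
  (forall n, (n <= p)%N -> normc (y n) <= e) ->
  2 ^+ p * e <= A * r ^+ p -> db p A r y.
Proof.
move=> /andP[r0 r1]; elim: p A e y => [|p IH] A e y A0 ye eA.
  by split=> // n np; apply: le_trans (ye n np) _; move: eA; rewrite !expr0 mulr1 mul1r.
have e0 : 0 <= e := le_trans (normc_ge0 _) (ye 0%N isT).
split=> [n np|].
  apply: le_trans (ye n np) _; apply: (@le_trans _ _ (2 ^+ p.+1 * e)).
    by rewrite ler_peMl // exprn_ege1 // ler1n.
  by apply: le_trans eA _; rewrite ler_piMr // exprn_ile1.
apply: (IH _ (e + e)); first by rewrite mulr_ge0.
  move=> n np; apply: le_trans (normc_triangle _ _) _; rewrite normcN.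
  by apply: lerD; apply: ye => //; exact: leqW.
by move: eA; rewrite !exprS -mulr2n -mulr_natl; lra.
Qed.

Lemma db_big p A r e y : 1 <= r -> (forall n, (n <= p)%N -> normc (y n) <= e) ->
  2 ^+ p * e <= A -> db p A r y.
Proof.
move=> r1; elim: p A e y => [|p IH] A e y ye eA.
  by split=> // n np; apply: le_trans (ye n np) _; move: eA; rewrite expr0 mul1r.
have e0 : 0 <= e := le_trans (normc_ge0 _) (ye 0%N isT).
split=> [n np|].
  apply: le_trans (ye n np) (le_trans _ eA).
  by rewrite ler_peMl // exprn_ege1 // ler1n.
have A0 : 0 <= A by apply: le_trans eA; rewrite mulr_ge0 ?exprn_ge0.
apply: (IH _ (e + e)).
  move=> n np; apply: le_trans (normc_triangle _ _) _; rewrite normcN.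
  by apply: lerD; apply: ye => //; exact: leqW.
apply: (@le_trans _ _ A); last by rewrite ler_peMr.
by move: eA; rewrite !exprS -mulr2n -mulr_natl; lra.
Qed.

Lemma db_ex_lin p A r (c : R[i]) (al be : R) : 0 <= r -> normc (ex al - 1) <= r ->
  normc c <= A -> db p A r (fun n => c * ex (al * n%:R + be)).
Proof.
move=> r0 ar; elim: p A c => [|p IH] A c cA.
  by split=> // n _; rewrite normcM normc_ex mulr1.
split=> [n _|]; first by rewrite normcM normc_ex mulr1.
have /IH : normc (c * (ex al - 1)) <= A * r by rewrite normcM ler_pM ?normc_ge0.
apply: db_ext => n _.
have -> : al * n.+1%:R + be = al * n%:R + be + al by rewrite -natr1; ring.
by rewrite (exD _ al); ring.
Qed.

(** The difference of e(quadratic) is the same sequence times e(linear) - 1, a factor of size r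
    whose own differences gain r each time; [dbM] then drives an induction on p. The constant
    satisfies 2^p * 2^(p p) <= 2^((p + 1)^2), which absorbs the Leibniz factor. *)
Lemma db_ex p r (c0 c1 c2 : R) : 0 <= r <= 1 ->
  (forall n, (n <= p)%N -> 2 * pi * `|c1 + c2 * (2 * n%:R + 1)| <= r) ->
  2 * pi * `|2 * c2| <= r ^+ 2 ->
  db p (2 ^+ (p * p)) r (fun n => ex (c0 + c1 * n%:R + c2 * n%:R ^+ 2)).
Proof.
move=> /andP[r0 r1]; elim: p => [|p IH] h1 h2.
  by split=> // n _; rewrite normc_ex expr0.
split=> [n _|]; first by rewrite normc_ex exprn_ege1 // ler1n.
have nu_ex (x : R) : normc (ex x - 1) <= 2 * pi * `|x|.
  by rewrite normcB; exact: nu_le.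
have rr : r ^+ 2 <= r by rewrite expr2 ler_piMr.
have hz : db p r r (fun n => ex (c1 + c2 * (2 * n%:R + 1)) - 1).
  case: p {IH} h1 => [|p] h1.
    by split=> // n n0; apply: le_trans (nu_ex _) (h1 n (leqW n0)).
  split=> [n np|]; first exact: le_trans (nu_ex _) (h1 n (leqW np)).
  have := @db_ex_lin p (r * r) r (ex (2 * c2) - 1) (2 * c2) (c1 + c2) r0
    (le_trans (nu_ex _) (le_trans h2 rr)) (le_trans (nu_ex _) h2).
  apply: db_ext => n _.
  have -> : c1 + c2 * (2 * n.+1%:R + 1) = (2 * c2) * n%:R + (c1 + c2) + 2 * c2.
    by rewrite -[n.+1%:R]natr1; ring.
  have -> : c1 + c2 * (2 * n%:R + 1) = (2 * c2) * n%:R + (c1 + c2) by ring.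
  by set b := _ + (c1 + c2); rewrite (exD b); ring.
have hy := IH (fun n np => h1 n (leqW np)) h2.
have H := dbM r0 hy hz.
have : 2 ^+ p * (2 ^+ (p * p) * r) <= 2 ^+ (p.+1 * p.+1) * r.
  by rewrite mulrA -exprD ler_wpM2r // ler_weXn2l ?ler1n //; lia.
move=> /(@db_le p _ r _ r _ r0)/(_ (lexx _) H).
apply: db_ext => n _.
have -> : c0 + c1 * n.+1%:R + c2 * n.+1%:R ^+ 2 =
  (c0 + c1 * n%:R + c2 * n%:R ^+ 2) + (c1 + c2 * (2 * n%:R + 1)).
  by rewrite -[n.+1%:R]natr1; ring.
by set b := c0 + _ + _; rewrite (exD b); ring.
Qed.

End DifferenceBounds.

Section Weight.
Context {R : realType}.
Implicit Types (x h : R).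

Definition tp x : R := (Num.max x 0) ^+ 4.

(* The integrated cubic B-spline: 0 for x <= 0 and 1 for 4 <= x. *)
Definition sg x : R :=
  (tp x - 4 * tp (x - 1) + 6 * tp (x - 2) - 4 * tp (x - 3) + tp (x - 4)) / 24.

(** A bump equal to 1 on [-1, 1] and 0 where |x| >= 5; squaring makes its sign evident. *)
Definition om x : R := (sg (x + 5) * sg (5 - x)) ^+ 2.

Lemma tp_pos x : 0 <= x -> tp x = x ^+ 4.
Proof. by move=> x0; rewrite /tp max_l. Qed.

Lemma tp_neg x : x <= 0 -> tp x = 0.
Proof. by move=> x0; rewrite /tp max_r // expr0n. Qed.

Lemma sg_neg x : x <= 0 -> sg x = 0.
Proof. by move=> x0; rewrite /sg !tp_neg ?mulr0 ?addr0 ?subr0 ?mul0r //; lra. Qed.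

Lemma sg_ge4 x : 4 <= x -> sg x = 1.
Proof. by move=> x0; rewrite /sg !tp_pos; [field|lra..]. Qed.

Lemma om_ge0 x : 0 <= om x. Proof. exact: sqr_ge0. Qed.

Lemma om_in x : `|x| <= 1 -> om x = 1.
Proof.
by rewrite ler_norml => /andP[h1 h2]; rewrite /om !sg_ge4 ?mulr1 ?expr1n //; lra.
Qed.

Lemma om_out x : 5 <= `|x| -> om x = 0.
Proof.
rewrite /om; have [x0|x0] := leP 0 x; last first.
  by rewrite ltr0_norm // => h; rewrite sg_neg ?mul0r ?expr0n //; lra.
by rewrite ger0_norm // => h; rewrite (@sg_neg (5 - x)) ?mulr0 ?expr0n //; lra.
Qed.

(** If the five samples are all nonnegative, [tp] is the polynomial x^4 along them. If one is
    negative, then x <= 4 |h| and all five values are at most (8 |h|)^4, small enough for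
    [db_small]; this explains the summand 16 * 8^4. *)
Lemma tp_db : exists2 A : R, 0 <= A & forall x h, `|h| <= 1 -> x <= 8 ->
  db 4 A `|h| (fun n => (tp (x + n%:R * h))%:C).
Proof.
pose A1 : R := 2 ^+ 4 * ((2 ^+ 4 * (12 * 12)) * (2 ^+ 4 * (12 * 12))).
exists (A1 + 16 * 8 ^+ 4) => [|x h h1 x8]; first by rewrite /A1; lra.
have h0 : 0 <= `|h| by [].
have hn (n : nat) : (n <= 4)%N -> `|n%:R * h| <= 4 * `|h|.
  by move=> n4; rewrite normrM ler_wpM2r // ger0_norm // ler_nat.
have [xp|] := boolP [forall n : 'I_5, 0 <= x + n%:R * h].
  have x0 : 0 <= x by have /forallP/(_ ord0) := xp; rewrite mul0r addr0.
  have hl : db 4 12 `|h| (fun n => (x + n%:R * h)%:C).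
    split=> [n n4|].
      rewrite normcR; apply: le_trans (ler_normD _ _) _.
      by have := hn n n4; rewrite (ger0_norm x0); lra.
    have : db 3 (12 * `|h|) `|h| (fun=> h%:C).
      by apply: db_const => //; rewrite normcR; lra.
    apply: db_ext => n _; rewrite -rmorphB /=; congr (_%:C).
    by rewrite -[n.+1%:R]natr1; ring.
  have H2 := dbM h0 hl hl; have H4 := dbM h0 H2 H2.
  have : A1 <= A1 + 16 * 8 ^+ 4 by lra.
  move=> /(@db_le _ _ _ _ _ `|h| _ h0)/(_ (lexx _) H4).
  apply: db_ext => n n4; rewrite -!realcM tp_pos; first by congr (_%:C); ring.
  by have /forallP/(_ (Ordinal (n4 : (n < 5)%N))) := xp.
rewrite negb_forall => /existsP[[n n5]]; rewrite -ltNge => xn.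
have {}xn : x + n%:R * h < 0 := xn.
have [xh|xh] := leP x (4 * `|h|); last first.
  by have := hn n n5; rewrite ler_norml => /andP[]; lra.
apply: (@db_small _ _ _ _ (8 ^+ 4 * `|h| ^+ 4)).
- by rewrite h0 h1.
- by rewrite /A1; lra.
- move=> m m4; rewrite normcR -exprMn /tp normrX.
  apply: lerXn2r; rewrite ?nnegrE ?mulr_ge0 //.
  have := hn m m4; rewrite ler_norml => /andP[b1 b2].
  have [y0|y0] := leP 0 (x + m%:R * h); last by rewrite normr0 mulr_ge0.
  by rewrite ger0_norm //; lra.
- by rewrite mulrA ler_wpM2r ?exprn_ge0 // /A1; lra.
Qed.

Lemma sg_db : exists2 A : R, 0 <= A & forall x h, `|h| <= 1 ->
  db 4 A `|h| (fun n => (sg (x + n%:R * h))%:C).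
Proof.
have [A A0 HA] := tp_db.
exists (1 + 16 * 5 * A) => [|x h h1]; first by rewrite addr_ge0 // !mulr_ge0.
have h0 : 0 <= `|h| by [].
have hn (n : nat) : (n <= 4)%N -> `|n%:R * h| <= 4.
  move=> n4; rewrite normrM; apply: (@le_trans _ _ (4 * 1)); last by rewrite mulr1.
  by apply: ler_pM => //; rewrite ger0_norm // ler_nat.
(* Beyond 8 the five samples all lie above 4, where [sg] is constant. *)
have [x8|x8] := leP x 8; last first.
  have : db 4 (1 + 16 * 5 * A) `|h| (fun=> 1%:C).
    by apply: db_const => //; rewrite normcR normr1 lerDl !mulr_ge0.
  apply: db_ext => n n4; rewrite sg_ge4 //.
  by have := hn n n4; rewrite ler_norml => /andP[]; lra.
have T (c k : R) : `|c| <= 1 -> 0 <= k -> db 4 (2 ^+ 4 * (1 * A)) `|h|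
    (fun n => (c * tp (x - k + n%:R * h))%:C).
  move=> c1 k0; have c0 : db 4 1 `|h| (fun=> c%:C).
    by apply: db_const => //; rewrite normcR.
  have xk : x - k <= 8 by lra.
  apply: db_ext (dbM h0 c0 (HA (x - k) h h1 xk)) => n _.
  by rewrite -realcM.
have c1 : `|24^-1| <= 1 :> R by rewrite ger0_norm; lra.
have c2 : `|- 4 / 24| <= 1 :> R by rewrite ler_norml; lra.
have c3 : `|6 / 24| <= 1 :> R by rewrite ler_norml; lra.
have [k0 k1 k2 k3 k4] : [/\ 0 <= 0 :> R, 0 <= 1 :> R, 0 <= 2 :> R, 0 <= 3 :> R & 0 <= 4 :> R].
  by [].
have := dbD (dbD (dbD (dbD (T _ _ c1 k0) (T _ _ c2 k1)) (T _ _ c3 k2))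
   (T _ _ c2 k3)) (T _ _ c1 k4).
set A' := _ + _ => H.
have : A' <= 1 + 16 * 5 * A by rewrite /A'; lra.
move=> /(@db_le _ _ _ _ _ `|h| _ h0)/(_ (lexx _) H).
apply: db_ext => n _; rewrite -!rmorphD /=; congr (_%:C).
rewrite /sg subr0 !(addrAC x _ (n%:R * h)); ring.
Qed.

Lemma om_bounded : exists2 C : R, 0 <= C & forall x, `|om x| <= C.
Proof.
have [A A0 HA] := sg_db.
have sgA x : `|sg x| <= A.
  have h0 : `|0 : R| <= 1 by rewrite normr0.
  by have /db_norm/(_ (leq0n 4)) := HA x 0 h0; rewrite normcR mulr0 addr0.
exists ((A * A) ^+ 2) => [|x]; first exact: sqr_ge0.
by rewrite /om normrX lerXn2r ?nnegrE ?mulr_ge0 // normrM ler_pM.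
Qed.

(** Small steps are handled by [sg_db] and the Leibniz rule; for |h| > 1 boundedness of [om]
    suffices. *)
Lemma om_db : exists2 A : R, 1 <= A & forall x h,
  db 4 A `|h| (fun n => (om (x + n%:R * h))%:C).
Proof.
have [A A0 HA] := sg_db; have [C C0 HC] := om_bounded.
pose B : R := 2 ^+ 4 * (A * A).
exists (1 + 2 ^+ 4 * C + 2 ^+ 4 * (B * B)) => [|x h].
  by rewrite -addrA lerDl addr_ge0 // mulr_ge0 ?exprn_ge0 // -expr2 sqr_ge0.
have h0 : 0 <= `|h| by [].
have BB0 : 0 <= B * B by rewrite -expr2 sqr_ge0.
have [h1|h1] := leP `|h| 1; last first.
  apply: (@db_big _ _ _ _ C); [exact: ltW | by move=> n _; rewrite normcR|].
  by lra.
have H1 := HA (x + 5) h h1.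
have hN : `|- h| <= 1 by rewrite normrN.
have := HA (5 - x) (- h) hN; rewrite normrN => H2.
have H3 := dbM h0 H1 H2; have := dbM h0 H3 H3; rewrite -/B => H4.
have : 2 ^+ 4 * (B * B) <= 1 + 2 ^+ 4 * C + 2 ^+ 4 * (B * B) by lra.
move=> /(@db_le _ _ _ _ _ `|h| _ h0)/(_ (lexx _) H4).
apply: db_ext => n _; rewrite -!realcM /om; congr (_%:C).
have -> : x + n%:R * h + 5 = x + 5 + n%:R * h by ring.
have -> : 5 - (x + n%:R * h) = 5 - x + n%:R * - h by ring.
by rewrite expr2.
Qed.

End Weight.


(** * Theta sums *)

Section Theta.
Context {R : realType} {d : nat}.
Variable (Q : 'M[R]_d).
Implicit Types (a x : 'cV[R]_d) (n h u : 'cV[int]_d) (N t : R).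

Definition ctr a : 'cV[int]_d := \col_j Num.floor (a j 0).

(** The weight lives on |x| <= 5 N; the extra 1 makes up for rounding the centre a down to
    [ctr a]. *)
Definition brad N : nat := (Num.truncn (5 * N) + 1)%N.

Definition wt N x : R := \prod_j om (x j 0 / N).

Definition theta_term N t x : R[i] := (wt N x)%:C * ex (t * qform Q x).

Definition theta N a t : R[i] :=
  \sum_(n <- box (ctr a) (brad N)) theta_term N t (emb n - a).

Lemma brad_le N : 1 <= N -> (brad N)%:R <= 6 * N.
Proof.
move=> N1; rewrite /brad natrD.
have : (Num.truncn (5 * N))%:R <= 5 * N by rewrite truncn_le; lra.
by lra.
Qed.

Lemma om_supp N (al : R) (k : int) : 0 < N ->
  om ((k%:~R - al) / N) != 0 -> k \in ibox (Num.floor al) (brad N).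
Proof.
move=> N0 om0; rewrite mem_ibox.
have h : `|k%:~R - al| < 5 * N.
  have [//|h] := ltP `|k%:~R - al| (5 * N).
  move: om0; rewrite om_out ?eqxx // normrM normfV (gtr0_norm N0).
  by rewrite ler_pdivlMr.
have h2 := truncnS_gt (5 * N); have /andP[f1 f2] := floor_itv al.
rewrite -ltzD1 -(ltr_int R) /brad intr_norm intrB PoszD 2!intrD.
rewrite -[(Posz (Num.truncn _))%:~R]/(_%:R); move: h2; rewrite -natr1 => h2.
move: h f2; rewrite !ltr_norml intrD => /andP[h3 h4] f2.
by apply/andP; split; rewrite -?[1%:~R]/(1 : R); lra.
Qed.

Lemma wt_supp N a n : 0 < N -> wt N (emb n - a) != 0 -> n \in box (ctr a) (brad N).
Proof.
move=> N0 w0; apply/mem_box => j; rewrite mxE -mem_ibox; apply: om_supp => //.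
apply: contra w0 => /eqP h; rewrite /wt (bigD1 j) //=.
by rewrite !mxE h mul0r.
Qed.

Lemma theta_term_supp N t a n : 0 < N ->
  theta_term N t (emb n - a) != 0 -> n \in box (ctr a) (brad N).
Proof.
move=> N0 h; apply: wt_supp N0 _; apply: contra h => /eqP h.
by rewrite /theta_term h rmorph0 mul0r.
Qed.

Lemma om_smooth2 : exists2 A : R, 1 <= A & forall N (al : R), 0 < N ->
  smooth2 N A (fun k : int => om ((k%:~R - al) / N)).
Proof.
have [A A1 HA] := @om_db R; exists A => // N al N0 k.
set x := (k%:~R - al) / N; have [H0 [H1 [H2 _]]] := HA x N^-1.
have e1 : ((k + 1)%:~R - al) / N = x + 1%:R * N^-1 by rewrite /x intrD; ring.
have e2 : ((k + 2)%:~R - al) / N = x + 2%:R * N^-1 by rewrite /x intrD; ring.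
have e0 : om x = om (x + 0%:R * N^-1) by rewrite mul0r addr0.
have NV : `|N^-1| = N^-1 by rewrite gtr0_norm // invr_gt0.
rewrite e1 e2 e0; split.
- by have := H0 0%N (leq0n 4); rewrite normcR.
- by have := H1 0%N (leq0n 3); rewrite -rmorphB normcR NV.
- have := H2 0%N (leq0n 2); rewrite -!rmorphB normcR NV => h.
  have -> : A / N ^+ 2 = A * N^-1 * N^-1 by rewrite -mulrA -expr2 exprVn.
  apply: le_trans h; rewrite le_eqVlt; apply/orP; left; apply/eqP.
  by congr (`|_|); ring.
Qed.

Lemma sqr_sum_le (T : Type) (r : seq T) (f : T -> R) (X : R) :
  (forall u : T, 0 <= f u) -> (forall u : T, f u ^+ 2 <= X) ->
  (\sum_(u <- r) f u) ^+ 2 <= (size r)%:R ^+ 2 * X.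
Proof.
move=> f0 fX; have X0 : T -> 0 <= X.
  by move=> u; exact: le_trans (sqr_ge0 _) (fX u).
case: r => [|u0 r]; first by rewrite big_nil !expr2 !mul0r.
have {X0}X0 := X0 u0.
have h : \sum_(u <- u0 :: r) f u <= (size (u0 :: r))%:R * Num.sqrt X.
  rewrite mulr_natl -sumr_size; apply: ler_sum => u _.
  by rewrite -(ger0_norm (f0 u)) -sqrtr_sqr ler_wsqrtr.
rewrite -[X]sqr_sqrtr // -exprMn; apply: lerXn2r; rewrite ?nnegrE //.
exact: sumr_ge0.
Qed.

Hypothesis Qs : Q^T = Q.

Lemma theta_single : exists2 C : R, 0 < C & forall N a t, 1 <= N ->
  normc (theta N a t) ^+ 2 <= (C * N) ^+ d * cnt Q N (2 * brad N) t.
Proof.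
have [A A1 HA] := om_smooth2.
exists (8 * A * A * 17) => [|N a t N1]; first by nra.
have N0 : 0 < N by lra.
have A0 : 0 <= A by lra.
pose w j (k : int) := om ((k%:~R - a j 0) / N).
pose phi n := t * qform Q (emb n - a).
pose beta h j := 2 * t * (Q *m emb h : 'cV[R]_d) j 0.
pose gam h := t * (qform Q (emb h) - 2 * bil Q (emb h) a).
have -> : theta N a t = \sum_(n <- box (ctr a) (brad N))
   (\prod_j w j (n j 0))%:C * ex (phi n).
  apply: eq_bigr => n _; congr (_ %:C * _); apply: eq_bigr => j _.
  by rewrite /w !mxE.
have H := @quad_sum R d N A (ctr a) (brad N) w phi beta gam N0 A0.
apply: le_trans (H _ _ _) _.
- by move=> j; exact: HA.
- by move=> j k; rewrite mxE; exact: om_supp.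
- move=> n h; rewrite /phi embD addrAC (@qformD _ _ Q _ (emb h)) //.
  rewrite (bilC _ (emb h) Qs) bilDr bilNr.
  have -> : \sum_j beta h j * (n j 0)%:~R = 2 * t * bil Q (emb h) (emb n).
    by rewrite /bil mulr_sumr; apply: eq_bigr => j _; rewrite embE mulrA.
  by rewrite /gam; ring.
rewrite ler_wpM2r //.
  by apply: sumr_ge0 => h _; apply: prodr_ge0 => j _; rewrite ltW // psi_gt0.
apply: lerXn2r; rewrite ?nnegrE; [by rewrite !mulr_ge0 | by rewrite !mulr_ge0 // ltW|].
rewrite -[leRHS]mulrA ler_wpM2l ?mulr_ge0 //.
by have := brad_le N1; rewrite natrD natrM; lra.
Qed.

(** A first Weyl step with difference u turns theta(t) times the conjugate of theta(t') into O(N^d)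
    sums whose quadratic part has coefficient t - t'. A second one, [quad_sum], bounds each of them
    by the same count. Squaring yields N^(2 d) N^d times the count. *)
Lemma theta_pair : exists2 C : R, 0 < C & forall N a t t', 1 <= N ->
  (normc (theta N a t) * normc (theta N a t')) ^+ 2 <=
  (C * N ^+ 3) ^+ d * cnt Q N (2 * brad N) (t - t').
Proof.
have [A A1 HA] := om_smooth2.
pose K := 4 * A * A; have K0 : 0 < K by rewrite /K; nra.
exists (25 ^+ 2 * (8 * K * K * 17)) => [|N a t t' N1]; first by nra.
have N0 : 0 < N by lra.
have A0 : 0 <= A by lra.
pose w u j (k : int) := om (((k + u j 0)%:~R - a j 0) / N) * om ((k%:~R - a j 0) / N).
pose phi u n := t * qform Q (emb (n + u) - a) - t' * qform Q (emb n - a).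
pose beta h j := 2 * (t - t') * (Q *m emb h : 'cV[R]_d) j 0.
pose gam u h := (t - t') * (qform Q (emb h) - 2 * bil Q (emb h) a)
   + 2 * t * bil Q (emb h) (emb u).
have r0 := brad_le N1.
have W0 := @weyl R _ (box (ctr a) (brad N)) (box 0 (2 * brad N))
  (fun n => theta_term N t (emb n - a)) (fun n => theta_term N t' (emb n - a))
  (box_uniq _ _) (box_uniq _ _).
have {}W0 := W0 _ (fun m => @theta_term_supp N t a m N0).
have {}W0 : normc (theta N a t) * normc (theta N a t') <=
  \sum_(u <- box 0 (2 * brad N)) normc (\sum_(n <- box (ctr a) (brad N))
     (\prod_j w u j (n j 0))%:C * ex (phi u n)).
  apply: le_trans (W0 _) _.
    move=> m n /mem_box hm /mem_box hn; apply/mem_box => j; rewrite !mxE.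
    have H (b c e : int) k : `|b - e| <= k%:Z -> `|c - e| <= k%:Z ->
      `|b - c - 0| <= (2 * k)%:Z by lia.
    by move: (hm j) (hn j); rewrite mxE; exact: H.
  apply: ler_sum => u _; rewrite le_eqVlt; apply/orP; left; apply/eqP.
  congr normc; apply: eq_bigr => n _.
  rewrite /theta_term conjcM [conjc _%:C]conjc_real -exN mulrACA -realcM -exD.
  rewrite /wt -big_split /=; congr (_ %:C * ex _); apply: eq_bigr => j _.
  by rewrite /w !mxE.
apply: (@le_trans _ _ ((25 * N) ^+ d ^+ 2 * ((8 * K * K * 17 * N) ^+ d *
   cnt Q N (2 * brad N) (t - t')))); last first.
  by rewrite mulrA -exprM mulnC exprM -exprMn; rewrite le_eqVlt; apply/orP; left;
    apply/eqP; congr (_ ^+ _ * _); ring.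
apply: le_trans (_ : _ <= (\sum_(u <- box 0 (2 * brad N)) normc _) ^+ 2) _.
  by apply: lerXn2r; rewrite ?nnegrE ?mulr_ge0 ?normc_ge0 //; [|exact: W0];
    apply: sumr_ge0 => u _; exact: normc_ge0.
have cnt0 : 0 <= cnt Q N (2 * brad N) (t - t').
  by apply: sumr_ge0 => h _; apply: prodr_ge0 => j _; rewrite ltW // psi_gt0.
apply: le_trans (sqr_sum_le _ _ (X := (8 * K * K * 17 * N) ^+ d *
   cnt Q N (2 * brad N) (t - t')) _) _ => [u|u|].
- exact: normc_ge0.
- have H := @quad_sum R d N K (ctr a) (brad N) (w u) (phi u) beta (gam u) N0 (ltW K0).
  apply: le_trans (H _ _ _) _.
  + move=> j; apply: smooth2M => //; last exact: HA.
    exact: (@smooth2_shift R N A (fun k : int => om ((k%:~R - a j 0) / N)) (u j 0) (HA _ _ N0)).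
  + move=> j k; rewrite mxE /w => h; apply: om_supp N0 _.
    by apply: contra h => /eqP ->; rewrite mulr0.
  + move=> n h; rewrite /phi.
    have -> : emb (n + h + u) - a = (emb (n + u) - a) + emb h :> 'cV[R]_d.
      by rewrite (addrAC n) (embD (n + u)) [LHS]addrAC.
    have -> : emb (n + h) - a = (emb n - a) + emb h :> 'cV[R]_d.
      by rewrite embD addrAC.
    rewrite !(@qformD _ _ Q _ (emb h)) // (bilC (emb (n + u) - a) _ Qs).
    rewrite (bilC (emb n - a) _ Qs) !bilDr !bilNr embD bilDr.
    have -> : \sum_j beta h j * (n j 0)%:~R = 2 * (t - t') * bil Q (emb h) (emb n).
      by rewrite /bil mulr_sumr; apply: eq_bigr => j _; rewrite embE mulrA.
    by rewrite /gam; ring.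
  rewrite ler_wpM2r //.
  apply: lerXn2r; rewrite ?nnegrE; [by rewrite !mulr_ge0 // ltW | by rewrite !mulr_ge0 // ltW|].
  rewrite -[leRHS]mulrA ler_wpM2l ?mulr_ge0 ?(ltW K0) //.
  by rewrite natrD natrM; lra.
- rewrite ler_wpM2r //; first by rewrite mulr_ge0 // exprn_ge0 // !mulr_ge0 // ltW.
  rewrite size_box natrX; apply: lerXn2r; rewrite ?nnegrE ?exprn_ge0 // ?mulr_ge0 ?(ltW N0)//.
  apply: lerXn2r; rewrite ?nnegrE ?mulr_ge0 ?(ltW N0) //.
  have -> : (2 * (2 * brad N)).+1%:R = 4 * (brad N)%:R + 1 :> R.
    by rewrite -natrM natr1; congr (_%:R); clear; lia.
  by lra.
Qed.

End Theta.


(** * Oscillation of periodic sequences *)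

Section PeriodicSequences.
Context {R : realType}.

Lemma db_sum p (A r : R) (T : Type) (s : seq T) (y : T -> nat -> R[i]) :
  0 <= A -> 0 <= r -> (forall i, db p A r (y i)) ->
  db p ((size s)%:R * A) r (fun k => \sum_(i <- s) y i k).
Proof.
move=> A0 r0 hy; elim: s => [|i s IH].
  rewrite mul0r; apply: db_ext (db0 p (lexx 0) r0) => k _.
  by rewrite big_nil.
rewrite /= -natr1 mulrDl mul1r addrC.
by apply: db_ext (dbD (hy i) IH) => k _; rewrite big_cons.
Qed.

(* A sequence of period M has mean-zero differences, so that each difference is
   bounded by M times the next one. *)
Lemma periodic_osc p (K r : R) (M : nat) (xi : nat -> R[i]) : (0 < M)%N -> 0 <= r ->
  (forall n, xi (n + M)%N = xi n) ->
  (forall n, db p K r (fun k => xi (n + k)%N)) ->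
  forall n m, normc (xi n - xi m) <= 2 * K * (M%:R * r) ^+ p.
Proof.
move=> M0 r0; elim: p K xi => [|p IH] K xi per hdb n m.
  rewrite expr0 mulr1; apply: le_trans (normc_triangle _ _) _; rewrite normcN.
  have h k : normc (xi k) <= K by have := db_norm (hdb k) (leq0n 0); rewrite addn0.
  by have := h n; have := h m; lra.
pose dx k := xi k.+1 - xi k.
have dper k : dx (k + M)%N = dx k by rewrite /dx -addSn !per.
have ddb k : db p (K * r) r (fun j => dx (k + j)%N).
  have [_ ] := hdb k; apply: db_ext => j _ /=.
  by rewrite /dx addnS.
have osc := IH _ _ dper ddb.
have sum_dx k j : \sum_(i < j) dx (k + i)%N = xi (k + j)%N - xi k.
  elim: j => [|j IHj]; first by rewrite big_ord0 addn0 subrr.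
  by rewrite big_ord_recr /= IHj /dx addnS addrC subrKA.
have MR : 0 < M%:R :> R by rewrite ltr0n.
have dx_le k : normc (dx k) <= 2 * (K * r) * (M%:R * r) ^+ p.
  have E : M%:R%:C * dx k = \sum_(i < M) (dx k - dx (0 + i)%N).
    rewrite sumrB sum_dx add0n -[X in xi X]add0n per subrr subr0.
    rewrite sumr_const card_ord -[RHS]mulr_natl; congr (_ * _).
    exact: (rmorph_nat (real_complex R)).
  rewrite -(ler_pM2l MR) -{1}(ger0_norm (ltW MR)) -normcR -normcM E.
  apply: le_trans (normc_sum _ _ _) _.
  apply: (@le_trans _ _ (\sum_(i < M) (2 * (K * r) * (M%:R * r) ^+ p))).
    by apply: ler_sum => i _; exact: osc.
  by rewrite sumr_const card_ord -[leLHS]mulr_natl.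
have modE k : xi k = xi (k %% M)%N.
  rewrite {1}(divn_eq k M); elim: (k %/ M)%N => [|q IHq]; first by rewrite mul0n.
  by rewrite mulSn -addnA addnC per.
have K0 : 0 <= 2 * (K * r) * (M%:R * r) ^+ p.
  exact: le_trans (normc_ge0 _) (dx_le 0%N).
wlog nm : n m / (m %% M <= n %% M)%N.
  move=> H; have [h|/ltnW h] := leqP (m %% M) (n %% M); first exact: H.
  by rewrite normcB; exact: H.
rewrite (modE n) (modE m) -(subnKC nm) -sum_dx.
apply: le_trans (normc_sum _ _ _) _.
apply: (@le_trans _ _ (\sum_(i < n %% M - m %% M) (2 * (K * r) * (M%:R * r) ^+ p))).
  by apply: ler_sum => i _; exact: dx_le.
rewrite sumr_const card_ord -[leLHS]mulr_natl.
have -> : 2 * K * (M%:R * r) ^+ p.+1 = M%:R * (2 * (K * r) * (M%:R * r) ^+ p).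
  by rewrite exprS; ring.
rewrite ler_wpM2r // ler_nat (leq_trans (leq_subr _ _)) // ltnW // ltn_pmod //.
Qed.

End PeriodicSequences.

(** * Product bound, size and periodicity of theta sums *)

Section ThetaBounds.
Context {R : realType} {d : nat}.
Variable (Q : 'M[R]_d).
Implicit Types (a x : 'cV[R]_d) (n h u : 'cV[int]_d) (N t : R).

Lemma theta_prod : Q^T = Q -> Q \in unitmx ->
  exists2 C : R, 0 < C & forall N a t t', 2 <= N -> t' < t ->
    (normc (theta Q N a t) * normc (theta Q N a t')) ^+ 2 <=
    C * (N ^+ 4 * ((t - t') + (N ^+ 2 * (t - t'))^-1)) ^+ d.
Proof.
move=> Qs Qu; have [C1 C10 H1] := theta_pair Qs.
have [C2 C20 H2] := @cnt_bound R d Q 12 Qu (ltr0n R 12).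
exists (C1 ^+ d * C2 * 2 ^+ d) => [|N a t t' N2 tt].
  by rewrite !mulr_gt0 // exprn_gt0.
have N1 : 1 <= N by lra.
have N0 : 0 < N by lra.
apply: le_trans (H1 N a t t' N1) _; set e := t - t'.
have e0 : 0 < e by rewrite subr_gt0.
have rN : (2 * brad N)%:R <= 12 * N by have := brad_le N1; rewrite natrM; lra.
apply: le_trans (ler_wpM2l _ (H2 _ _ _ N2 rN e0)) _.
  by rewrite exprn_ge0 // mulr_ge0 ?exprn_ge0 ?ltW.
set x := N * e; have x0 : 0 < x by rewrite mulr_gt0.
have E : N ^+ 4 * (e + (N ^+ 2 * e)^-1) = N ^+ 3 * (x + x^-1).
  by rewrite /x; field; rewrite !gt_eqF.
rewrite E.
have -> : C1 ^+ d * C2 * 2 ^+ d * (N ^+ 3 * (x + x^-1)) ^+ d =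
  (C1 * N ^+ 3) ^+ d * (C2 * (2 * (x + x^-1)) ^+ d) by rewrite !exprMn; ring.
have xV : 0 < x^-1 by rewrite invr_gt0.
apply: ler_wpM2l; first by rewrite ltW // exprn_gt0 // mulr_gt0 // exprn_gt0.
apply: ler_wpM2l; first exact: ltW.
have x0' := ltW x0; have xV' := ltW xV.
apply: lerXn2r; rewrite ?nnegrE ?mulr_ge0 ?addr_ge0 //.
have h : x * x^-1 = 1 by rewrite divff // gt_eqF.
(* This is the difference of 2 (x + 1/x) and (1 + x) (1 + 1/x). *)
have : 0 <= (x - 1) ^+ 2 * x^-1 by rewrite mulr_ge0 ?sqr_ge0 // ltW.
have -> : (x - 1) ^+ 2 * x^-1 = x * (x * x^-1) - 2 * (x * x^-1) + x^-1 by ring.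
have -> : (1 + x) * (1 + x^-1) = 1 + x + x^-1 + x * x^-1 by ring.
by rewrite h; lra.
Qed.

Lemma wt_le : exists2 C : R, 1 <= C & forall N x, `|wt N x| <= C ^+ d.
Proof.
have [C C0 HC] := @om_bounded R; exists (1 + C) => [|N x]; first by lra.
rewrite normr_prod -[X in _ ^+ X]card_ord -prodr_const.
by apply: ler_prod => j _; rewrite normr_ge0 /=; apply: le_trans (HC _) _; lra.
Qed.

Lemma theta_upper : exists2 C : R, 0 < C & forall N a t, 1 <= N ->
  normc (theta Q N a t) <= (C * N) ^+ d.
Proof.
have [C C1 HC] := wt_le; exists (13 * C) => [|N a t N1]; first by lra.
apply: le_trans (normc_sum _ _ _) _.
apply: (@le_trans _ _ (\sum_(n <- box (ctr a) (brad N)) C ^+ d)).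
  by apply: ler_sum => n _; rewrite normcM normc_ex mulr1 normcR.
rewrite sumr_size size_box -[leLHS]mulr_natl natrX -exprMn.
apply: lerXn2r; rewrite ?nnegrE ?mulr_ge0 //; [lra..|].
have r1 := brad_le N1; have -> : (2 * brad N).+1%:R = 2 * (brad N)%:R + 1 :> R.
  by rewrite -natrM natr1.
have -> : 13 * C * N = 13 * N * C by ring.
by rewrite ler_wpM2r //; lra.
Qed.

(** At t = 0 all terms are nonnegative, and those on the plateau of the weight equal 1. Dividing the
    product bound with t' = 0 by this gives bounds for a single theta sum. *)
Lemma theta0_lower N a : 2 <= N -> (N / 2) ^+ d <= normc (theta Q N a 0).
Proof.
move=> N2; have N0 : 0 < N by lra.
have -> : theta Q N a 0 = (\sum_(n <- box (ctr a) (brad N)) wt N (emb n - a))%:C.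
  rewrite realc_sum; apply: eq_bigr => n _.
  by rewrite /theta_term mul0r ex0 mulr1.
have w0 n : 0 <= wt N (emb n - a).
  by apply: prodr_ge0 => j _; exact: om_ge0.
rewrite normcR ger0_norm; last by rewrite sumr_ge0.
pose B := Num.truncn (N - 1).
have hB : B%:R <= N - 1 by rewrite truncn_le; lra.
have hB2 : N - 1 < B%:R + 1 by rewrite natr1 truncnS_gt.
have in1 n : n \in box (ctr a) B -> wt N (emb n - a) = 1.
  move=> /mem_box hn; rewrite /wt big1 // => j _; apply: om_in.
  rewrite normrM normfV (gtr0_norm N0) ler_pdivrMr // mul1r !mxE.
  have := hn j; rewrite mxE -(ler_int R) intr_norm intrB -[(Posz B)%:~R]/(B%:R).
  have /andP[f1 f2] := floor_itv (a j 0).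
  move: f2; rewrite intrD !ler_norml => f2 /andP[g1 g2].
  by apply/andP; split; move: f2; rewrite -[1%:~R]/(1 : R); lra.
have -> : \sum_(n <- box (ctr a) (brad N)) wt N (emb n - a) =
    \sum_(n <- undup (box (ctr a) (brad N) ++ box (ctr a) B)) wt N (emb n - a).
  apply: sum_supp; rewrite ?box_uniq ?undup_uniq //.
    by move=> n nb _; rewrite mem_undup mem_cat nb.
  by move=> n _; exact: wt_supp.
apply: (@le_trans _ _ (\sum_(n <- box (ctr a) B) wt N (emb n - a))); last first.
  have -> : \sum_(n <- box (ctr a) B) wt N (emb n - a) =
    \sum_(n <- undup (box (ctr a) (brad N) ++ box (ctr a) B) | n \in box (ctr a) B)
      wt N (emb n - a).
    rewrite -[RHS]big_filter; apply: perm_big; apply: uniq_perm.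
    - exact: box_uniq.
    - by rewrite filter_uniq ?undup_uniq.
    - move=> n; rewrite mem_filter mem_undup mem_cat.
      by case: (n \in box (ctr a) B); rewrite ?orbT.
  by rewrite [leRHS](bigID (mem (box (ctr a) B))) /= lerDl sumr_ge0.
rewrite big_seq (eq_bigr (fun=> 1)) -?big_seq; last by move=> n /in1.
rewrite sumr_size size_box natrX; apply: lerXn2r; rewrite ?nnegrE ?divr_ge0 //.
  lra.
have -> : (2 * B).+1%:R = 2 * B%:R + 1 :> R by rewrite -natrM natr1.
have [N3|N3] := leP 3 N; first by lra.
have : (1 <= B)%N by rewrite truncn_ge_nat; lra.
rewrite -(ler_nat R); lra.
Qed.

Lemma theta_int N a u t : 0 < N -> theta Q N (a + emb u) t = theta Q N a t.
Proof.
move=> N0; rewrite /theta.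
have E n : emb (n + u) - (a + emb u) = emb n - a :> 'cV[R]_d.
  by rewrite embD opprD addrACA subrr addr0.
under [RHS]eq_bigr => n _ do rewrite -E.
rewrite -(big_map (fun n => n + u) xpredT (fun n => theta_term Q N t (emb n - (a + emb u)))).
apply: sum_supp.
- exact: box_uniq.
- by rewrite map_inj_uniq ?box_uniq //; exact: addIr.
- move=> n _ h; apply/mapP; exists (n - u); last by rewrite subrK.
  by apply: (@theta_term_supp _ _ Q N t) => //; rewrite -E subrK.
- by move=> n _ h; exact: (theta_term_supp N0 h).
Qed.

End ThetaBounds.


(** * Dependence of theta sums on the translate at low frequencies *)

Section LowFrequencies.
Context {R : realType} {d : nat}.
Variable (Q : 'M[R]_d).
Implicit Types (a b x : 'cV[R]_d) (N t h r : R) (j : 'I_d).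

Local Notation ev j := (delta_mx j 0 : 'cV[R]_d).

Lemma evE j k : ev j k 0 = (k == j)%:R.
Proof. by rewrite mxE eqxx andbT. Qed.

Lemma addevE x s j k : (x + s *: ev j) k 0 = x k 0 + s * (k == j)%:R.
Proof. by rewrite !mxE eqxx andbT. Qed.

Lemma subevE x s j k : (x - s *: ev j) k 0 = x k 0 - s * (k == j)%:R.
Proof. by rewrite !mxE eqxx andbT. Qed.

Lemma qform_ev x s j : Q^T = Q ->
  qform Q (x + s *: ev j) = qform Q x + 2 * s * (Q *m x) j 0 + s ^+ 2 * Q j j.
Proof.
move=> Qs; rewrite qformD // [qform Q (s *: _)]qform_bil.
rewrite !bilZr (bilC (s *: ev j) _ Qs) bilZr.
have E y : bil Q y (ev j) = (Q *m y) j 0.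
  rewrite /bil (bigD1 j) //= evE eqxx mulr1 big1 ?addr0 // => k /negPf kj.
  by rewrite evE kj mulr0.
have -> : Q j j = (Q *m ev j) j 0.
  rewrite mxE (bigD1 j) //= evE eqxx mulr1 big1 ?addr0 // => k /negPf kj.
  by rewrite evE kj mulr0.
by rewrite !E; ring.
Qed.

(** Along a coordinate direction a term is a constant times a bump sampled at step h / N times a
    quadratic exponential of slope O(t N h); both nonconstant factors gain h (t N + 1/N) per
    difference. *)
Lemma term_db : Q^T = Q -> exists K c : R, [/\ 0 < K, 1 <= c &
  forall N t h x j, 1 <= N -> 0 <= t -> 0 <= h <= 1 ->
    c * h * (t * N + N^-1) <= 1 ->
    db 4 K (c * h * (t * N + N^-1))
       (fun n => theta_term Q N t (x + (n%:R * h) *: ev j))].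
Proof.
move=> Qs; have [M M0 QM] := mulmx_bound Q.
have [A A1 HA] := @om_db R; have [C C0 HC] := @om_bounded R.
have p0 := pi_gt0 R.
pose P0 := (1 + C) ^+ d; have P00 : 0 < P0 by rewrite exprn_gt0 //; lra.
pose K : R := 2 ^+ 4 * (2 ^+ 4 * (P0 * A) * 2 ^+ (4 * 4)).
pose c := 1 + 100 * (pi * M).
have pM : 0 < pi * M by rewrite mulr_gt0.
exists K, c; split; first by rewrite /K !mulr_gt0 ?exprn_gt0 //; lra.
  by rewrite /c; lra.
move=> N t h x j N1 t0 /andP[h0 h1]; set r := c * h * _ => r1.
have N0 : 0 < N by lra.
have NV : 0 < N^-1 by rewrite invr_gt0.
have c1 : 1 <= c by rewrite /c; lra.
have tN0 : 0 <= t * N by rewrite mulr_ge0 // ltW.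
have r0 : 0 <= r by rewrite /r !mulr_ge0 ?addr_ge0 ?(ltW NV) //; lra.
pose P := \prod_(k < d | k != j) om (x k 0 / N).
have wE n : wt N (x + (n%:R * h) *: ev j) = P * om ((x j 0 + n%:R * h) / N).
  rewrite /wt (bigD1 j) //= [LHS]mulrC addevE eqxx mulr1; congr (_ * _).
  by apply: eq_bigr => k /negPf kj; rewrite addevE kj mulr0 addr0.
have K0 : 0 <= K by rewrite /K !mulr_ge0 ?exprn_ge0 //; lra.
have hn n : (n <= 4)%N -> 0 <= n%:R * h <= 4.
  move=> n4; rewrite mulr_ge0 //=; apply: (@le_trans _ _ (4 * 1)); last by rewrite mulr1.
  by apply: ler_pM => //; rewrite ler_nat.
have zero : (forall n, (n <= 4)%N -> wt N (x + (n%:R * h) *: ev j) = 0) ->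
    db 4 K r (fun n => theta_term Q N t (x + (n%:R * h) *: ev j)).
  move=> H; apply: db_ext (db0 4 K0 r0) => n n4.
  by rewrite /theta_term H // rmorph0 mul0r.
have [P_eq0|P_neq0] := eqVneq P 0.
  by apply: zero => n _; rewrite wE P_eq0 mul0r.
(* The samples move by at most 4 <= 4 N, so from 9 N on they all miss the support, of radius 5 N. In
   the remaining case x is bounded by 9 N and the slope of the phase is under control. *)
have [xj9|xj9] := leP (9 * N) `|x j 0|.
  apply: zero => n n4; rewrite wE om_out ?mulr0 //.
  rewrite normrM normfV (gtr0_norm N0) ler_pdivlMr //.
  have /andP[hn0 hn4] := hn n n4.
  have := lerB_normD (x j 0) (n%:R * h); rewrite (ger0_norm hn0); lra.
have xk k : `|x k 0| <= 9 * N.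
  have [->|kj] := eqVneq k j; first exact: ltW.
  have [h5|h5] := leP (5 * N) `|x k 0|; last by lra.
  move/negP: P_neq0; case; apply/eqP; rewrite /P (bigD1 k) //= om_out ?mul0r //.
  by rewrite normrM normfV (gtr0_norm N0) ler_pdivlMr.
have Qx := QM _ _ xk j.
have Qj : `|Q j j| <= M.
  have := QM (ev j) 1 _ j; rewrite mulr1 => H.
  have -> : Q j j = (Q *m ev j) j 0.
    rewrite mxE (bigD1 j) //= evE eqxx mulr1 big1 ?addr0 // => k /negPf kj.
    by rewrite evE kj mulr0.
  by apply: H => k; rewrite evE ger0_norm // lern1 leq_b1.
have Plt : `|P| <= P0.
  rewrite /P normr_prod big_mkcond /= /P0 -[X in _ ^+ X]card_ord -prodr_const.
  apply: ler_prod => k _; case: ifP => _; last by rewrite ler01 /=; lra.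
  by rewrite normr_ge0 /=; apply: le_trans (HC _) _; lra.
have hP : db 4 P0 r (fun=> P%:C) by apply: db_const => //; rewrite normcR.
have hw : db 4 A r (fun n => (om (x j 0 / N + n%:R * (h / N)))%:C).
  apply: db_le (HA _ _) => //.
  rewrite ger0_norm ?mulr_ge0 ?(ltW NV) // /r.
  have : h * N^-1 <= c * (h * N^-1) by rewrite ler_peMl // mulr_ge0 // ltW.
  have : 0 <= c * (h * (t * N)) by rewrite !mulr_ge0 //; lra.
  by lra.
pose q1 := 2 * t * h * (Q *m x) j 0; pose q2 := t * h ^+ 2 * Q j j.
have q1b : `|q1| <= 18 * M * (h * (t * N)).
  rewrite /q1 normrM ger0_norm ?mulr_ge0 //.
  have := ler_wpM2l (mulr_ge0 (mulr_ge0 (ler0n R 2) t0) h0) Qx; lra.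
have q2b : `|q2| <= M * (h ^+ 2 * t).
  rewrite /q2 normrM ger0_norm ?mulr_ge0 ?sqr_ge0 //.
  have := ler_wpM2l (mulr_ge0 t0 (sqr_ge0 h)) Qj; lra.
have htN : 0 <= h * (t * N) by rewrite mulr_ge0.
have q2b' : `|q2| <= M * (h * (t * N)).
  apply: le_trans q2b _; rewrite ler_wpM2l ?(ltW M0) // expr2 -mulrA ler_wpM2l //.
  have : h * t <= t by rewrite ler_piMl.
  have : t <= t * N by rewrite ler_peMr.
  lra.
have rge : 100 * (pi * M) * (h * (t * N)) <= r.
  rewrite /r /c.
  have : 0 <= pi * M * (h * N^-1) by rewrite !mulr_ge0 // ltW.
  have : 0 <= h * N^-1 by rewrite mulr_ge0 // ltW.
  lra.
have he : db 4 (2 ^+ (4 * 4)) r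
    (fun n => ex (t * qform Q x + q1 * n%:R + q2 * n%:R ^+ 2)).
  apply: db_ex; first by rewrite r0.
    move=> n n4; apply: le_trans rge.
    have -> : 100 * (pi * M) * (h * (t * N)) = 2 * pi * (50 * M * (h * (t * N))) by ring.
    rewrite ler_wpM2l ?mulr_ge0 ?(ltW p0) //.
    apply: le_trans (ler_normD _ _) _; rewrite [`|q2 * _|]normrM.
    have n9 : `|2 * n%:R + 1| <= 9 :> R.
      have n4' : n%:R <= 4 :> R by rewrite ler_nat.
      have : 0 <= n%:R :> R by [].
      by move=> nn; rewrite ger0_norm; clear -nn n4'; lra.
    have := ler_pM (normr_ge0 _) (normr_ge0 _) q2b' n9.
    have : 0 <= M * (h * (t * N)) by rewrite mulr_ge0 // ltW.
    lra.
  have -> : `|2 * q2| = 2 * `|q2| by rewrite normrM ger0_norm.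
  have h2t : 0 <= h ^+ 2 * t by rewrite mulr_ge0 ?sqr_ge0.
  (* The second difference of the phase has size t h^2, and 4 t <= (t N + 1/N)^2 by the inequality
     between arithmetic and geometric means. *)
  apply: (@le_trans _ _ (c ^+ 2 * (h ^+ 2 * (4 * t)))).
    have := ler_wpM2l (mulr_ge0 (mulr_ge0 (ler0n R 2) (ltW p0)) (ler0n R 2)) q2b.
    have : c <= c ^+ 2 by rewrite expr2 ler_peMr // (le_trans ler01 c1).
    have : 0 <= pi * M * (h ^+ 2 * t) by rewrite mulr_ge0 // ltW.
    move=> H1 H2; have H3 := ler_wpM2r h2t H2.
    have : 100 * (pi * M) * (h ^+ 2 * t) <= c * (h ^+ 2 * t).
      apply: ler_wpM2r => //; rewrite /c; have := mulr_gt0 p0 M0; clear; lra.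
    lra.
  have -> : r ^+ 2 = c ^+ 2 * (h ^+ 2 * (t * N + N^-1) ^+ 2) by rewrite /r !exprMn mulrA.
  rewrite ler_wpM2l ?sqr_ge0 // ler_wpM2l ?sqr_ge0 //.
  have NN : N * N^-1 = 1 by rewrite divff // gt_eqF.
  have : 0 <= (t * N - N^-1) ^+ 2 by exact: sqr_ge0.
  have -> : (t * N - N^-1) ^+ 2 = (t * N) ^+ 2 - 2 * t * (N * N^-1) + N^-1 ^+ 2 by ring.
  have -> : (t * N + N^-1) ^+ 2 = (t * N) ^+ 2 + 2 * t * (N * N^-1) + N^-1 ^+ 2 by ring.
  by rewrite NN; clear; lra.
have := dbM r0 (dbM r0 hP hw) he; apply: db_ext => n _.
rewrite /theta_term wE realcM qform_ev //; congr (_ * (om _)%:C * ex _).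
  by rewrite mulrA mulrDl.
by rewrite /q1 /q2; ring.
Qed.

(** Puts nearby translates on one common box, so that differences in the translate can be taken term
    by term. *)
Lemma theta_box N a b t : 1 <= N -> (forall k, `|b k 0 - a k 0| <= 4) ->
  theta Q N b t = \sum_(n <- box (ctr a) (brad N + 5)) theta_term Q N t (emb n - b).
Proof.
move=> N1 ab; have N0 : 0 < N by lra.
apply: sum_supp; rewrite ?box_uniq //; last by move=> n _; exact: theta_term_supp.
move=> n /mem_box nb _; apply/mem_box => k; have := nb k; rewrite !mxE.
have fab : `|Num.floor (b k 0) - Num.floor (a k 0)| <= 5.
  have /andP[f1 f2] := floor_itv (a k 0); have /andP[f3 f4] := floor_itv (b k 0).
  have H0 (z : int) : `|z| < 6 -> `|z| <= 5 by clear; lia.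
  apply: H0; rewrite -(ltr_int R) (_ : (6 : int)%:~R = 6 :> R) // intr_norm intrB.
  move: (ab k) f2 f4; rewrite ler_norml !intrD ltr_norml -[1%:~R]/(1 : R) => /andP[g1 g2] f2 f4.
  by apply/andP; split; lra.
have H (z x1 x2 : int) (m : nat) : `|x1 - x2| <= 5 -> `|z - x1| <= m%:Z ->
  `|z - x2| <= (m + 5)%:Z by clear; lia.
exact: H.
Qed.

Lemma theta_db : Q^T = Q -> exists K c : R, [/\ 0 < K, 1 <= c &
  forall N t h a j, 1 <= N -> 0 <= t -> 0 <= h <= 1 ->
    c * h * (t * N + N^-1) <= 1 ->
    db 4 (K * N ^+ d) (c * h * (t * N + N^-1))
       (fun n => theta Q N (a - (n%:R * h) *: ev j) t)].
Proof.
move=> Qs; have [K [c [K0 c1 HK]]] := term_db Qs.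
exists (23 ^+ d * K), c; split; rewrite ?mulr_gt0 ?exprn_gt0 //.
move=> N t h a j N1 t0 h01 rle; set r := c * h * _ in rle *.
have N0 : 0 < N by lra.
have /andP[h0 h1] := h01.
have r0 : 0 <= r.
  by rewrite /r !mulr_ge0 ?addr_ge0 ?mulr_ge0 ?invr_ge0 ?(ltW N0) //; lra.
have H := @db_sum R 4 K r _ (box (ctr a) (brad N + 5))
  (fun n k => theta_term Q N t ((emb n - a) + (k%:R * h) *: ev j)) (ltW K0) r0
  (fun n => HK N t h (emb n - a) j N1 t0 h01 rle).
apply: db_le (db_ext _ H) => //.
- rewrite size_box natrX mulrAC -exprMn ler_wpM2r ?(ltW K0) //.
  apply: lerXn2r; rewrite ?nnegrE ?mulr_ge0 ?(ltW N0) //.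
  have := brad_le N1.
  have -> : (2 * (brad N + 5)).+1%:R = 2 * (brad N)%:R + 11 :> R.
    by rewrite -natrM -natrD; congr (_%:R); clear; lia.
  lra.
- move=> k k4; rewrite (@theta_box N a); last 2 first.
  + exact: N1.
  + move=> i; rewrite subevE addrAC subrr add0r normrN normrM; apply: (@le_trans _ _ (4 * 1)); last by rewrite mulr1.
    apply: ler_pM => //; last by rewrite ger0_norm // lern1 leq_b1.
    rewrite ger0_norm ?mulr_ge0 //; apply: (@le_trans _ _ (4 * 1)); last by rewrite mulr1.
    by apply: ler_pM => //; rewrite ler_nat.
  by apply: eq_bigr => n _; rewrite opprD opprK addrA.
Qed.

(** By periodicity y may be taken in [0, 1[. On the grid of step h = 1/M the sequence has period M,
    and [periodic_osc] gives (M c h v)^4 = (c v)^4 whatever M is. The passage from y to the grid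
    costs a single first difference. *)
Lemma theta_step : Q^T = Q -> exists2 C : R, 0 < C &
  forall N t a j y, 1 <= N -> 0 <= t ->
    normc (theta Q N (a - y *: ev j) t - theta Q N a t) <=
    C * N ^+ d * (t * N + N^-1) ^+ 4.
Proof.
move=> Qs; have [K [c [K0 c1 HK]]] := theta_db Qs.
exists (2 * K * c ^+ 4 + K * c) => [|N t a j y N1 t0].
  by rewrite addr_gt0 // !mulr_gt0 ?exprn_gt0 //; lra.
have N0 : 0 < N by lra.
pose v := t * N + N^-1.
have v0 : 0 < v by rewrite /v ltr_wpDl ?mulr_ge0 ?invr_gt0 // ltW.
rewrite -/v.
wlog y01 : y / 0 <= y < 1.
  move=> H; pose z := y - (Num.floor y)%:~R.
  have /andP[f1 f2] := floor_itv y.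
  have := H z; have -> : theta Q N (a - z *: ev j) t = theta Q N (a - y *: ev j) t.
    rewrite -[RHS](@theta_int R d Q N _ (Num.floor y *: delta_mx j 0)) //; congr theta.
    apply/colP => k; rewrite !mxE /z intrM; case: (_ && _); rewrite ?mulr1n ?mulr0n.
      by rewrite -[1%:~R]/(1 : R); ring.
    by rewrite -[0%:~R]/(0 : R); ring.
  apply; rewrite /z; move: f2; rewrite intrD -[1%:~R]/(1 : R); lra.
have /andP[y0 y1] := y01.
(* M >= c v keeps the ratio c h v at most 1; M >= v^(-3) makes the rounding cost c h v at most c
   v^4. *)
pose M := (Num.truncn (c * v + v^-1 ^+ 3)).+1.
have vV : 0 <= v^-1 ^+ 3 by rewrite exprn_ge0 // invr_ge0 ltW.
have cv : 0 < c * v by rewrite mulr_gt0 //; lra.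
have MR : c * v + v^-1 ^+ 3 < M%:R by exact: truncnS_gt.
have M0 : 0 < M%:R :> R by rewrite ltr0n.
pose h := M%:R^-1 : R.
have h0 : 0 < h by rewrite invr_gt0.
have h1 : h <= 1 by rewrite invf_le1 // ler1n.
have chv : c * h * v <= 1.
  by rewrite mulrAC ler_pdivrMr // mul1r; lra.
have r0 : 0 <= c * h * v by rewrite mulrAC mulr_ge0 // ltW.
pose xi n := theta Q N (a - (n%:R * h) *: ev j) t.
have per n : xi (n + M)%N = xi n.
  rewrite /xi -[RHS](@theta_int R d Q N _ (- delta_mx j 0)) //; congr theta.
  rewrite natrD mulrDl divff ?gt_eqF // scalerDl scale1r opprD addrA; congr (_ + _).
  by rewrite embN; congr (- _); apply/colP => k; rewrite !mxE; case: (_ && _).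
have hdb n : db 4 (K * N ^+ d) (c * h * v) (fun k => xi (n + k)%N).
  have := HK N t h (a - (n%:R * h) *: ev j) j N1 t0; rewrite (ltW h0) h1 -/v.
  move=> /(_ isT chv); apply: db_ext => k _.
  by rewrite /xi natrD mulrDl scalerDl opprD addrA.
have osc := periodic_osc (ltn0Sn _) r0 per hdb.
pose n := Num.truncn (y * M%:R).
have nE : n%:R <= y * M%:R < n%:R + 1.
  by rewrite natr1; apply: truncn_itv; rewrite mulr_ge0 // ltW.
pose z := y - n%:R * h.
have z0 : 0 <= z.
  by rewrite /z subr_ge0 ler_pdivrMr //; case/andP: nE.
have zh : z <= h.
  rewrite /z lerBlDr -[X in _ <= X + _]mul1r -mulrDl ler_pdivlMr // addrC.
  by apply: ltW; case/andP: nE.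
have NV : 0 < N ^+ d by rewrite exprn_gt0.
have step2 : normc (theta Q N (a - y *: ev j) t - xi n) <= K * N ^+ d * (c * z * v).
  have := HK N t z (a - (n%:R * h) *: ev j) j N1 t0; rewrite z0 (le_trans zh h1) -/v.
  have czv : c * z * v <= 1.
    by apply: le_trans chv; rewrite ler_wpM2r ?(ltW v0) // ler_wpM2l //; lra.
  move=> /(_ isT czv) [_ [/(_ 0%N isT)]].
  rewrite mul0r scale0r subr0 mul1r -/(xi n) => H _; move: H.
  have -> : a - (n%:R * h) *: ev j - z *: ev j = a - y *: ev j.
    by rewrite -addrA -opprD -scalerDl /z addrCA subrr addr0.
  by [].
have step1 := osc n 0%N.
have xi0 : xi 0%N = theta Q N a t by rewrite /xi mul0r scale0r subr0.
rewrite xi0 in step1.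
have -> : theta Q N (a - y *: ev j) t - theta Q N a t =
  (theta Q N (a - y *: ev j) t - xi n) + (xi n - theta Q N a t) by rewrite addrA subrK.
apply: le_trans (normc_triangle _ _) _.
apply: le_trans (lerD step2 step1) _.
have -> : M%:R * (c * h * v) = c * v.
  by rewrite /h; field; rewrite gt_eqF.
have hv : h <= v ^+ 3.
  rewrite /h -[v ^+ 3]invrK lef_pV2 ?posrE ?invr_gt0 ?exprn_gt0 // -exprVn.
  by apply: ltW; apply: le_lt_trans MR; lra.
have zv : c * z * v <= c * v ^+ 4.
  rewrite -mulrA ler_wpM2l //; first by lra.
  by rewrite (exprSr v 3) ler_wpM2r ?(ltW v0) // (le_trans zh).
have := ler_wpM2l (mulr_ge0 (ltW K0) (ltW NV)) zv.
by rewrite exprMn; lra.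
Qed.

Lemma theta_shift : Q^T = Q -> exists2 C : R, 0 < C &
  forall N t a b, 1 <= N -> 0 <= t ->
    normc (theta Q N b t - theta Q N a t) <=
    C * N ^+ d * (t * N + N^-1) ^+ 4.
Proof.
move=> Qs; have [C C0 HC] := theta_step Qs.
exists (d%:R * C + 1) => [|N t a b N1 t0]; first by rewrite ltr_wpDl ?mulr_ge0 // ltW.
pose X := C * N ^+ d * (t * N + N^-1) ^+ 4.
pose m (k : nat) : 'cV[R]_d := \col_i (if (i < k)%N then b i 0 else a i 0).
have m0 : m 0%N = a by apply/colP => i; rewrite mxE.
have md : m d = b by apply/colP => i; rewrite mxE ltn_ord.
have step k : (k <= d)%N -> normc (theta Q N (m k) t - theta Q N a t) <= k%:R * X.
  elim: k => [|k IH] kd; first by rewrite m0 subrr normc0 mul0r.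
  pose j := Ordinal kd.
  have mS : m k.+1 = m k - (a j 0 - b j 0) *: ev j.
    apply/colP => i; rewrite subevE !mxE ltnS.
    have [->|ij] := eqVneq i j; first by rewrite /= leqnn ltnn mulr1; ring.
    rewrite mulr0 subr0 leq_eqVlt.
    have -> : (nat_of_ord i == k) = false.
      by apply: contraNF ij => /eqP ik; apply/eqP/val_inj.
    by [].
  rewrite -natr1 mulrDl mul1r mS.
  have -> : theta Q N (m k - (a j 0 - b j 0) *: ev j) t - theta Q N a t =
    (theta Q N (m k) t - theta Q N a t) +
    (theta Q N (m k - (a j 0 - b j 0) *: ev j) t - theta Q N (m k) t).
    by rewrite [RHS]addrC addrA subrK.
  apply: le_trans (normc_triangle _ _) (lerD (IH (ltnW kd)) _).
  exact: HC.
rewrite -md; apply: le_trans (step d (leqnn d)) _.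
have X0 : 0 <= N ^+ d * (t * N + N^-1) ^+ 4.
  rewrite mulr_ge0 ?exprn_ge0 ?addr_ge0 ?mulr_ge0 ?invr_ge0 //; lra.
by rewrite /X; lra.
Qed.

End LowFrequencies.


(** * Theta sums of irrational forms on compact frequency ranges *)

Section Irrationality.
Context {R : realType} {d : nat}.
Variable (Q : 'M[R]_d).
Implicit Types (n h u : 'cV[int]_d) (N t : R).

Local Notation zv j := (delta_mx j 0 : 'cV[int]_d).

Lemma nu0_int (x : R) : nu x = 0 -> x \is a Num.int.
Proof.
move=> x0; have := nu_ge_cfrac x; rewrite x0 pmulr_rle0 // normr_le0 => /eqP c0.
have -> : x = (Num.floor (x + 2^-1))%:~R by apply/eqP; rewrite -subr_eq0 -/(cfrac x) c0.
by rewrite intr_int.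
Qed.

(** Compactness: the sum of the squares of these quantities over all entries is continuous in t, and
    a zero t would make 2 t q Q integral. Its minimum on [tau, T] is therefore positive, and some
    entry carries a fixed share of it. *)
Lemma nu_irrational (tau T : R) (q : nat) : irrational_mx Q -> 0 < tau -> (0 < q)%N ->
  exists2 eta : R, 0 < eta & forall t, tau <= t <= T ->
    exists i j, eta < nu (2 * t * Q i j * q%:R).
Proof.
move=> irr tau0 q0.
have [Tt|tT] := ltP T tau.
  by exists 1 => // t /andP[h1 h2]; move: (le_trans h1 h2); rewrite leNgt Tt.
pose g (p : 'I_d * 'I_d) t := nu (2 * t * Q p.1 p.2 * q%:R) ^+ 2.
pose f t := \sum_(p <- enum [set: 'I_d * 'I_d]%SET) g p t.
have gc p : continuous (g p).
  have -> : g p = (fun t => 2 - 2 * cos ((2 * pi * 2 * Q p.1 p.2 * q%:R) * t)).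
    by apply/funext => t; rewrite /g nu_sqr; congr (2 - 2 * cos _); ring.
  move=> t; apply: cvgB; first exact: cvg_cst.
  apply: cvgM; first exact: cvg_cst.
  apply: (cvg_comp (fun t => (2 * pi * 2 * Q p.1 p.2 * q%:R) * t)).
    by apply: cvgM; [exact: cvg_cst|exact: cvg_id].
  exact: continuous_cos.
have fc : continuous f.
  rewrite /f; elim: (enum _) => [|p s IH] t.
    by under eq_fun do rewrite big_nil; exact: cvg_cst.
  under eq_fun do rewrite big_cons.
  by apply: cvgD; [exact: gc|exact: IH].
have [t0 t0in t0min] := EVT_min tT (continuous_subspaceT fc).
have g0 p t : 0 <= g p t by exact: sqr_ge0.
have ft0 : 0 < f t0.
  rewrite lt_neqAle sumr_ge0 // andbT eq_sym; apply/negP => f0.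
  apply: irr; exists (2 * t0 * q%:R).
    rewrite !mulf_neq0 // ?pnatr_eq0 -?lt0n //.
    by move: t0in; rewrite in_itv /= => /andP[? _]; rewrite gt_eqF // (lt_le_trans tau0).
  move=> i j; have -> : 2 * t0 * q%:R * Q i j = 2 * t0 * Q i j * q%:R by ring.
  apply: nu0_int.
  move: f0; rewrite /f psumr_eq0 // => /allP/(_ (i, j)).
  by rewrite mem_enum finset.in_setT => /(_ isT)/=; rewrite sqrf_eq0 => /eqP.
pose m := (size (enum [set: 'I_d * 'I_d]%SET))%:R + 1 : R.
have m1 : 1 <= m by rewrite lerDr.
exists (Num.sqrt (f t0 / (2 * m))).
  by rewrite sqrtr_gt0 divr_gt0 // mulr_gt0 //; lra.
move=> t tin; apply: contrapT => H.
have gle p : g p t <= f t0 / (2 * m).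
  rewrite /g -[leRHS]sqr_sqrtr; last by rewrite divr_ge0 ?(ltW ft0) // mulr_ge0 //; lra.
  apply: lerXn2r; rewrite ?nnegrE ?nu_ge0 ?sqrtr_ge0 //.
  by rewrite leNgt; apply/negP => h; apply: H; exists p.1, p.2.
have : f t0 <= f t by apply: t0min; rewrite in_itv.
have : f t <= (m - 1) * (f t0 / (2 * m)).
  rewrite /m addrK [leRHS]mulr_natl -sumr_size /f.
  by apply: ler_sum => p _; exact: gle.
have -> : (m - 1) * (f t0 / (2 * m)) = f t0 / 2 - f t0 / (2 * m).
  by field; rewrite gt_eqF //; lra.
have : 0 < f t0 / (2 * m) by rewrite divr_gt0 // mulr_gt0 //; lra.
lra.
Qed.

Lemma fact_multiple (K m : nat) : (0 < m <= K)%N -> exists q, (K`! = m * q)%N.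
Proof.
move=> mK; have /dvdnP[q ->] : (m %| K`!)%N by exact: dvdn_fact.
by exists q; rewrite mulnC.
Qed.

(* More than (25 + 2 K)^d / (K + 1) points h of a box lie so densely that some
   translates by 0, ..., K steps along e_j meet. *)
Lemma dense_collision (G : seq 'cV[int]_d) (B K : nat) (j : 'I_d) : uniq G ->
  {subset G <= box 0 B} ->
  ((2 * (B + K)).+1 ^ d < K.+1 * size G)%N ->
  exists h h' (m : nat), [/\ h \in G, h' \in G, (0 < m <= K)%N & h - h' = m%:Z *: zv j].
Proof.
move=> uG GB big; apply: contrapT => H.
pose F (p : 'cV[int]_d * nat) : 'cV[int]_d := p.1 + p.2%:Z *: zv j.
pose r := [seq F (h, k) | h <- G, k <- iota 0 K.+1].
have ur : uniq r.
  apply: allpairs_uniq => //; first exact: iota_uniq.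
  have swap (x y z w : 'cV[int]_d) : x + z = y + w -> x - y = w - z.
    by move=> e; apply/eqP; rewrite subr_eq addrAC [w + y]addrC -e addrK.
  have mem_r x k : (x, k) \in [seq (x, k) | x <- G, k <- iota 0 K.+1] ->
      x \in G /\ k \in iota 0 K.+1.
    by case/allpairsP => -[x' k'] [? ? [-> ->]].
  move=> [a1 b1] [a2 b2] /mem_r[a1G b1K] /mem_r[a2G b2K]; rewrite /F /= => E.
  move: b1K b2K; rewrite !mem_iota !add0n /= => b1K b2K.
  have [b12|b12|b12] := ltngtP b1 b2; last 1 first.
  - by move: E; rewrite b12 => /addIr ->.
  - exfalso; apply: H; exists a1, a2, (b2 - b1)%N; split => //; first by lia.
    rewrite -subzn; last exact: ltnW.
    by rewrite scalerBl; exact: swap.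
  - exfalso; apply: H; exists a2, a1, (b1 - b2)%N; split => //; first by lia.
    rewrite -subzn; last exact: ltnW.
    by rewrite scalerBl; apply: swap.
have rB : {subset r <= box 0 (B + K)}.
  move=> x /allpairsP[[h k] [/GB/mem_box hB kK ->]].
  apply/mem_box => i; rewrite /F !mxE.
  move: kK; rewrite mem_iota add0n /= => kK {x}.
  have E (z w : int) : 0 <= w <= K%:Z -> `|z - 0| <= B%:Z -> `|z + w - 0| <= (B + K)%:Z.
    by clear; lia.
  have E2 (b : bool) : 0 <= k%:Z * (b%:R : int) <= K%:Z.
    by case: b; rewrite ?mulr1 ?mulr0 //=; lia.
  by apply: E; [exact: E2|have := hB i; rewrite mxE].
have := uniq_leq_size ur rB; rewrite size_box size_allpairs size_iota mulnC.
by rewrite leqNgt big.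
Qed.

Lemma psi_prod_le1 (P : pred 'I_d) N (b : 'I_d -> R) :
  \prod_(k | P k) psi N (b k) <= 1.
Proof.
elim/big_rec: _ => // k x _ x1; rewrite -[1](mulr1 1).
have [x0|x0] := leP 0 x.
  by apply: ler_pM => //; rewrite ?psi_le1 // ltW // psi_gt0.
by rewrite mulr1 (le_trans _ ler01) // pmulr_rle0 ?psi_gt0 //; exact: ltW.
Qed.

(** A point h with some coordinate of 2 t Q h at distance more than eta from Z contributes
    O(N^(-2)). If the other points had positive density, collisions would provide for each column j
    some m <= K with m 2 t Q_ij almost integral for all i; then K! 2 t Q would be almost integral,
    against [nu_irrational]. *)
Lemma cnt_small (tau T c : R) : irrational_mx Q -> 0 < tau -> 0 < c ->
  exists N0 : R, forall N t, N0 <= N -> 1 <= N -> tau <= t <= T ->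
    cnt Q N (2 * brad N) t <= c * N ^+ d.
Proof.
move=> irr tau0 c0.
(* K + 1 translates of a set of more than (c / 2) N^d points overfill the enlarged box, which has at
   most (27 N)^d points. *)
pose K := Num.truncn (2 * 27 ^+ d / c).
have Kc : 27 ^+ d < K.+1%:R * (c / 2).
  have := truncnS_gt (2 * 27 ^+ d / c); rewrite -/K ltr_pdivrMr //; lra.
have [eta0 eta00 Heta] := nu_irrational (tau := tau) T irr tau0 (fact_gt0 K).
(* The integers m found for different columns all divide K!, and passing from m to K! multiplies the
   error 2 eta by at most K!, that is, up to eta0. *)
pose eta := eta0 / (2 * (K`!)%:R).
have KF : 0 < (K`!)%:R :> R by rewrite ltr0n fact_gt0.
have eta_gt0 : 0 < eta by rewrite divr_gt0 // mulr_gt0.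
exists (1 + K%:R + 2 * 25 ^+ d / (c * eta ^+ 2)) => N t NN N1 tin.
have N0 : 0 < N by lra.
have ce : 0 < c * eta ^+ 2 by rewrite mulr_gt0 // exprn_gt0.
have h25 : 0 <= 2 * 25 ^+ d / (c * eta ^+ 2) by rewrite divr_ge0 ?mulr_ge0 ?exprn_ge0 // ltW.
have NK : K%:R <= N by lra.
have K0 : 0 <= K%:R :> R by [].
have NE : 2 * 25 ^+ d / (c * eta ^+ 2) <= N ^+ 2.
  have : N <= N ^+ 2 by rewrite expr2 ler_peMr // ltW.
  lra.
set B := (2 * brad N)%N.
have BN : B%:R <= 12 * N by rewrite /B natrM; have := brad_le N1; lra.
pose good h := [forall j, nu (2 * t * (Q *m emb h) j 0) <= eta].
pose G := [seq h <- box 0 B | good h].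
have Gle : (size G)%:R <= c / 2 * N ^+ d.
  rewrite leNgt; apply/negP => Gbig.
  have coll j : exists m, (0 < m <= K)%N /\
      forall i, nu (2 * t * Q i j * m%:R) <= 2 * eta.
    have [|||h [h' [m [hG h'G mK hh]]]] := @dense_collision G B K j.
    - by rewrite filter_uniq ?box_uniq.
    - by move=> h; rewrite mem_filter => /andP[].
    - rewrite -(ltr_nat R) natrM natrX.
      apply: (@le_lt_trans _ _ (27 ^+ d * N ^+ d)).
        rewrite -exprMn; apply: lerXn2r; rewrite ?nnegrE ?mulr_ge0 ?(ltW N0) //.
        have -> : (2 * (B + K)).+1%:R = 2 * (B%:R + K%:R) + 1 :> R.
          by rewrite -natrD -natrM natr1.
        lra.
      have Nd : 0 < N ^+ d by rewrite exprn_gt0.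
      apply: lt_trans (_ : K.+1%:R * (c / 2) * N ^+ d < _); first by rewrite ltr_pM2r.
      by rewrite -mulrA ltr_pM2l // ltr0n.
    exists m; split => // i.
    have gh x : x \in G -> nu (2 * t * (Q *m emb x) i 0) <= eta.
      by rewrite mem_filter => /andP[/forallP].
    have E : Q i j * m%:R = (Q *m emb h) i 0 - (Q *m emb h') i 0.
      have mxB (x1 x2 : 'cV[R]_d) : (x1 - x2) i 0 = x1 i 0 - x2 i 0 by rewrite !mxE.
      rewrite -mxB -mulmxBr -embN -embD hh mxE (bigD1 j) //= big1 ?addr0.
        by rewrite !mxE !eqxx /= mulr1.
      by move=> k /negPf kj; rewrite !mxE kj /= mulr0 mulr0.
    rewrite -mulrA E mulrBr; apply: le_trans (nuD _ _) _; rewrite nuN.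
    by have := gh _ hG; have := gh _ h'G; lra.
  have [i [j]] := Heta t tin; rewrite ltNge => /negP; apply.
  have [m [mK mi]] := coll j; have [q qE] := fact_multiple mK.
  rewrite qE natrM mulrA; apply: le_trans (nuMn _ _) _.
  have qK : (q%:R : R) <= (K`!)%:R by rewrite ler_nat qE leq_pmull //; case/andP: mK.
  apply: le_trans (ler_pM (nu_ge0 _) (ler0n R q) (mi i) qK) _.
  rewrite /eta; have -> : 2 * (eta0 / (2 * (K`!)%:R)) * (K`!)%:R = eta0 by field; rewrite gt_eqF.
  by [].
have bad h : ~~ good h -> \prod_j psi N (2 * t * (Q *m emb h) j 0) <= (N ^+ 2 * eta ^+ 2)^-1.
  rewrite negb_forall => /existsP[j]; rewrite -ltNge => hj.
  rewrite (bigD1 j) //=; apply: (@le_trans _ _ (psi N (2 * t * (Q *m emb h) j 0) * 1)).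
    apply: ler_wpM2l; first by rewrite ltW // psi_gt0.
    exact: psi_prod_le1.
  rewrite mulr1 /psi lef_pV2 ?posrE ?psi_den_gt0 ?mulr_gt0 ?exprn_gt0 //.
  have : N ^+ 2 * eta ^+ 2 <= N ^+ 2 * nu (2 * t * (Q *m emb h) j 0) ^+ 2.
    rewrite ler_wpM2l ?sqr_ge0 //; apply: lerXn2r; rewrite ?nnegrE ?nu_ge0 //; exact: ltW.
  lra.
rewrite /cnt (bigID good) /=.
have S1 : \sum_(h <- box 0 B | good h) \prod_j psi N (2 * t * (Q *m emb h) j 0) <= (size G)%:R.
  rewrite -big_filter -/G; apply: (@le_trans _ _ (\sum_(h <- G) 1)); last by rewrite sumr_size.
  by apply: ler_sum => h _; exact: psi_prod_le1.
have S2 : \sum_(h <- box 0 B | ~~ good h) \prod_j psi N (2 * t * (Q *m emb h) j 0) <=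
   c / 2 * N ^+ d.
  apply: (@le_trans _ _ (\sum_(h <- box 0 B | ~~ good h) (N ^+ 2 * eta ^+ 2)^-1)).
    by apply: ler_sum => h; exact: bad.
  have V0 : 0 < N ^+ 2 * eta ^+ 2 by rewrite mulr_gt0 // exprn_gt0.
  apply: (@le_trans _ _ (\sum_(h <- (box 0 B : seq 'cV[int]_d)) (N ^+ 2 * eta ^+ 2)^-1)).
    by rewrite [leRHS](bigID (fun h => ~~ good h)) /= lerDl sumr_ge0 // => *; rewrite invr_ge0 ltW.
  rewrite sumr_size size_box -[leLHS]mulr_natl ler_pdivrMr // natrX.
  apply: (@le_trans _ _ ((25 * N) ^+ d)).
    apply: lerXn2r; rewrite ?nnegrE ?mulr_ge0 ?(ltW N0) //.
    have -> : (2 * B).+1%:R = 2 * B%:R + 1 :> R by rewrite -natrM natr1.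
    lra.
  rewrite exprMn; have -> : c / 2 * N ^+ d * (N ^+ 2 * eta ^+ 2) =
    (c * eta ^+ 2 / 2 * N ^+ 2) * N ^+ d by ring.
  apply: ler_wpM2r; first by rewrite exprn_ge0 // ltW.
  by move: NE; rewrite ler_pdivrMr //; lra.
lra.
Qed.

Lemma theta_small (tau T lam : R) : Q^T = Q -> irrational_mx Q -> 0 < tau -> 0 < lam ->
  exists N0 : R, forall N a t, N0 <= N -> 1 <= N -> tau <= t <= T ->
    normc (theta Q N a t) <= lam * N ^+ d.
Proof.
move=> Qs irr tau0 lam0; have [C C0 HC] := theta_single Qs.
have c0 : 0 < lam ^+ 2 / C ^+ d by rewrite divr_gt0 // exprn_gt0.
have [N0 HN] := cnt_small T irr tau0 c0.
exists N0 => N a t NN N1 tin.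
have Np : 0 < N by lra.
rewrite -(@ler_pXn2r _ 2) ?nnegrE ?normc_ge0 ?mulr_ge0 ?exprn_ge0 ?(ltW lam0) ?(ltW Np) //.
apply: le_trans (HC N a t N1) _.
apply: le_trans (ler_wpM2l _ (HN N t NN N1 tin)) _.
  by rewrite exprn_ge0 // mulr_ge0 // ltW.
rewrite le_eqVlt; apply/orP; left; apply/eqP; rewrite !exprMn; field.
by rewrite expf_neq0 // gt_eqF.
Qed.

End Irrationality.


(** * Sparsity of the level sets *)

Section LevelSets.
Context {R : realType}.
Implicit Types (A : pred nat) (w F : nat -> R) (L C : R) (x y k l m P j J : nat).

Lemma piece_sum A w (P m y : nat) (K : R) :
  (forall k, 0 <= w k) -> {homo w : k l / (k <= l)%N >-> l <= k} ->
  (forall x, (size [seq k <- iota x P | A k])%:R <= K) ->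
  \sum_(k <- iota y (m * P) | A k) w k <= K * \sum_(i < m) w (y + i * P)%N.
Proof.
move=> w0 wdec AK; elim: m => [|m IH]; first by rewrite big_nil big_ord0 mulr0.
rewrite mulSnr iotaD big_cat big_ord_recr /= mulrDr; apply: lerD => //.
apply: (@le_trans _ _ (\sum_(k <- [seq k <- iota (y + m * P) P | A k]) w (y + m * P)%N)).
  rewrite -big_filter big_seq [leRHS]big_seq; apply: ler_sum => k.
  by rewrite mem_filter mem_iota => /andP[_ /andP[h _]]; exact: wdec.
by rewrite sumr_size -[leLHS]mulr_natl ler_wpM2r.
Qed.

Lemma harmonic_dyadic (s : nat) : \sum_(1 <= i < 2 ^ s) (i%:R : R)^-1 <= s%:R.
Proof.
elim: s => [|s IH]; first by rewrite big_geq.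
have s1 : (1 <= 2 ^ s)%N by rewrite expn_gt0.
rewrite (big_cat_nat s1) /=; last by rewrite leq_exp2l.
rewrite -natr1; apply: lerD => //.
apply: (@le_trans _ _ (\sum_(2 ^ s <= i < 2 ^ s.+1) (2 ^ s)%:R^-1)).
  rewrite big_nat [leRHS]big_nat; apply: ler_sum => i /andP[h _].
  rewrite lef_pV2 ?posrE ?ltr0n ?ler_nat //; exact: leq_trans h.
rewrite sumr_const_nat expnS mul2n -addnn addnK -[leLHS]mulr_natl.
by rewrite divff // pnatr_eq0 -lt0n.
Qed.

Lemma harmonic_le (m s : nat) : (m < 2 ^ s)%N ->
  \sum_(i < m) (i.+1%:R : R)^-1 <= s%:R.
Proof.
move=> ms; apply: le_trans (harmonic_dyadic s).
rewrite -(big_mkord xpredT (fun i => (i.+1%:R : R)^-1)) -(big_add1 _ _ 0 m.+1 xpredT (fun i => (i%:R : R)^-1)).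
rewrite (@big_cat_nat _ _ _ m.+1 1 (2 ^ s)) //= lerDl.
by apply: sumr_ge0 => i _; rewrite invr_ge0.
Qed.

(* The points where F is large come in clusters of length 2 C / kap that are
   kap L / (2 C) apart. *)
Definition level_sparse A L (C kap : R) := forall l k, (l < k)%N -> A l -> A k ->
  (k - l)%:R <= L -> kap <= C * ((k - l)%:R / L + (k - l)%:R^-1).

Lemma separated_gap A L C kap l k : 0 < L -> 1 <= C -> 0 < kap ->
  level_sparse A L C kap -> (l < k)%N -> A l -> A k ->
  (k - l)%:R <= L -> (k - l)%:R < kap * L / (2 * C) -> (k - l)%:R <= 2 * C / kap.
Proof.
move=> L0 C1 kap0 sep lk Al Ak nL nP; have C0 : 0 < C by lra.
have := sep _ _ lk Al Ak nL; set n := (k - l)%:R in nL nP *.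
have n0 : 0 < n by rewrite ltr0n subn_gt0.
have h : C * (n / L) < kap / 2.
  move: nP; rewrite ltr_pdivlMr ?mulr_gt0 // => nP.
  by rewrite mulrA ltr_pdivrMr //; lra.
rewrite mulrDr => h2; have {h h2} : kap / 2 <= C * n^-1 by lra.
rewrite ler_pdivlMr // ler_pdivlMr //; lra.
Qed.

(** A piece this short meets only one cluster: its members lie within 2 C / kap of any chosen one,
    on either side. *)
Lemma cluster_size A L C kap x P : 0 < L -> 1 <= C -> 0 < kap <= 1 ->
  level_sparse A L C kap -> P%:R <= kap * L / (2 * C) ->
  (size [seq k <- iota x P | A k])%:R <= 5 * C / kap.
Proof.
move=> L0 C1 /andP[kap0 kap1] sep PL; have C0 : 0 < C by lra.
have PL' : P%:R <= L.
  apply: le_trans PL _; rewrite ler_pdivrMr ?mulr_gt0 //.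
  have : kap * L <= L by rewrite ler_piMl // ltW.
  have : L <= L * (2 * C) by rewrite ler_peMr ?(ltW L0) //; lra.
  lra.
have Ck : C <= C / kap by rewrite ler_pdivlMr // ler_piMr // ltW.
case E : [seq k <- iota x P | A k] => [|k0 s].
  by rewrite divr_ge0 ?(ltW kap0) //; lra.
pose m := Num.truncn (2 * C / kap).
have m0 : m%:R <= 2 * C / kap by rewrite truncn_le divr_ge0 ?(ltW kap0) //; lra.
have k0in : k0 \in [seq k <- iota x P | A k] by rewrite E mem_head.
apply: (@le_trans _ _ (2 * m + 1)%:R); last first.
  by rewrite natrD natrM; move: m0 Ck; rewrite -!mulrA; lra.
rewrite ler_nat -E.
have -> : (2 * m + 1 = size [seq (k0 + i - m)%N | i <- iota 0 (2 * m + 1)])%N.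
  by rewrite size_map size_iota.
apply: uniq_leq_size; first by rewrite filter_uniq ?iota_uniq.
move=> k; move: k0in; rewrite !mem_filter !mem_iota.
move=> /andP[Ak0 /andP[k0x k0P]] /andP[Ak /andP[kx kP]].
have close a b : A a -> A b -> (x <= a)%N -> (b < x + P)%N -> (a < b)%N -> (b - a <= m)%N.
  move=> Aa Ab xa bP ab.
  have baP : (b - a < P)%N by clear -xa bP ab; lia.
  rewrite truncn_ge_nat; last by rewrite divr_ge0 ?(ltW kap0) //; lra.
  apply: (separated_gap L0 C1 kap0 sep) => //.
    by apply: le_trans PL'; rewrite ler_nat ltnW.
  by apply: lt_le_trans PL; rewrite ltr_nat.
have kk0 : (k0 - m <= k <= k0 + m)%N.
  have [h|h|->] := ltngtP k k0; last by clear; lia.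
    by have := close k k0 Ak Ak0 kx k0P h; clear -h; lia.
  by have := close k0 k Ak0 Ak k0x kP h; clear -h; lia.
apply/mapP; exists (k + m - k0)%N; first by rewrite mem_iota; clear -kk0; lia.
by clear -kk0; lia.
Qed.

Lemma piece_length L C kap : 1 <= C -> 0 < kap <= 1 -> 2 * C <= kap * L ->
  exists P : nat, [/\ (0 < P)%N, P%:R <= kap * L / (2 * C) & kap * L / (4 * C) <= P%:R].
Proof.
move=> C1 /andP[kap0 kap1] kL; have C0 : 0 < C by lra.
set v := kap * L / (2 * C); exists (Num.truncn v).
have v1 : 1 <= v by rewrite /v ler_pdivlMr ?mulr_gt0 // mul1r.
have h := truncnS_gt v; rewrite -natr1 in h.
have P1 : (1 <= Num.truncn v)%N by rewrite truncn_ge_nat //; lra.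
have P1' : 1 <= (Num.truncn v)%:R :> R by rewrite (ler_nat R 1).
split => //; first by rewrite truncn_le; lra.
have -> : kap * L / (4 * C) = v / 2 by rewrite /v; field; rewrite gt_eqF.
lra.
Qed.

Lemma piece_number L C kap P l : 1 <= C -> 0 < kap <= 1 -> (0 < P)%N -> 0 < L ->
  kap * L / (4 * C) <= P%:R -> l%:R <= L ->
  exists2 m : nat, (l <= m * P)%N & m%:R <= 5 * C / kap.
Proof.
move=> C1 /andP[kap0 kap1] P0 L0 PL lL; have C0 : 0 < C by lra.
exists (l %/ P).+1; first by rewrite mulSn addnC {1}(divn_eq l P) leq_add2l ltnW // ltn_pmod.
rewrite -natr1.
have PR : 0 < P%:R :> R by rewrite ltr0n.
have : (l %/ P)%:R <= l%:R / P%:R :> R.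
  by rewrite ler_pdivlMr // -natrM ler_nat leq_trunc_div.
have : l%:R / P%:R <= 4 * C / kap.
  rewrite ler_pdivrMr //; apply: le_trans lL _.
  have := ler_wpM2l (_ : 0 <= 4 * C / kap) PL.
  have -> : 4 * C / kap * (kap * L / (4 * C)) = L by field; rewrite !gt_eqF.
  by apply; rewrite divr_ge0 ?(ltW kap0) //; lra.
have : C <= C / kap by rewrite ler_pdivlMr // ler_piMr // ltW.
rewrite -!mulrA; lra.
Qed.

(** At most 5 C / kap pieces cover the range, and each contains at most 5 C / kap members. *)
Lemma count_block A L C kap x l : 1 <= C -> 0 < kap <= 1 -> 2 * C <= kap * L ->
  level_sparse A L C kap -> l%:R <= L ->
  \sum_(k <- iota x l | A k) (1 : R) <= 25 * C ^+ 2 / kap ^+ 2.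
Proof.
move=> C1 kap01 kL sep lL; have /andP[kap0 kap1] := kap01.
have C0 : 0 < C by lra.
have L0 : 0 < L.
  by rewrite -(pmulr_rgt0 _ kap0); lra.
have [P [P0 P1 P2]] := piece_length C1 kap01 kL.
have [m lm mb] := piece_number C1 kap01 P0 L0 P2 lL.
apply: (@le_trans _ _ (\sum_(k <- iota x (m * P) | A k) (1 : R))).
  by rewrite -(subnKC lm) iotaD big_cat /= lerDl sumr_ge0.
have H := @piece_sum A (fun=> 1) P m x (5 * C / kap) (fun=> ler01) (fun _ _ _ => lexx _)
  (fun y => cluster_size y L0 C1 kap01 sep P1).
apply: le_trans H _; rewrite sumr_const card_ord.
have := ler_wpM2l (_ : 0 <= 5 * C / kap) mb.
have -> : 5 * C / kap * (5 * C / kap) = 25 * C ^+ 2 / kap ^+ 2 by field; rewrite gt_eqF.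
by apply; rewrite divr_ge0 ?(ltW kap0) //; lra.
Qed.

(** As 0 belongs to the level set, y lies beyond its cluster and no member occurs between y and P.
    The i-th piece therefore carries weights at most 1 / (i P), and the harmonic sum over the pieces
    costs only the logarithmic factor s. *)
Lemma weighted_block A L C kap y l (s : nat) : 1 <= C -> 0 < kap <= 1 -> 2 * C <= kap * L ->
  level_sparse A L C kap -> l%:R <= L -> A 0%N -> 2 * C / kap < y%:R ->
  5 * C / kap < (2 ^ s)%:R ->
  \sum_(k <- iota y (l - y) | A k) (k%:R : R)^-1 <= 20 * C ^+ 2 / kap ^+ 2 * s%:R / L.
Proof.
move=> C1 kap01 kL sep lL A0 ylarge ms; have /andP[kap0 kap1] := kap01.
have C0 : 0 < C by lra.
have L0 : 0 < L.
  by rewrite -(pmulr_rgt0 _ kap0); lra.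
have [P [P0 P1 P2]] := piece_length C1 kap01 kL.
have [m lm mb] := piece_number C1 kap01 P0 L0 P2 lL.
have PR : 0 < P%:R :> R by rewrite ltr0n.
have y0 : (0 < y)%N.
  by rewrite -(ltr_nat R); apply: lt_trans ylarge; rewrite divr_gt0 // mulr_gt0.
have Aempty k : (y <= k)%N -> (k < P)%N -> ~~ A k.
  move=> yk kP; apply/negP => Ak.
  have k0 : (0 < k)%N by exact: leq_trans yk.
  have kPr : k%:R < kap * L / (2 * C) by apply: lt_le_trans P1; rewrite ltr_nat.
  have := @separated_gap A L C kap 0 k L0 C1 kap0 sep k0 A0 Ak; rewrite subn0.
  have kL' : k%:R <= L.
    apply: le_trans (ltW kPr) _; rewrite ler_pdivrMr ?mulr_gt0 //.
    have : kap * L <= L by rewrite ler_piMl // ltW.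
    have : L <= L * (2 * C) by rewrite ler_peMr ?(ltW L0) //; lra.
    lra.
  move=> /(_ kL' kPr) h; have : y%:R <= k%:R :> R by rewrite ler_nat.
  by move=> h3; have := lt_le_trans ylarge (le_trans h3 h); rewrite ltxx.
pose w k : R := (k.+1%:R)^-1 + 0.
have V0 k : 0 <= (k%:R : R)^-1 by rewrite invr_ge0.
(* [piece_sum] asks for a weight that is nonincreasing from 0 on, whereas the inverse of 0 is 0 by
   convention; capping at 1/P repairs this and changes nothing from P on. *)
pose w' k : R := if (k < P)%N then P%:R^-1 else k%:R^-1.
have w'0 k : 0 <= w' k by rewrite /w'; case: ifP.
have w'dec : {homo w' : k l / (k <= l)%N >-> l <= k}.
  move=> a b ab; rewrite /w'; case: ltnP => [bP|Pb].
    by rewrite (leq_ltn_trans ab bP).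
  have b0 : (0 < b)%N := leq_trans P0 Pb.
  case: ltnP => [_|Pa]; first by rewrite lef_pV2 ?posrE ?ltr0n ?ler_nat.
  by rewrite lef_pV2 ?posrE ?ltr0n ?ler_nat // (leq_trans P0).
apply: (@le_trans _ _ (\sum_(k <- iota P (m * P) | A k) w' k)).
  apply: (@le_trans _ _ (\sum_(k <- iota P (m * P) | A k && (y <= k)%N) k%:R^-1)); last first.
    rewrite big_mkcondr /= big_seq_cond [leRHS]big_seq_cond; apply: ler_sum => k.
    rewrite mem_iota => /andP[/andP[Pk _] _]; case: ifP => // _.
    by rewrite /w' ltnNge Pk.
  rewrite -[leLHS]big_filter -[leRHS]big_filter.
  set r1 := [seq _ <- _ | _]; set r2 := [seq _ <- _ | _].
  have r12 : {subset r1 <= r2}.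
    move=> k; rewrite !mem_filter !mem_iota => /andP[Ak /andP[yk kl]].
    have [kP|Pk] := ltnP k P; first by have := Aempty k yk kP; rewrite Ak.
    by rewrite Ak yk /=; clear -Pk yk kl lm; lia.
  have u1 : uniq r1 by rewrite filter_uniq ?iota_uniq.
  have u2 : uniq r2 by rewrite filter_uniq ?iota_uniq.
  have -> : \sum_(k <- r1) (k%:R : R)^-1 = \sum_(k <- r2 | k \in r1) k%:R^-1.
    rewrite -[RHS]big_filter; apply: perm_big; apply: uniq_perm => //.
      by rewrite filter_uniq.
    move=> k; rewrite [RHS]mem_filter; apply/idP/andP => [kr|[]//].
    by split=> //; exact: r12.
  by rewrite [leRHS](bigID (mem r1)) /= lerDl sumr_ge0.
apply: le_trans (@piece_sum A w' P m P (5 * C / kap) w'0 w'dec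
  (fun y => cluster_size y L0 C1 kap01 sep P1)) _.
have -> : \sum_(i < m) w' (P + i * P)%N = P%:R^-1 * \sum_(i < m) (i.+1%:R)^-1.
  rewrite mulr_sumr; apply: eq_bigr => i _.
  by rewrite /w' ltnNge leq_addr /= -mulSn natrM invfM mulrC.
have m2 : (m < 2 ^ s)%N by rewrite -(ltr_nat R) (le_lt_trans mb).
have kL0 : 0 < kap * L / (4 * C) by rewrite divr_gt0 ?mulr_gt0.
have PV : P%:R^-1 <= (kap * L / (4 * C))^-1 by rewrite lef_pV2 ?posrE.
have Ck0 : 0 <= 5 * C / kap by rewrite divr_ge0 ?(ltW kap0) //; lra.
apply: le_trans (ler_wpM2l Ck0 (ler_pM _ _ PV (harmonic_le m2))) _.
- by rewrite invr_ge0.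
- by apply: sumr_ge0 => i _; rewrite invr_ge0.
rewrite le_eqVlt; apply/orP; left; apply/eqP; field.
by rewrite !gt_eqF.
Qed.

End LevelSets.


(** * Sums over one block of frequencies *)

Section BlockSums.
Context {R : realType}.
Implicit Types (F c : nat -> R) (L C f : R) (x y l k j J : nat).

Local Notation hf := (2^-1 : R).

(** The exponents 18 and 8 realise [kap] ^ 9 = [lam] ^ 4 without roots, and leave [lam] / [kap] ^ 2
    = 2^(-2 j), a summable sequence with room for a factor 2^j. *)
Definition lam j : R := hf ^+ (18 * j).
Definition kap j : R := hf ^+ (8 * j).

Lemma lam_gt0 j : 0 < lam j. Proof. by rewrite exprn_gt0. Qed.
Lemma kap_gt0 j : 0 < kap j. Proof. by rewrite exprn_gt0. Qed.

Lemma half_le1 n : hf ^+ n <= 1.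
Proof. by rewrite exprn_ile1 //; lra. Qed.

Lemma half_le n m : (n <= m)%N -> hf ^+ m <= hf ^+ n.
Proof. by move=> nm; rewrite ler_wiXn2l //; lra. Qed.

Lemma kap_le1 j : kap j <= 1. Proof. exact: half_le1. Qed.

Lemma halfV n : (hf ^+ n)^-1 = 2 ^+ n.
Proof. by rewrite exprVn invrK. Qed.

Lemma half2 n : hf ^+ n * 2 ^+ n = 1.
Proof. by rewrite -exprMn mulVf // expr1n. Qed.

Lemma lam_kap j : lam j / kap j.+1 ^+ 2 = 2 ^+ 16 * hf ^+ (2 * j).
Proof.
rewrite /kap -exprM halfV /lam.
have -> : hf ^+ (18 * j) = hf ^+ (2 * j) * hf ^+ (16 * j).
  by rewrite -exprD; congr (_ ^+ _); lia.
have -> : 2 ^+ (8 * j.+1 * 2) = 2 ^+ (16 * j) * 2 ^+ 16 :> R.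
  by rewrite -exprD; congr (_ ^+ _); lia.
have -> : hf ^+ (2 * j) * hf ^+ (16 * j) * (2 ^+ (16 * j) * 2 ^+ 16) =
  2 ^+ 16 * hf ^+ (2 * j) * (hf ^+ (16 * j) * 2 ^+ (16 * j)) by ring.
by rewrite half2 mulr1.
Qed.

Lemma sum_half j0 J : \sum_(j0 <= j < J) hf ^+ j <= 2 * hf ^+ j0.
Proof.
have [h|h] := leqP J j0; first by rewrite big_geq // mulr_ge0.
suff -> : \sum_(j0 <= j < J) hf ^+ j = 2 * hf ^+ j0 - 2 * hf ^+ J.
  by rewrite gerBl mulr_ge0.
elim: J h => // J IH; rewrite ltnS leq_eqVlt => /orP[/eqP ->|h].
  by rewrite big_nat1 exprS; field.
by rewrite big_nat_recr ?(ltnW h) //= IH // exprS; field.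
Qed.

Lemma level_decomp f j0 J : f <= lam j0 -> (j0 <= J)%N ->
  f <= \sum_(j0 <= j < J) lam j * (lam j.+1 < f)%R%:R + lam J.
Proof.
move=> f0; elim: J => [|J IH]; first by rewrite leqn0 => /eqP <-; rewrite big_geq // add0r.
rewrite leq_eqVlt => /orP[/eqP <-|h]; first by rewrite big_geq // add0r.
rewrite big_nat_recr //=.
have S0 : 0 <= \sum_(j0 <= j < J) lam j * (lam j.+1 < f)%R%:R.
  by apply: sumr_ge0 => j _; rewrite mulr_ge0 // ltW // lam_gt0.
have L0 := lam_gt0 J.+1.
case: (ltP (lam J.+1) f) => hf'; last by rewrite mulr0; lra.
by rewrite mulr1; have := IH h; lra.
Qed.

Lemma weighted_level_sum (r : seq nat) F c j0 J : (forall k, 0 <= c k) ->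
  {in r, forall k, F k <= lam j0} -> (j0 <= J)%N ->
  \sum_(k <- r) F k * c k <=
  \sum_(j0 <= j < J) lam j * (\sum_(k <- r | lam j.+1 < F k) c k)
  + lam J * \sum_(k <- r) c k.
Proof.
move=> c0 Fle jJ.
have -> : \sum_(j0 <= j < J) lam j * (\sum_(k <- r | lam j.+1 < F k) c k) =
    \sum_(k <- r) \sum_(j0 <= j < J) lam j * (lam j.+1 < F k)%R%:R * c k.
  rewrite exchange_big /=; apply: eq_bigr => j _.
  rewrite mulr_sumr big_mkcond; apply: eq_bigr => k _.
  by case: ifP => _; rewrite ?mulr1 // mulr0 mul0r.
rewrite mulr_sumr -big_split /= big_seq [leRHS]big_seq; apply: ler_sum => k kr.
by rewrite -mulr_suml -mulrDl ler_wpM2r // level_decomp // Fle.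
Qed.

(** The form of [theta_prod] after division by powers of N, at the frequencies k / L and with
    exponent 9 for d. *)
Definition pair_bound C L F := forall l k, (l < k)%N -> (k - l)%:R <= L ->
  F k ^+ 2 * F l ^+ 2 <= C * ((k - l)%:R / L + (k - l)%:R^-1) ^+ 9.

Lemma level_separated C L F j : 0 < L -> 1 <= C -> pair_bound C L F ->
  level_sparse (fun k => lam j < F k) L C (kap j).
Proof.
move=> L0 C1 Hp l k lk Al Ak nL; have := Hp l k lk nL.
set v := _ / L + _ => h.
have n0 : 0 < (k - l)%:R :> R by rewrite ltr0n subn_gt0.
have v0 : 0 < v by rewrite addr_gt0 ?divr_gt0 ?invr_gt0.
have C0 : 0 < C by lra.
rewrite -(@ler_pXn2r _ 9) ?nnegrE ?(ltW (kap_gt0 j)) ?mulr_ge0 ?(ltW v0) ?(ltW C0) //.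
have -> : kap j ^+ 9 = lam j ^+ 2 * lam j ^+ 2.
  by rewrite -exprD /kap /lam -!exprM; congr (_ ^+ _); clear; lia.
have sq u : lam j < u -> lam j ^+ 2 <= u ^+ 2.
  move=> hu; apply: lerXn2r; rewrite ?nnegrE; [exact: ltW (lam_gt0 _)| |exact: ltW].
  exact: ltW (lt_trans (lam_gt0 _) hu).
apply: le_trans (ler_pM (sqr_ge0 _) (sqr_ge0 _) (sq _ Ak) (sq _ Al)) _.
apply: le_trans h _; rewrite exprMn ler_wpM2r ?exprn_ge0 ?(ltW v0) //.
by rewrite exprS ler_peMr ?exprn_ege1 // ltW.
Qed.

Lemma kap_large C L j J : 1 <= C -> 2 * C * 2 ^+ (8 * J) <= L -> (j <= J)%N ->
  2 * C <= kap j * L.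
Proof.
move=> C1 h jJ; have hk : kap J <= kap j by apply: half_le; rewrite leq_mul2l.
have L0 : 0 <= L by apply: le_trans h; rewrite mulr_ge0 ?exprn_ge0 //; lra.
apply: le_trans (ler_wpM2r L0 hk).
have := ler_wpM2l (ltW (kap_gt0 J)) h.
have -> : kap J * (2 * C * 2 ^+ (8 * J)) = 2 * C * (kap J * 2 ^+ (8 * J)) by ring.
by rewrite half2 mulr1.
Qed.

(** Level j contributes [lam] j times O([kap] (j + 1) ^ (-2)), a geometric series started at j0.
    Levels are resolved only up to J: what lies below [lam] J adds at most L [lam] J = O(2^(-2 J)),
    because L = O(2^(16 J)). *)
Lemma block_sum C E : 1 <= C -> 1 <= E -> exists2 C2 : R, 0 < C2 &
  forall L F x l j0 J, (forall k, 0 <= F k) -> pair_bound C L F ->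
    l%:R <= L -> 2 * C * 2 ^+ (8 * J) <= L -> L <= E * 2 ^+ (16 * J) ->
    (j0 <= J)%N -> (forall k, (x <= k < x + l)%N -> F k <= lam j0) ->
    \sum_(k <- iota x l) F k <= C2 * hf ^+ j0.
Proof.
move=> C1 E1; have C0 : 0 < C by lra.
have E0 : 0 < E by lra.
exists (25 * C ^+ 2 * 2 ^+ 17 + E); first by rewrite addr_gt0 ?mulr_gt0 ?exprn_gt0.
move=> L F x l j0 J F0 Hp lL LJ1 LJ2 jJ Fle.
have L0 : 0 < L by apply: lt_le_trans LJ1; rewrite !mulr_gt0 ?exprn_gt0.
have := @weighted_level_sum (iota x l) F (fun=> 1) j0 J (fun=> ler01).
under eq_bigr => k _ do rewrite mulr1.
move=> H; apply: le_trans (H _ jJ) _.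
  by move=> k; rewrite mem_iota => /Fle.
have T : lam J * \sum_(k <- iota x l) (1 : R) <= E * hf ^+ j0.
  rewrite sumr_size size_iota; have lCJ := le_trans lL LJ2.
  apply: le_trans (ler_wpM2l (ltW (lam_gt0 J)) lCJ) _.
  have -> : lam J = hf ^+ (2 * J) * hf ^+ (16 * J).
    by rewrite -exprD /lam; congr (_ ^+ _); clear; lia.
  have -> : hf ^+ (2 * J) * hf ^+ (16 * J) * (E * 2 ^+ (16 * J)) =
    E * hf ^+ (2 * J) * (hf ^+ (16 * J) * 2 ^+ (16 * J)) by ring.
  by rewrite half2 mulr1 ler_wpM2l ?(ltW E0) // half_le // (leq_trans jJ) // leq_pmull.
have S : \sum_(j0 <= j < J) lam j * (\sum_(k <- iota x l | lam j.+1 < F k) 1) <=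
    25 * C ^+ 2 * 2 ^+ 17 * hf ^+ j0.
  apply: (@le_trans _ _ (\sum_(j0 <= j < J) 25 * C ^+ 2 * 2 ^+ 16 * hf ^+ j)).
    rewrite big_nat [leRHS]big_nat; apply: ler_sum => j /andP[j0j jJ'].
    have kl : 0 < kap j.+1 <= 1 by rewrite kap_gt0 kap_le1.
    have cb := count_block x C1 kl (kap_large C1 LJ1 jJ') (level_separated L0 C1 Hp) lL.
    apply: le_trans (ler_wpM2l (ltW (lam_gt0 j)) cb) _.
    rewrite mulrCA lam_kap [leLHS]mulrA ler_wpM2l //; last by rewrite half_le // leq_pmull.
    by rewrite mulr_ge0 ?exprn_ge0 // mulr_ge0 // sqr_ge0.
  rewrite -mulr_sumr exprS.
  have := ler_wpM2l (_ : 0 <= 25 * C ^+ 2 * 2 ^+ 16) (sum_half j0 J).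
  have -> : 25 * C ^+ 2 * (2 * 2 ^+ 16) * hf ^+ j0 =
    25 * C ^+ 2 * 2 ^+ 16 * (2 * hf ^+ j0) by ring.
  by apply; rewrite !mulr_ge0 ?exprn_ge0 ?(ltW C0).
by rewrite mulrDl; apply: lerD.
Qed.

Lemma ltn_pow2 n : (n < 2 ^ n)%N. Proof. exact: ltn_expl. Qed.

Lemma linear_half (a j : nat) : ((8 * j + 8 + a)%:R : R) <= (8 + a)%:R * 2 ^+ j.
Proof.
rewrite -natrX -natrM ler_nat; have := ltn_pow2 j; nia.
Qed.

(** The lower bound on F 0 puts the frequency 0 in every level set considered, which is what
    [weighted_block] needs to gain 1 / L. The logarithmic factor, linear in j, is absorbed by 2^j
    through [linear_half]. *)
Lemma first_block_sum C E : 1 <= C -> 1 <= E -> exists2 C2 : R, 0 < C2 &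
  forall L F y l j0 J, (forall k, 0 <= F k) -> pair_bound C L F ->
    l%:R <= L -> 2 * C * 2 ^+ (8 * J) < y%:R -> y%:R <= L ->
    L <= E * 2 ^+ (16 * J) -> (j0 <= J)%N -> lam j0.+1 < F 0%N ->
    (forall k, (y <= k < l)%N -> F k <= lam j0) ->
    \sum_(k <- iota y (l - y)) F k / k%:R <= C2 * hf ^+ j0 / L.
Proof.
move=> C1 E1; have C0 : 0 < C by lra.
have E0 : 0 < E by lra.
pose s0 := (Num.truncn (5 * C + E)).+1.
have s0C : 5 * C + E < (2 ^ s0)%:R.
  by apply: lt_trans (truncnS_gt _) _; rewrite ltr_nat ltn_pow2.
pose D := (8 + s0)%:R : R.
have D0 : 0 < D by rewrite ltr0n.
exists (20 * C ^+ 2 * 2 ^+ 17 * D + 2 * E * D).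
  by rewrite addr_gt0 ?mulr_gt0 ?exprn_gt0.
move=> L F y l j0 J F0 Hp lL LJ1 yL LJ2 jJ F00 Fle.
have LJ1' := le_trans (ltW LJ1) yL.
have L0 : 0 < L by apply: lt_le_trans LJ1'; rewrite !mulr_gt0 ?exprn_gt0.
have c0 k : 0 <= (k%:R : R)^-1 by rewrite invr_ge0.
apply: le_trans (@weighted_level_sum (iota y (l - y)) F _ j0 J c0 _ jJ) _.
  move=> k; rewrite mem_iota => /andP[yk kl]; apply: Fle; rewrite yk /=.
  by clear -yk kl; lia.
have y0 : (0 < y)%N.
  by rewrite -(ltr_nat R); apply: lt_trans LJ1; rewrite !mulr_gt0 ?exprn_gt0.
have T : lam J * \sum_(k <- iota y (l - y)) (k%:R : R)^-1 <= 2 * E * D * hf ^+ j0 / L.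
  have Hh : \sum_(k <- iota y (l - y)) (k%:R : R)^-1 <= (16 * J + s0)%:R.
    apply: le_trans (harmonic_dyadic (16 * J + s0)).
    have lS : (l <= 2 ^ (16 * J + s0))%N.
      rewrite -(ler_nat R) (le_trans lL) // (le_trans LJ2) // expnD natrM mulrC !natrX.
      rewrite ler_wpM2l ?exprn_ge0 //; rewrite natrX in s0C; lra.
    have [yl|ly] := leqP y l; last first.
      have -> : (l - y = 0)%N by clear -ly; lia.
      by rewrite big_nil sumr_ge0.
    rewrite -/(index_iota y l) (big_cat_nat y0 (leq_trans yl lS)) /=.
    rewrite (big_cat_nat yl lS) /=.
    by rewrite addrCA lerDl addr_ge0 // sumr_ge0.
  apply: le_trans (ler_wpM2l (ltW (lam_gt0 J)) Hh) _.
  have H2 : (16 * J + s0)%:R <= 2 * (D * 2 ^+ J) :> R.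
    apply: le_trans (ler_wpM2l (ler0n R 2) (linear_half s0 J)).
    by rewrite -natrM ler_nat; clear; lia.
  apply: le_trans (ler_wpM2l (ltW (lam_gt0 J)) H2) _.
  rewrite ler_pdivlMr //.
  have H3 : 0 <= lam J * (2 * (D * 2 ^+ J)) by rewrite !mulr_ge0 ?exprn_ge0 ?(ltW D0) ?(ltW (lam_gt0 J)).
  apply: le_trans (ler_wpM2l H3 LJ2) _.
  have -> : lam J = hf ^+ J * hf ^+ J * hf ^+ (16 * J).
    by rewrite -!exprD /lam; congr (_ ^+ _); clear; lia.
  have -> : hf ^+ J * hf ^+ J * hf ^+ (16 * J) * (2 * (D * 2 ^+ J)) * (E * 2 ^+ (16 * J)) =
    2 * E * D * hf ^+ J * (hf ^+ J * 2 ^+ J) * (hf ^+ (16 * J) * 2 ^+ (16 * J)) by ring.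
  rewrite !half2 !mulr1 ler_wpM2l ?half_le // !mulr_ge0 ?(ltW E0) ?(ltW D0) //.
have S : \sum_(j0 <= j < J) lam j * (\sum_(k <- iota y (l - y) | lam j.+1 < F k) (k%:R)^-1) <=
    20 * C ^+ 2 * 2 ^+ 17 * D * hf ^+ j0 / L.
  apply: (@le_trans _ _ (\sum_(j0 <= j < J) 20 * C ^+ 2 * 2 ^+ 16 * D / L * hf ^+ j)).
    rewrite big_nat [leRHS]big_nat; apply: ler_sum => j /andP[j0j jJ'].
    have kl : 0 < kap j.+1 <= 1 by rewrite kap_gt0 kap_le1.
    have A0 : lam j.+1 < F 0%N.
      by apply: le_lt_trans F00; apply: half_le; rewrite leq_mul2l ltnS.
    have yl : 2 * C / kap j.+1 < y%:R.
      apply: le_lt_trans LJ1; rewrite /kap halfV ler_wpM2l ?mulr_ge0 ?(ltW C0) //.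
      by rewrite ler_weXn2l ?ler1n // leq_mul2l.
    have s2 : 5 * C / kap j.+1 < (2 ^ (8 * j.+1 + s0))%:R.
      by rewrite /kap halfV expnD natrM mulrC !natrX ltr_pM2l ?exprn_gt0 // -natrX; lra.
    have cb := weighted_block C1 kl (kap_large C1 LJ1' jJ') (level_separated L0 C1 Hp) lL A0 yl s2.
    apply: le_trans (ler_wpM2l (ltW (lam_gt0 j)) cb) _.
    have -> : lam j * (20 * C ^+ 2 / kap j.+1 ^+ 2 * (8 * j.+1 + s0)%:R / L) =
      20 * C ^+ 2 / L * ((lam j / kap j.+1 ^+ 2) * (8 * j.+1 + s0)%:R) by ring.
    rewrite lam_kap.
    have -> : 20 * C ^+ 2 * 2 ^+ 16 * D / L * hf ^+ j =
      20 * C ^+ 2 / L * (2 ^+ 16 * hf ^+ (2 * j) * (D * 2 ^+ j)).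
      rewrite mul2n -addnn exprD.
      have -> : 2 ^+ 16 * (hf ^+ j * hf ^+ j) * (D * 2 ^+ j) =
         2 ^+ 16 * hf ^+ j * D * (hf ^+ j * 2 ^+ j) by ring.
      by rewrite half2; ring.
    apply: ler_wpM2l.
      by apply: divr_ge0; [apply: mulr_ge0 => //; exact: sqr_ge0|exact: ltW].
    apply: ler_wpM2l; first by rewrite mulr_ge0 ?exprn_ge0.
    have -> : (8 * j.+1 + s0 = 8 * j + 8 + s0)%N by clear; lia.
    exact: linear_half.
  rewrite -mulr_sumr.
  have P0 : 0 <= 20 * C ^+ 2 * 2 ^+ 16 * D / L.
    by rewrite divr_ge0 ?mulr_ge0 ?exprn_ge0 ?(ltW C0) ?(ltW D0) ?(ltW L0).
  apply: le_trans (ler_wpM2l P0 (sum_half j0 J)) _.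
  by rewrite le_eqVlt; apply/orP; left; apply/eqP; rewrite [2 ^+ 17]exprS; ring.
have -> : (20 * C ^+ 2 * 2 ^+ 17 * D + 2 * E * D) * hf ^+ j0 / L =
  20 * C ^+ 2 * 2 ^+ 17 * D * hf ^+ j0 / L + 2 * E * D * hf ^+ j0 / L by ring.
exact: lerD.
Qed.

End BlockSums.


(** * Weighted sums over all frequencies *)

Section WeightedSums.
Context {R : realType}.
Implicit Types (F g X : nat -> R) (L C E beta e : R) (x y l k j J B m n : nat).

Local Notation hf := (2^-1 : R).

Lemma half_small e : 0 < e -> exists n, forall m, (n <= m)%N -> hf ^+ m < e.
Proof.
move=> e0; exists (Num.truncn (e^-1)).+1 => m nm.
have h : e^-1 < m%:R.
  by apply: lt_le_trans (truncnS_gt _) _; rewrite ler_nat.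
have m0 : 0 < m%:R :> R by apply: lt_trans h; rewrite invr_gt0.
rewrite -[e]invrK exprVn ltf_pV2 ?posrE ?invr_gt0 ?exprn_gt0 //.
by apply: lt_trans h _; rewrite -natrX ltr_nat ltn_pow2.
Qed.

(* 1/b^2 <= 1/(b - 1/2) - 1/(b + 1/2), and the sum telescopes. *)
Lemma tail_sqr (m n : nat) : (0 < m)%N ->
  \sum_(m <= b < n) (b%:R ^+ 2 : R)^-1 <= 2 / m%:R.
Proof.
move=> m0; have m1 : 1 <= m%:R :> R by rewrite ler1n.
have [nm|/ltnW mn] := leqP n m; first by rewrite big_geq // divr_ge0.
suff H : \sum_(m <= b < n) (b%:R ^+ 2 : R)^-1 <= (m%:R - hf)^-1 - (n%:R - hf)^-1.
  apply: le_trans H _.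
  have n1 : 1 <= n%:R :> R by rewrite ler1n (leq_trans m0).
  apply: (@le_trans _ _ (m%:R - hf)^-1).
    by rewrite gerBl invr_ge0; lra.
  rewrite -[2 / _]invrK invf_div lef_pV2 ?posrE; lra.
elim: n mn => [|n IH]; first by rewrite leqn0 => /eqP ->; rewrite big_geq // subrr.
rewrite leq_eqVlt => /orP[/eqP <-|mn]; first by rewrite big_geq // subrr.
rewrite big_nat_recr //=; apply: le_trans (lerD (IH mn) (lexx _)) _.
have n1 : 1 <= n%:R :> R by rewrite ler1n (leq_trans m0).
rewrite -[n.+1%:R]natr1; set v := n%:R in n1 *.
have E : (v - hf)^-1 - (v + 1 - hf)^-1 = (v ^+ 2 - 4^-1)^-1.
  by field; apply/and3P; split; apply: lt0r_neq0; nra.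
have : (v ^+ 2)^-1 <= (v ^+ 2 - 4^-1)^-1 by rewrite lef_pV2 ?posrE //; nra.
move: E; move: (v - hf)^-1 (v + 1 - hf)^-1 (v ^+ 2 - 4^-1)^-1 (v ^+ 2)^-1 (m%:R - hf)^-1.
by move=> a b c f h; lra.
Qed.

(** The spare half power of k, due to the exponent 9 instead of 8, is kept in the factor sqrt(C3 /
    m), which tends to 0. For m of order sqrt N the rest, m^(-4), is N^(-2), so that the whole is
    o(N^(-2)). *)
Lemma mid_sum F (C3 : R) (m n : nat) : (0 < m)%N -> 0 <= C3 -> (forall k, 0 <= F k) ->
  (forall k, (m <= k < n)%N -> F k ^+ 2 <= C3 / k%:R ^+ 9) ->
  \sum_(m <= k < n) F k / k%:R <= Num.sqrt (C3 / m%:R) * 2 / m%:R ^+ 4.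
Proof.
move=> m0 C30 F0 HF; have mR : 0 < m%:R :> R by rewrite ltr0n.
set q := Num.sqrt _; have q0 : 0 <= q by exact: sqrtr_ge0.
have q2 : q ^+ 2 = C3 / m%:R by rewrite sqr_sqrtr // divr_ge0 // ltW.
apply: (@le_trans _ _ (\sum_(m <= k < n) q / m%:R ^+ 3 * (k%:R ^+ 2)^-1)).
  rewrite big_nat [leRHS]big_nat; apply: ler_sum => k /andP[mk kn].
  have k0 : 0 < k%:R :> R by rewrite ltr0n (leq_trans m0).
  have mkR : m%:R <= k%:R :> R by rewrite ler_nat.
  have Fk : F k <= q / k%:R ^+ 4.
    rewrite -(@ler_pXn2r _ 2) ?nnegrE ?divr_ge0 ?exprn_ge0 ?(ltW k0) //.
    apply: le_trans (HF k _) _; first by rewrite mk kn.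
    rewrite expr_div_n q2 -exprM -mulrA; apply: ler_wpM2l => //.
    rewrite -invfM lef_pV2 ?posrE ?mulr_gt0 ?exprn_gt0 //.
    by rewrite exprS ler_wpM2r // exprn_ge0 // ltW.
  have := ler_wpM2r (_ : 0 <= k%:R^-1) Fk; rewrite invr_ge0 ltW // => /(_ isT) h.
  apply: le_trans h _; rewrite -[leLHS]mulrA -[leRHS]mulrA; apply: ler_wpM2l => //.
  rewrite -!invfM lef_pV2 ?posrE ?mulr_gt0 ?exprn_gt0 //.
  have -> : k%:R ^+ 4 * k%:R = k%:R ^+ 3 * k%:R ^+ 2 :> R by ring.
  rewrite ler_wpM2r ?exprn_ge0 ?(ltW k0) //.
  by apply: lerXn2r; rewrite ?nnegrE ?(ltW k0) ?(ltW mR).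
rewrite -mulr_sumr.
have := ler_wpM2l (_ : 0 <= q / m%:R ^+ 3) (tail_sqr n m0).
have -> : q / m%:R ^+ 3 * (2 / m%:R) = q * 2 / m%:R ^+ 4.
  by field; rewrite gt_eqF.
by apply; rewrite divr_ge0 ?exprn_ge0 ?(ltW mR).
Qed.

(** In block b one has k >= b L / 2, so that the quadratic decay of g turns into 4 beta / (L
    b^2). *)
Lemma blocks_sum g F X L beta l B : 0 <= beta -> (0 < l)%N -> L <= 2 * l%:R ->
  0 < L -> (forall k, 0 <= F k) ->
  (forall k, (0 < k)%N -> g k <= beta * L / k%:R ^+ 2) ->
  (forall b, (0 < b)%N -> \sum_(k <- iota (b * l) l) F k <= X b) ->
  \sum_(l <= k < B * l) g k * F k <=
  4 * beta / L * \sum_(1 <= b < B) X b / b%:R ^+ 2.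
Proof.
move=> b0 l0 Ll L0 F0 gb FX; have lR : 0 < l%:R :> R by rewrite ltr0n.
case: B => [|B]; first by rewrite mul0n !big_geq // mulr0.
elim: B => [|B IH]; first by rewrite mul1n !big_geq // mulr0.
rewrite [in leRHS]big_nat_recr //= mulrDr.
rewrite (@big_cat_nat _ _ _ (B.+1 * l)) /=; last 2 first.
- by rewrite mulSn leq_addr.
- by rewrite leq_mul2r leqnSn orbT.
apply: lerD => //.
have BR : 0 < B.+1%:R :> R by rewrite ltr0n.
have -> : index_iota (B.+1 * l) (B.+2 * l) = iota (B.+1 * l) l.
  by rewrite /index_iota; congr iota; rewrite -mulnBl subSnn mul1n.
apply: (@le_trans _ _ (4 * beta / L / B.+1%:R ^+ 2 * \sum_(k <- iota (B.+1 * l) l) F k)).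
  rewrite mulr_sumr big_seq [leRHS]big_seq; apply: ler_sum => k.
  rewrite mem_iota => /andP[Bk _]; apply: ler_wpM2r => //.
  have k0 : (0 < k)%N by apply: leq_trans Bk; rewrite muln_gt0.
  have kR : 0 < k%:R :> R by rewrite ltr0n.
  apply: le_trans (gb k k0) _.
  rewrite ler_pdivrMr ?exprn_gt0 //.
  have h : B.+1%:R * L / 2 <= k%:R.
    have : (B.+1 * l)%:R <= k%:R :> R by rewrite ler_nat.
    have := ler_wpM2l (ltW BR) Ll; rewrite natrM; lra.
  have h2 : (B.+1%:R * L / 2) ^+ 2 <= k%:R ^+ 2.
    apply: lerXn2r; rewrite ?nnegrE ?(ltW kR) //.
    by rewrite divr_ge0 // mulr_ge0 // ltW.
  have P0 : 0 <= 4 * beta / L / B.+1%:R ^+ 2.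
    by rewrite !divr_ge0 ?mulr_ge0 ?exprn_ge0 ?(ltW L0).
  have := ler_wpM2l P0 h2.
  suff -> : 4 * beta / L / B.+1%:R ^+ 2 * (B.+1%:R * L / 2) ^+ 2 = beta * L by [].
  by clear -L0 BR; move: (B.+1%:R) BR => w w0; field; rewrite !gt_eqF.
rewrite mulrAC -mulrA; apply: ler_wpM2l; first by rewrite divr_ge0 ?mulr_ge0 ?(ltW L0).
rewrite ler_wpM2r ?invr_ge0 ?exprn_ge0 // FX //.
Qed.

(** Three ranges: below l the weight 1/k and [first_block_sum]; the blocks before Tb, where F is
    below level j0; and all later blocks, where only F <= 1 is used and the tail of the series of
    1/b^2 supplies 1 / Tb. *)
Lemma tail_sum C E beta : 1 <= C -> 1 <= E -> 0 <= beta ->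
  exists2 C2 : R, 0 < C2 &
  forall L F g y l j0 J Tb B, (forall k, 0 <= F k <= 1) -> pair_bound C L F ->
    l%:R <= L -> L <= 2 * l%:R -> 2 * C * 2 ^+ (8 * J) < y%:R -> (y <= l)%N ->
    L <= E * 2 ^+ (16 * J) -> (j0 <= J)%N -> lam j0.+1 < F 0%N -> (0 < Tb)%N ->
    (forall k, (y <= k < Tb * l)%N -> F k <= lam j0) ->
    (forall k, (0 < k)%N -> [/\ 0 <= g k, g k <= k%:R^-1 & g k <= beta * L / k%:R ^+ 2]) ->
    \sum_(y <= k < B * l) g k * F k <= C2 / L * (hf ^+ j0 + Tb%:R^-1).
Proof.
move=> C1 E1 b0; have [D1 D10 H1] := block_sum C1 E1.
have [D2 D20 H2] := first_block_sum C1 E1.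
exists (D2 + 8 * beta * D1) => [|L F g y l j0 J Tb B F01 Hp lL Ll LJ1 yl LJ2 jJ F00 Tb0 Fle gb].
  by rewrite ltr_wpDr ?mulr_ge0 // ltW.
have F0 k : 0 <= F k by case/andP: (F01 k).
have C0 : 0 < C by lra.
have y0 : (0 < y)%N.
  by rewrite -(ltr_nat R); apply: lt_trans LJ1; rewrite !mulr_gt0 ?exprn_gt0.
have l0 : (0 < l)%N by exact: leq_trans yl.
have lR : 0 < l%:R :> R by rewrite ltr0n.
have L0 : 0 < L by apply: lt_le_trans lL.
have yL : y%:R <= L by apply: le_trans lL; rewrite ler_nat.
have T0 : 0 <= Tb%:R^-1 :> R by rewrite invr_ge0.
have S1 : \sum_(y <= k < l) g k * F k <= D2 * hf ^+ j0 / L.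
  have := H2 L F y l j0 J F0 Hp lL LJ1 yL LJ2 jJ F00.
  move=> /(_ _)/le_trans H; apply: le_trans (H _ _ (lexx _)).
    rewrite /index_iota big_seq [leRHS]big_seq; apply: ler_sum => k.
    rewrite mem_iota => /andP[yk _]; rewrite mulrC; apply: ler_wpM2l => //.
    by have [] := gb k (leq_trans y0 yk).
  move=> k /andP[yk kl]; apply: Fle; rewrite yk (leq_trans kl) // leq_pmull //.
pose X b : R := D1 * (if (b < Tb)%N then hf ^+ j0 else 1).
have S2 : \sum_(l <= k < B * l) g k * F k <= 4 * beta / L * \sum_(1 <= b < B) X b / b%:R ^+ 2.
  apply: blocks_sum => // [k k0|b bgt0]; first by have [] := gb k k0.
  rewrite /X; case: ifP => bT.
    apply: (H1 L F (b * l)%N l j0 J) => //; first exact: le_trans (ltW LJ1) yL.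
    move=> k /andP[bk kb]; apply: Fle; apply/andP; split.
      by apply: leq_trans bk; apply: leq_trans yl _; rewrite leq_pmull.
    by apply: leq_trans kb _; rewrite addnC -mulSn leq_mul2r bT orbT.
  have := H1 L F (b * l)%N l 0%N J F0 Hp lL (le_trans (ltW LJ1) yL) LJ2 (leq0n _).
  rewrite expr0; apply => k _.
  by rewrite /lam muln0 expr0; case/andP: (F01 k).
have S3 : \sum_(1 <= b < B) X b / b%:R ^+ 2 <= D1 * 2 * (hf ^+ j0 + Tb%:R^-1).
  apply: (@le_trans _ _ (\sum_(1 <= b < B) D1 * (hf ^+ j0 * (b%:R ^+ 2)^-1) +
     \sum_(1 <= b < B) D1 * (if (b < Tb)%N then 0 else (b%:R ^+ 2)^-1))).
    rewrite -big_split /=; apply: ler_sum => b _; rewrite /X -mulrA -mulrDr.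
    apply: ler_wpM2l; first exact: ltW.
    case: ifP => _; first by rewrite addr0.
    by rewrite mul1r lerDr mulr_ge0 ?exprn_ge0 // invr_ge0 exprn_ge0.
  rewrite -!mulr_sumr -mulrDr -[leRHS]mulrA; apply: ler_wpM2l; first exact: ltW.
  rewrite mulrDr; apply: lerD.
    rewrite mulrC; apply: ler_wpM2r; first by rewrite exprn_ge0.
    by have := tail_sqr B (ltn0Sn 0); rewrite (_ : 2 / 1%:R = 2 :> R) // divr1.
  have [BT|/ltnW TB] := leqP B Tb.
    rewrite big_nat big1 ?mulr_ge0 // => b /andP[_ bB].
    by rewrite (leq_trans bB BT).
  rewrite (big_cat_nat Tb0 TB) /= big_nat big1 ?add0r; last by move=> b /andP[_ ->].
  apply: le_trans (tail_sqr B Tb0); rewrite big_nat [leRHS]big_nat.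
  by apply: ler_sum => b /andP[Tbb _]; rewrite ltnNge Tbb.
have gF0 k : (0 < k)%N -> 0 <= g k * F k.
  by move=> k0; rewrite mulr_ge0 //; have [] := gb k k0.
have gFs a b' : (0 < a)%N -> 0 <= \sum_(a <= k < b') g k * F k.
  move=> a0; rewrite big_nat; apply: sumr_ge0 => k /andP[ak _].
  by apply: gF0; exact: leq_trans ak.
have fin1 : D2 * hf ^+ j0 / L <= D2 / L * (hf ^+ j0 + Tb%:R^-1).
  rewrite mulrAC; apply: ler_wpM2l; first by rewrite divr_ge0 ?(ltW L0) ?(ltW D20).
  by rewrite lerDl.
have -> : (D2 + 8 * beta * D1) / L * (hf ^+ j0 + Tb%:R^-1) =
  D2 / L * (hf ^+ j0 + Tb%:R^-1) + 4 * beta / L * (D1 * 2 * (hf ^+ j0 + Tb%:R^-1)) by ring.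
have bL : 0 <= 4 * beta / L by rewrite divr_ge0 ?mulr_ge0 ?(ltW L0).
have P2 : 0 <= 4 * beta / L * (D1 * 2 * (hf ^+ j0 + Tb%:R^-1)).
  apply: mulr_ge0 => //; apply: mulr_ge0; first by rewrite mulr_ge0 // ltW.
  by rewrite addr_ge0 ?exprn_ge0.
have [Bl|/ltnW lB] := leqP (B * l) l; last first.
  rewrite (big_cat_nat yl lB) /=; apply: lerD; first exact: le_trans S1 fin1.
  by apply: le_trans S2 _; apply: ler_wpM2l.
have [By|/ltnW yB] := leqP (B * l) y.
  rewrite big_geq // addr_ge0 // mulr_ge0 ?addr_ge0 ?exprn_ge0 //.
  by rewrite divr_ge0 ?(ltW L0) ?(ltW D20).
apply: (@le_trans _ _ (\sum_(y <= k < l) g k * F k)).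
  by rewrite [leRHS](big_cat_nat yB Bl) /= lerDl gFs // (leq_trans y0).
by apply: le_trans S1 (le_trans fin1 _); rewrite lerDl.
Qed.

End WeightedSums.


Ltac pos := repeat first
  [ assumption | done | apply: mulr_gt0 | apply: exprn_gt0 | apply: addr_gt0
  | rewrite invr_gt0 | rewrite ltr0n | apply: mulr_ge0 | apply: exprn_ge0
  | apply: addr_ge0 | rewrite invr_ge0 | rewrite ler0n | apply: ltW; assumption ].

Lemma ler_sum_sub (R : numDomainType) (T : eqType) (r1 r2 : seq T) (f : T -> R) :
  uniq r1 -> uniq r2 -> {subset r1 <= r2} -> {in r2, forall x, 0 <= f x} ->
  \sum_(x <- r1) f x <= \sum_(x <- r2) f x.
Proof.
move=> u1 u2 r12 f0.
have -> : \sum_(x <- r1) f x = \sum_(x <- r2 | x \in r1) f x.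
  rewrite -[RHS]big_filter; apply: perm_big; apply: uniq_perm => //.
    by rewrite filter_uniq.
  move=> x; rewrite mem_filter; apply/idP/andP => [xr|[]//].
  by split=> //; exact: r12.
rewrite [leRHS](bigID (mem r1)) /= lerDl big_seq_cond; apply: sumr_ge0 => x /andP[xr _].
exact: f0.
Qed.

(** * Summation over frequencies *)

Section Frequencies.
Context {R : realType} {d : nat}.
Variable (Q : 'M[R]_d).
Hypotheses (d9 : (9 <= d)%N) (Qs : Q^T = Q) (Qu : Q \in unitmx) (irr : irrational_mx Q).
Implicit Types (N L : R) (a b : 'cV[R]_d) (g : nat -> R) (k K : nat).

Local Notation hf := (2^-1 : R).

Definition freq_weight (beta L : R) g := forall k, (0 < k)%N ->
  [/\ 0 <= g k, g k <= k%:R^-1 & g k <= beta * L / k%:R ^+ 2].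

Definition ntheta (C N L : R) a k : R :=
  normc (theta Q N a (k%:R / L)) / (C * N) ^+ d.

Lemma pow256_bounds (x : R) : 1 <= x -> exists J : nat,
  2 ^+ (8 * J) <= x < 2 ^+ (8 * J.+1).
Proof.
move=> x1; have n1 : (0 < Num.truncn x)%N by rewrite truncn_ge_nat //; lra.
have /andP[h1 h2] := trunc_log_bounds (isT : (1 < 256)%N) n1.
exists (trunc_log 256 (Num.truncn x)); apply/andP; split.
  have : ((256 ^ trunc_log 256 (Num.truncn x))%:R : R) <= (Num.truncn x)%:R by rewrite ler_nat.
  rewrite natrX exprM (_ : (2 : R) ^+ 8 = 256%:R); last by rewrite -natrX.
  by move=> h; apply: le_trans h _; rewrite truncn_le; lra.
apply: lt_le_trans (truncnS_gt x) _.
rewrite exprM (_ : (2 : R) ^+ 8 = 256%:R); last by rewrite -natrX.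
by rewrite -natrX ler_nat.
Qed.

Lemma ntheta_pair_bound (Cup cL : R) : 0 < Cup -> 0 < cL ->
  exists2 C : R, 1 <= C & forall N L a, 2 <= N -> L = cL * N ^+ 2 ->
    pair_bound C L (ntheta Cup N L a).
Proof.
move=> Cup0 cL0; have [Cp Cp0 Hp] := theta_prod Qs Qu.
pose D := Cp / Cup ^+ d ^+ 4 * (1 + cL) ^+ d * 2 ^+ d.
have D0 : 0 < D by rewrite !mulr_gt0 ?invr_gt0 ?exprn_gt0 //; lra.
exists (1 + D) => [|N L a N2 LE l k lk nL]; first by lra.
have N0 : 0 < N by lra.
have L0 : 0 < L by rewrite LE mulr_gt0 // exprn_gt0.
set n := (k - l)%:R in nL *.
have n1 : 1 <= n by rewrite /n ler1n subn_gt0.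
have n0 : 0 < n by lra.
have ttE : k%:R / L - l%:R / L = n / L by rewrite -mulrBl -natrB // ltnW.
have tt : l%:R / L < k%:R / L by rewrite ltr_pM2r ?invr_gt0 // ltr_nat.
have := Hp N a _ _ N2 tt; rewrite ttE => H.
have X0 : 0 < (Cup * N) ^+ d by rewrite exprn_gt0 // mulr_gt0.
have -> : ntheta Cup N L a k ^+ 2 * ntheta Cup N L a l ^+ 2 =
  (normc (theta Q N a (k%:R / L)) * normc (theta Q N a (l%:R / L))) ^+ 2
   / ((Cup * N) ^+ d) ^+ 4.
  by rewrite /ntheta; field; rewrite gt_eqF.
rewrite ler_pdivrMr ?exprn_gt0 ?mulr_gt0 //; apply: le_trans H _.
set v := n / L + n^-1.
have v0 : 0 < v by rewrite addr_gt0 ?divr_gt0 ?invr_gt0.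
have v2 : v <= 2.
  have : n / L <= 1 by rewrite ler_pdivrMr // mul1r.
  have : n^-1 <= 1 by rewrite invf_le1.
  by rewrite /v; lra.
have w : n / L + (N ^+ 2 * (n / L))^-1 <= (1 + cL) * v.
  have -> : (N ^+ 2 * (n / L))^-1 = cL * n^-1.
    by rewrite LE; field; rewrite !gt_eqF.
  have : 0 <= n / L by rewrite divr_ge0 // ltW.
  have : 0 < n^-1 by rewrite invr_gt0.
  by rewrite /v; nra.
have w0 : 0 <= n / L + (N ^+ 2 * (n / L))^-1.
  have v1 : 0 <= n / L by rewrite divr_ge0 ?(ltW n0) ?(ltW L0).
  by rewrite addr_ge0 // invr_ge0 mulr_ge0 // exprn_ge0 // ltW.
have step : (N ^+ 4 * (n / L + (N ^+ 2 * (n / L))^-1)) ^+ d <=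
   (N ^+ 4) ^+ d * ((1 + cL) ^+ d * (2 ^+ d * v ^+ 9)).
  rewrite exprMn; apply: ler_wpM2l; first by rewrite !exprn_ge0 // ltW.
  apply: (@le_trans _ _ (((1 + cL) * v) ^+ d)).
    by apply: lerXn2r; rewrite ?nnegrE ?mulr_ge0 ?(ltW v0) //; lra.
  rewrite exprMn; apply: ler_wpM2l; first by rewrite exprn_ge0 //; lra.
  (* As v <= 2, the d - 9 surplus factors cost only a constant. *)
  rewrite -(subnK d9) exprD [X in _ <= X * _]exprD.
  apply: ler_wpM2r; first by rewrite exprn_ge0 // ltW.
  apply: (@le_trans _ _ (2 ^+ (d - 9))); first by apply: lerXn2r; rewrite ?nnegrE ?(ltW v0).
  by rewrite ler_peMr ?exprn_ge0 // exprn_ege1 //; lra.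
apply: le_trans (ler_wpM2l (ltW Cp0) step) _.
have -> : (Cup * N) ^+ d ^+ 4 = Cup ^+ d ^+ 4 * (N ^+ 4) ^+ d.
  by rewrite exprMn exprMn -!exprM mulnC.
have -> : Cp * ((N ^+ 4) ^+ d * ((1 + cL) ^+ d * (2 ^+ d * v ^+ 9))) =
  D * v ^+ 9 * (Cup ^+ d ^+ 4 * (N ^+ 4) ^+ d).
  by rewrite /D; field; rewrite expf_neq0 // gt_eqF // exprn_gt0.
apply: ler_wpM2r; first by rewrite mulr_ge0 ?exprn_ge0 ?(ltW Cup0) ?(ltW N0).
by apply: ler_wpM2r; [rewrite exprn_ge0 // ltW | lra].
Qed.

Lemma mid_range (eta rho C3 : R) : 0 < eta -> 0 < rho -> 0 < C3 ->
  exists2 x : R, 0 <= x & forall N (F g : nat -> R), x <= N -> 1 <= N -> (forall k, 0 <= F k) ->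
    (forall k, (0 < k)%N -> k%:R <= N -> F k ^+ 2 <= C3 / k%:R ^+ 9) ->
    (forall k, (0 < k)%N -> g k <= k%:R^-1) ->
    (0 < Num.truncn (eta * Num.sqrt N))%N /\
    \sum_(Num.truncn (eta * Num.sqrt N) <= k < (Num.truncn N).+1) g k * F k <=
      32 * rho / (eta ^+ 4 * N ^+ 2).
Proof.
(* The first summand makes eta sqrt N >= 2, so that truncation loses at most half; the second makes
   C3 / k1 <= rho^2 for the truncated value k1. *)
move=> eta0 rho0 C30; pose x0 := 2 / eta + 2 * C3 / (rho ^+ 2 * eta).
have x00 : 0 < x0 by rewrite /x0; pos.
exists (x0 ^+ 2) => [|N F g A6 N1 F0 F3 g1]; first by pos.
have N0 : 0 < N := lt_le_trans ltr01 N1.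
have sN : x0 <= Num.sqrt N.
  by rewrite -[x0]ger0_norm ?(ltW x00) // -sqrtr_sqr ler_wsqrtr.
have sN2 : Num.sqrt N ^+ 2 = N by rewrite sqr_sqrtr // ltW.
set k1 := Num.truncn _.
have es2 : 2 <= eta * Num.sqrt N.
  have : 2 / eta <= Num.sqrt N by apply: le_trans sN; rewrite lerDl; pos.
  by rewrite ler_pdivrMr // mulrC.
have esR : 2 * C3 / rho ^+ 2 <= eta * Num.sqrt N.
  have : 2 * C3 / (rho ^+ 2 * eta) <= Num.sqrt N.
    by apply: le_trans sN; rewrite lerDr; pos.
  rewrite ler_pdivrMr ?mulr_gt0 ?exprn_gt0 // ler_pdivrMr ?exprn_gt0 //; lra.
have k1h : eta * Num.sqrt N / 2 <= k1%:R.
  have : eta * Num.sqrt N < k1%:R + 1 by rewrite natr1 truncnS_gt.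
  by lra.
have k1R : 0 < k1%:R :> R by lra.
have k1p : (0 < k1)%N by rewrite -(ltr_nat R).
split=> //; set y := (Num.truncn N).+1.
apply: (@le_trans _ _ (\sum_(k1 <= k < y) F k / k%:R)).
  rewrite big_nat [leRHS]big_nat; apply: ler_sum => k /andP[k1k _].
  by rewrite mulrC ler_wpM2l // g1 // (leq_trans k1p).
have {}F3 k : (k1 <= k < y)%N -> F k ^+ 2 <= C3 / k%:R ^+ 9.
  case/andP=> k1k ky; apply: F3; first exact: leq_trans k1p k1k.
  by rewrite -truncn_ge_nat ?(ltW N0).
apply: le_trans (mid_sum k1p (ltW C30) F0 F3) _.
have q1 : Num.sqrt (C3 / k1%:R) <= rho.
  rewrite -[rho]ger0_norm ?(ltW rho0) // -sqrtr_sqr ler_wsqrtr // ler_pdivrMr //.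
  have : C3 / rho ^+ 2 <= k1%:R by lra.
  by rewrite ler_pdivrMr ?exprn_gt0 // mulrC.
have q2 : eta ^+ 4 * N ^+ 2 / 16 <= k1%:R ^+ 4.
  have -> : eta ^+ 4 * N ^+ 2 / 16 = (eta * Num.sqrt N / 2) ^+ 4.
    by rewrite -[in LHS]sN2; field.
  by apply: lerXn2r; rewrite ?nnegrE ?(ltW k1R) //; lra.
rewrite ler_pdivlMr ?mulr_gt0 ?exprn_gt0 // mulrAC ler_pdivrMr ?exprn_gt0 //.
have q0 : 0 <= Num.sqrt (C3 / k1%:R) by exact: sqrtr_ge0.
have A0 : 0 <= eta ^+ 4 * N ^+ 2 by rewrite mulr_ge0 ?exprn_ge0 ?(ltW eta0) ?(ltW N0).
have q3 : eta ^+ 4 * N ^+ 2 <= 16 * k1%:R ^+ 4 by rewrite -ler_pdivrMl // mulrC.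
have := ler_pM q0 A0 q1 q3; clear; move: (Num.sqrt _) (k1%:R ^+ 4) => a b; lra.
Qed.

(** The constants are fixed in the order j0, [Tb], [tau], and N comes last. The range up to N falls
    to [mid_range]. Above N, irrationality puts all k < Tb l below level j0, and [tail_sum]
    applies. *)
Lemma freq_single (cL beta eps eta : R) : 0 < cL -> 0 <= beta -> 0 < eps -> 0 < eta ->
  exists N0 : R, forall N L a g K, N0 <= N -> 1 <= N -> L = cL * N ^+ 2 ->
    freq_weight beta L g ->
    [/\ (0 < Num.truncn (eta * Num.sqrt N))%N &
    \sum_(Num.truncn (eta * Num.sqrt N) <= k < K) g k * normc (theta Q N a (k%:R / L))
      <= eps * N ^+ d / N ^+ 2].
Proof.
move=> cL0 b0 eps0 eta0.
have [Cup Cup0 Hup] := theta_upper Q.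
have [C C1 Hpair] := ntheta_pair_bound Cup0 cL0.
have C0 : 0 < C by lra.
pose E := 1 + cL * (4 * C ^+ 2 * 2 ^+ 16).
have E1 : 1 <= E by rewrite lerDl !mulr_ge0 ?exprn_ge0 ?(ltW cL0) ?(ltW C0).
have [C2 C20 Htail] := tail_sum C1 E1 b0.
pose U := Cup ^+ d; have U0 : 0 < U by rewrite exprn_gt0.
pose c0 := (2 * Cup)^-1 ^+ d; have c00 : 0 < c0 by rewrite exprn_gt0 // invr_gt0 mulr_gt0.
(* Makes the tail bound U N^d (C2 / L) kp equal to half of the target; [rho] below does the same for
   the middle range. *)
pose kp := eps * cL / (2 * C2 * U).
have kp0 : 0 < kp by rewrite /kp; pos.
have m0 : 0 < Num.min (kp / 2) c0 by rewrite lt_min c00 andbT; pos.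
have [j0 Hj0] := half_small m0.
have hj0 : hf ^+ j0 < kp / 2 by have := Hj0 j0 (leqnn _); rewrite lt_min => /andP[].
have lj0 : lam j0.+1 < c0.
  have jj : (j0 <= 18 * j0.+1)%N by clear; lia.
  by have := Hj0 _ jj; rewrite lt_min => /andP[].
pose Tb := (Num.truncn (2 / kp)).+1.
have Tbk : Tb%:R^-1 <= kp / 2.
  rewrite -[kp / 2]invrK invf_div lef_pV2 ?posrE ?ltr0n //; last by rewrite divr_gt0.
  by apply: ltW; exact: truncnS_gt.
have l0 : 0 < lam j0 :> R by exact: lam_gt0.
(* For tau <= k / L <= Tb the bound [theta_small] puts F k below level j0. For k / L < tau and 1 / k
   <= tau the pair bound against frequency 0 does: c0^2 F(k)^2 <= C (2 tau)^9 <= 2 C tau. *)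
pose tau := Num.min (4^-1) (c0 ^+ 2 * lam j0 ^+ 2 / (2 * C)).
have tau0 : 0 < tau.
  rewrite lt_min; apply/andP; split; first by rewrite invr_gt0.
  by apply: divr_gt0; apply: mulr_gt0 => //; rewrite exprn_gt0.
have tau4 : tau <= 4^-1 by rewrite ge_min lexx.
have tauC : C * (2 * tau) <= c0 ^+ 2 * lam j0 ^+ 2.
  have : tau <= c0 ^+ 2 * lam j0 ^+ 2 / (2 * C) by rewrite ge_min lexx orbT.
  by rewrite ler_pdivlMr ?mulr_gt0 //; lra.
have Tb0 : (0 < Tb)%N by [].
clearbody tau Tb.
have [N1 HN1] := theta_small Tb%:R Qs irr tau0 (mulr_gt0 l0 U0).
pose C3 := C * (1 + cL^-1) ^+ 9 / c0 ^+ 2.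
have cLV : 0 < cL^-1 by rewrite invr_gt0.
have C1L : 0 < 1 + cL^-1 by rewrite addr_gt0.
have C30 : 0 < C3 by rewrite /C3; pos.
pose rho := eps * eta ^+ 4 / (64 * U).
have rho0 : 0 < rho by rewrite /rho; pos.
have [x0 x00 Hmid] := mid_range eta0 rho0 C30.
pose N2 : R := 2 + N1 + `|N1| + 2 * C * 2 ^+ (8 * j0) + tau^-1 + 3 / cL + x0.
exists N2.
move=> N L a g K; rewrite {}/N2 => NN N1' LE gw.
have P1 : 0 <= N1 + `|N1| by rewrite -lerBlDl sub0r -normrN ler_norm.
have P2 : 0 < 2 * C * 2 ^+ (8 * j0) by rewrite !mulr_gt0 ?exprn_gt0.
have P3 : 0 < tau^-1 by rewrite invr_gt0.
have P4 : 0 < 3 / cL by rewrite divr_gt0.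
have [A1 A2 A3] : [/\ 2 <= N, N1 <= N & 2 * C * 2 ^+ (8 * j0) <= N].
  have := normr_ge0 N1; clear -NN P1 P2 P3 P4 x00 => P0.
  by split; lra.
have [A4 A5 A6] : [/\ tau^-1 <= N, 3 / cL <= N & x0 <= N].
  by clear -NN P1 P2 P3 P4 x00; split; lra.
clear NN P1 P2 P3 P4.
have N0 : 0 < N := lt_le_trans ltr01 N1'.
have L0 : 0 < L by rewrite LE mulr_gt0 // exprn_gt0.
have L3 : 3 * N <= L.
  move: A5; rewrite ler_pdivrMr // LE expr2 mulrA => h.
  by rewrite ler_wpM2r ?(ltW N0) // mulrC.
have X0 : 0 < (Cup * N) ^+ d by rewrite exprn_gt0 // mulr_gt0.
pose F := ntheta Cup N L a.
have FE k : normc (theta Q N a (k%:R / L)) = (Cup * N) ^+ d * F k.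
  by rewrite /F /ntheta [RHS]mulrC divfK // gt_eqF.
have F01 k : 0 <= F k <= 1.
  by rewrite divr_ge0 ?normc_ge0 ?(ltW X0) //= ler_pdivrMr // mul1r Hup.
have F0 k : 0 <= F k by case/andP: (F01 k).
have F00 : c0 <= F 0%N.
  rewrite /F /ntheta mul0r ler_pdivlMr // -exprMn.
  have -> : (2 * Cup)^-1 * (Cup * N) = N / 2 by field; rewrite gt_eqF.
  exact: theta0_lower.
clear Hj0 m0; clearbody c0.
have pb : pair_bound C L F by exact: Hpair.
have F0k k : (0 < k)%N -> k%:R <= L -> c0 ^+ 2 * F k ^+ 2 <= C * (k%:R / L + k%:R^-1) ^+ 9.
  move=> k0 kL; have := pb 0%N k k0; rewrite subn0 => /(_ kL) h.
  apply: le_trans h; rewrite mulrC; apply: ler_wpM2l; first exact: sqr_ge0.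
  by apply: lerXn2r; rewrite ?nnegrE ?(ltW c00).
(* With 2^(8 J) of order N, the quantity 2^(16 J) has the order of N^2, hence of L. *)
have [J /andP[J1 J2]] : exists J, 2 ^+ (8 * J) <= N / (2 * C) < 2 ^+ (8 * J.+1).
  apply: pow256_bounds; rewrite ler_pdivlMr ?mulr_gt0 // mul1r; apply: le_trans A3.
  by rewrite ler_peMr ?exprn_ege1 ?ler1n // mulr_ge0 // ltW.
rewrite ler_pdivlMr ?mulr_gt0 // in J1; rewrite ltr_pdivrMr ?mulr_gt0 // in J2.
pose y := (Num.truncn N).+1; pose l := Num.truncn L.
have Ny : N < y%:R by exact: truncnS_gt.
have yN : y%:R <= N + 1 by rewrite -natr1 lerD2r truncn_le ltW.
have lL : l%:R <= L by rewrite truncn_le ltW.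
have Ll1 : L < l%:R + 1 by rewrite natr1 truncnS_gt.
have Ll : L <= 2 * l%:R by clear -Ll1 L3 A1; lra.
have yl : (y <= l)%N by rewrite -(ler_nat R); clear -yN Ll1 L3 A1; lra.
have jJ : (j0 <= J)%N.
  rewrite leqNgt; apply/negP => Jj.
  have h : 2 ^+ (8 * J.+1) <= 2 ^+ (8 * j0) :> R by rewrite ler_weXn2l ?ler1n // leq_mul2l.
  have := ler_wpM2l (_ : 0 <= 2 * C) h; rewrite mulr_ge0 ?(ltW C0) // => /(_ isT) h3.
  by clear -h3 J2 A3; lra.
have LJ : L <= E * 2 ^+ (16 * J).
  have h : N ^+ 2 <= 4 * C ^+ 2 * 2 ^+ 16 * 2 ^+ (16 * J).
    have -> : 4 * C ^+ 2 * 2 ^+ 16 * 2 ^+ (16 * J) = (2 ^+ (8 * J.+1) * (2 * C)) ^+ 2.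
      rewrite [RHS]exprMn -exprM (_ : (8 * J.+1 * 2 = 16 + 16 * J)%N); last by clear; lia.
      by rewrite exprD; ring.
    by apply: lerXn2r; rewrite ?nnegrE ?mulr_ge0 ?exprn_ge0 ?(ltW C0) ?(ltW N0) ?(ltW J2).
  rewrite LE /E mulrDl mul1r -mulrA.
  have := ler_wpM2l (ltW cL0) h.
  have : 0 <= 2 ^+ (16 * J) :> R by rewrite exprn_ge0.
  by move=> h1 h2; apply: le_trans h2 _; rewrite lerDr.
clearbody E.
have Fsm k : (y <= k < Tb * l)%N -> F k <= lam j0.
  case/andP=> yk kTl; have Nk : N < k%:R by apply: lt_le_trans Ny _; rewrite ler_nat.
  have k0 : 0 < k%:R :> R := lt_trans N0 Nk.
  have kT : k%:R / L <= Tb%:R.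
    rewrite ler_pdivrMr //; apply: (@le_trans _ _ (Tb%:R * l%:R)).
      by rewrite -natrM ler_nat ltnW.
    by apply: ler_wpM2l lL; rewrite ler0n.
  have [tk|tk] := leP tau (k%:R / L).
    have := HN1 N a (k%:R / L) A2 N1'; rewrite tk kT FE => /(_ isT).
    have -> : lam j0 * U * N ^+ d = (Cup * N) ^+ d * lam j0 by rewrite exprMn /U; ring.
    by rewrite ler_pM2l.
  have Vk : k%:R^-1 <= tau.
    by rewrite -[tau]invrK lef_pV2 ?posrE ?invr_gt0 // (le_trans A4 (ltW Nk)).
  have kL : k%:R <= L.
    have : k%:R / L <= 1 by clear -tk tau4; lra.
    by rewrite ler_pdivrMr // mul1r.
  have k0' : (0 < k)%N by rewrite -(ltr_nat R).
  have h1 : (k%:R / L + k%:R^-1) ^+ 9 <= 2 * tau.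
    have v0 : 0 <= k%:R / L + k%:R^-1 by rewrite addr_ge0 ?invr_ge0 ?divr_ge0 ?(ltW L0).
    have v1 : k%:R / L + k%:R^-1 <= 1 by clear -tk tau4 Vk; lra.
    rewrite exprS; apply: (@le_trans _ _ (k%:R / L + k%:R^-1)); last by clear -tk Vk; lra.
    by rewrite ler_piMr // exprn_ile1.
  have := le_trans (F0k k k0' kL) (le_trans (ler_wpM2l (ltW C0) h1) tauC).
  by rewrite ler_pM2l ?exprn_gt0 // (@ler_pXn2r _ 2) ?nnegrE ?(ltW l0).
have yJ : 2 * C * 2 ^+ (8 * J) < y%:R by clear -J1 Ny; lra.
have k1L : (0 < l)%N by apply: leq_trans yl.
have HT : \sum_(y <= k < K * l) g k * F k <= C2 / L * kp.
  apply: le_trans (Htail L F g y l j0 J Tb K F01 pb lL Ll yJ yl LJ jJ _ _ Fsm gw) _ => //.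
    exact: lt_le_trans lj0 F00.
  by apply: ler_wpM2l; [rewrite divr_ge0 ?(ltW C20) ?(ltW L0)|clear -hj0 Tbk; lra].
have NL : N <= L by apply: le_trans L3; rewrite ler_peMl ?ler1n // ltW.
have F3 k : (0 < k)%N -> k%:R <= N -> F k ^+ 2 <= C3 / k%:R ^+ 9.
  move=> k0 kN.
  have kR : 0 < k%:R :> R by rewrite ltr0n.
  have h := F0k k k0 (le_trans kN NL).
  have h1 : k%:R / L + k%:R^-1 <= (1 + cL^-1) / k%:R.
    suff h1 : k%:R / L <= cL^-1 / k%:R by rewrite mulrDl mul1r addrC lerD2l.
    rewrite ler_pdivrMr // LE.
    have -> : cL^-1 / k%:R * (cL * N ^+ 2) = N ^+ 2 / k%:R by field; rewrite !gt_eqF.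
    by rewrite ler_pdivlMr // expr2; apply: ler_pM; rewrite ?(ltW kR).
  have h2 : (k%:R / L + k%:R^-1) ^+ 9 <= (1 + cL^-1) ^+ 9 / k%:R ^+ 9.
    rewrite -expr_div_n; apply: lerXn2r; rewrite ?nnegrE //.
      by rewrite addr_ge0 ?invr_ge0 ?divr_ge0 ?(ltW L0).
    by rewrite divr_ge0 // addr_ge0 // ltW.
  have h3 := le_trans h (ler_wpM2l (ltW C0) h2).
  have -> : C3 / k%:R ^+ 9 = (C * ((1 + cL^-1) ^+ 9 / k%:R ^+ 9)) / c0 ^+ 2.
    by rewrite /C3; ring.
  by rewrite ler_pdivlMr ?exprn_gt0 // mulrC.
have g1 k : (0 < k)%N -> g k <= k%:R^-1 by move=> k0; case: (gw _ k0).
have [k1p HM] := Hmid N F g A6 N1' F0 F3 g1.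
split=> //; move: k1p HM; set k1 := Num.truncn _; rewrite -/y => k1p HM.
have gF0 k : (0 < k)%N -> 0 <= g k * F k by move=> k0; rewrite mulr_ge0 //; case: (gw _ k0).
have HS : \sum_(k1 <= k < K) g k * F k <=
    \sum_(k1 <= k < y) g k * F k + \sum_(y <= k < K * l) g k * F k.
  rewrite -big_cat; apply: ler_sum_sub; rewrite ?iota_uniq //.
  - rewrite cat_uniq !iota_uniq andbT /=; apply/hasPn => k.
    by rewrite !mem_index_iota => /andP[yk _]; rewrite negb_and -!ltnNge ltnS yk orbT.
  - move=> k; rewrite mem_cat !mem_index_iota => /andP[-> kK] /=.
    have [//|yk] := ltnP k y; rewrite /= (leq_trans kK) //.
    by rewrite leq_pmulr.
  - move=> k; rewrite mem_cat !mem_index_iota => /orP[]/andP[h _]; apply: gF0.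
      exact: leq_trans h.
    exact: leq_trans h.
under eq_bigr => k _ do rewrite FE mulrCA.
rewrite -mulr_sumr; apply: le_trans (ler_wpM2l (ltW X0) (le_trans HS (lerD HM HT))) _.
rewrite le_eqVlt; apply/orP; left; apply/eqP.
rewrite /rho /kp LE exprMn -/U; field.
by rewrite !gt_eqF.
Qed.

End Frequencies.


(** * Differences of theta sums for two translates *)

Section FrequencyDifference.
Context {R : realType} {d : nat}.
Variable (Q : 'M[R]_d).
Hypotheses (d9 : (9 <= d)%N) (Qs : Q^T = Q) (Qu : Q \in unitmx) (irr : irrational_mx Q).
Implicit Types (N L : R) (a b : 'cV[R]_d) (g : nat -> R) (k K : nat).

(** Below k1 = eta sqrt N the shift bound gives terms of size N^d k^3 / N^4, whose sum is at most
    N^(d - 4) k1^4 <= eta N^(d - 2) up to a constant. From k1 on the two theta sums are bounded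
    separately. *)
Lemma freq_diff (cL beta eps : R) : 0 < cL -> 0 <= beta -> 0 < eps ->
  exists N0 : R, forall N L a b g K, N0 <= N -> 1 <= N -> L = cL * N ^+ 2 ->
    freq_weight beta L g ->
    normc (theta Q N b 0 - theta Q N a 0) +
    \sum_(1 <= k < K) g k * normc (theta Q N b (k%:R / L) - theta Q N a (k%:R / L))
      <= eps * N ^+ d / N ^+ 2.
Proof.
move=> cL0 b0 eps0; have [C C0 HC] := theta_shift Qs.
have cLV : 0 < cL^-1 by rewrite invr_gt0.
pose D := C * (1 + cL^-1) ^+ 4; have D0 : 0 < D by rewrite /D; pos.
(* D eta <= eps / 4 settles the low range; eta <= 1 allows eta^4 to be replaced by eta. *)
pose eta := Num.min 1 (eps / (4 * D)).
have eta0 : 0 < eta by rewrite lt_min ltr01; pos.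
have eta1 : eta <= 1 by rewrite ge_min lexx.
have etaD : D * eta <= eps / 4.
  have : eta <= eps / (4 * D) by rewrite ge_min lexx orbT.
  by rewrite ler_pdivlMr; [lra|pos].
have e40 : 0 < eps / 4 by pos.
have [N1 H1] := freq_single d9 Qs Qu irr cL0 b0 e40 eta0.
exists (Num.max N1 eta^-1) => N L a b g K; rewrite ge_max => /andP[N1N Ne] N1' LE gw.
have N0 : 0 < N := lt_le_trans ltr01 N1'.
have [k1p Ha] := H1 N L a g K N1N N1' LE gw.
have [_ Hb] := H1 N L b g K N1N N1' LE gw.
move: k1p Ha Hb; set k1 := Num.truncn _ => k1p Ha Hb.
have L0 : 0 < L by rewrite LE; pos.
pose X k := normc (theta Q N b (k%:R / L) - theta Q N a (k%:R / L)).
have g0 k : (0 < k)%N -> 0 <= g k by move=> k0; case: (gw _ k0).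
have g1 k : (0 < k)%N -> g k <= k%:R^-1 by move=> k0; case: (gw _ k0).
have M0 : 0 < N ^+ d / N ^+ 2 by pos.
set M := N ^+ d / N ^+ 2 in M0.
have EM : eps * N ^+ d / N ^+ 2 = eps * M by rewrite /M; ring.
have E4M : eps / 4 * N ^+ d / N ^+ 2 = eps / 4 * M by rewrite /M; ring.
have Z : normc (theta Q N b 0 - theta Q N a 0) <= eps / 4 * M.
  apply: le_trans (HC N 0 a b N1' (lexx _)) _; rewrite mul0r add0r.
  have -> : C * N ^+ d * N^-1 ^+ 4 = C * (N^-1 ^+ 2) * M.
    by rewrite /M; field; rewrite gt_eqF.
  apply: ler_wpM2r; first exact: ltW.
  apply: le_trans etaD; apply: (@le_trans _ _ (D * N^-1 ^+ 2)).
    apply: ler_wpM2r; first by pos.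
    by rewrite ler_peMr ?(ltW C0) // exprn_ege1 // lerDl ltW.
  apply: ler_wpM2l; first exact: ltW.
  have NV : N^-1 <= eta by rewrite -[eta]invrK lef_pV2 ?posrE ?invr_gt0.
  apply: le_trans NV; rewrite expr2 ler_piMr ?invr_ge0 ?(ltW N0) //.
  by rewrite invf_le1.
have Lw : \sum_(1 <= k < k1) g k * X k <= eps / 4 * M.
  apply: (@le_trans _ _ (\sum_(1 <= k < k1) D * N ^+ d / N ^+ 4 * k1%:R ^+ 3)).
    rewrite big_nat [leRHS]big_nat; apply: ler_sum => k /andP[k0 kk].
    have kR : 0 < k%:R :> R by rewrite ltr0n.
    apply: le_trans (ler_pM (g0 _ k0) (normc_ge0 _) (g1 _ k0) (HC _ _ _ _ N1' _)) _.
      by rewrite divr_ge0 // ltW.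
    have h : (k%:R / L * N + N^-1) <= (1 + cL^-1) * (k%:R / N).
      have -> : k%:R / L * N = cL^-1 * (k%:R / N) by rewrite LE; field; rewrite !gt_eqF.
      rewrite mulrDl mul1r addrC lerD2r -[leLHS]mul1r ler_wpM2r ?invr_ge0 ?(ltW N0) //.
      by rewrite ler1n.
    have h0 : 0 <= k%:R / L * N + N^-1.
      by apply: addr_ge0; [apply: mulr_ge0; [apply: divr_ge0|] | rewrite invr_ge0]; rewrite ?ltW.
    have h4 : (k%:R / L * N + N^-1) ^+ 4 <= ((1 + cL^-1) * (k%:R / N)) ^+ 4.
      by apply: lerXn2r; rewrite ?nnegrE // (le_trans h0 h).
    apply: (@le_trans _ _ (k%:R^-1 * (C * N ^+ d * ((1 + cL^-1) * (k%:R / N)) ^+ 4))).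
      apply: ler_wpM2l; first by rewrite invr_ge0 ltW.
      by apply: ler_wpM2l => //; pos.
    have -> : k%:R^-1 * (C * N ^+ d * ((1 + cL^-1) * (k%:R / N)) ^+ 4) =
      D * N ^+ d / N ^+ 4 * k%:R ^+ 3 by rewrite /D; field; rewrite !gt_eqF.
    apply: ler_wpM2l; first by pos.
    by apply: lerXn2r; rewrite ?nnegrE ?ler0n // ler_nat ltnW.
  rewrite sumr_const_nat -[leLHS]mulr_natr.
  have k1s : k1%:R <= eta * Num.sqrt N by rewrite truncn_le; pos; rewrite sqrtr_ge0.
  have k14 : k1%:R ^+ 4 <= eta * N ^+ 2.
    apply: (@le_trans _ _ ((eta * Num.sqrt N) ^+ 4)).
      by apply: lerXn2r; rewrite ?nnegrE ?ler0n //; pos; rewrite sqrtr_ge0.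
    have -> : (eta * Num.sqrt N) ^+ 4 = eta ^+ 4 * (Num.sqrt N ^+ 2) ^+ 2 by ring.
    rewrite sqr_sqrtr ?(ltW N0) //; apply: ler_wpM2r; first by pos.
    by rewrite exprS ler_piMr ?(ltW eta0) // exprn_ile1 // ltW.
  apply: (@le_trans _ _ (D * N ^+ d / N ^+ 4 * k1%:R ^+ 4)).
    have -> : D * N ^+ d / N ^+ 4 * k1%:R ^+ 4 = D * N ^+ d / N ^+ 4 * k1%:R ^+ 3 * k1%:R by ring.
    by apply: ler_wpM2l; [pos|rewrite ler_nat subn1 leq_pred].
  apply: (@le_trans _ _ (D * N ^+ d / N ^+ 4 * (eta * N ^+ 2))).
    by apply: ler_wpM2l k14; pos.
  have -> : D * N ^+ d / N ^+ 4 * (eta * N ^+ 2) = D * eta * M.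
    by rewrite /M; field; rewrite gt_eqF.
  by apply: ler_wpM2r etaD; exact: ltW.
have Up : \sum_(k1 <= k < K) g k * X k <= eps / 4 * M + eps / 4 * M.
  rewrite -E4M; apply: le_trans (lerD Hb Ha); rewrite -big_split /= big_nat [leRHS]big_nat.
  apply: ler_sum => k /andP[k1k _]; rewrite -mulrDr; apply: ler_wpM2l.
    by apply: g0; exact: leq_trans k1k.
  by rewrite -[normc (theta Q N a _)]normcN; exact: normc_triangle.
have HS : \sum_(1 <= k < K) g k * X k <=
    \sum_(1 <= k < k1) g k * X k + \sum_(k1 <= k < K) g k * X k.
  rewrite -big_cat; apply: ler_sum_sub; rewrite ?iota_uniq //.
  - rewrite cat_uniq !iota_uniq andbT /=; apply/hasPn => k.
    by rewrite !mem_index_iota => /andP[yk _]; rewrite negb_and -[~~ (k < k1)%N]leqNgt yk orbT.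
  - move=> k; rewrite mem_cat !mem_index_iota => /andP[-> ->] /=.
    by rewrite andbT; case: ltnP.
  - move=> k; rewrite mem_cat !mem_index_iota => kk; apply: mulr_ge0; last exact: normc_ge0.
    by apply: g0; case/orP: kk => /andP[h _] //; exact: leq_trans h.
rewrite EM; apply: le_trans (lerD Z (le_trans HS (lerD Lw Up))) _.
by rewrite le_eqVlt; apply/orP; left; apply/eqP; field.
Qed.

End FrequencyDifference.


(** * Fejer kernels and comparison of lattice point counts *)

Section Fejer.
Context {R : realType}.
Implicit Types (b t u : R) (n m K M A D : nat).

Definition dirichlet n b : R[i] := \sum_(m < n) ex (m%:R * b).

Definition fejer K b : R := normc (dirichlet K b) ^+ 2 / K%:R.

Lemma geom_ex n b : (1 - ex b) * dirichlet n b = 1 - ex (n%:R * b).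
Proof.
rewrite /dirichlet; elim: n => [|n IH]; first by rewrite big_ord0 mulr0 mul0r ex0 subrr.
rewrite big_ord_recr /= mulrDr IH -[n.+1%:R]natr1 [(_ + 1) * b]mulrDl mul1r exD; ring.
Qed.

Lemma dirichlet_nu n b : nu b * normc (dirichlet n b) <= 2.
Proof.
rewrite /nu -normcM geom_ex; apply: le_trans (normc_triangle _ _) _.
by rewrite normcN normc_ex normc1.
Qed.

Lemma dirichlet_le n b : normc (dirichlet n b) <= n%:R.
Proof.
apply: le_trans (normc_sum _ _ _) _.
by under eq_bigr do rewrite normc_ex; rewrite sumr_const card_ord.
Qed.

Lemma conjc_dirichlet n b : conjc (dirichlet n b) = dirichlet n (- b).
Proof.
rewrite /dirichlet raddf_sum; apply: eq_bigr => m _.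
by rewrite mulrN exN.
Qed.

Lemma dirichletN n b : normc (dirichlet n (- b)) = normc (dirichlet n b).
Proof. by rewrite -conjc_dirichlet normc_conj. Qed.

Lemma fejer_ge0 K b : 0 <= fejer K b.
Proof. by rewrite divr_ge0 // sqr_ge0. Qed.

Lemma fejer_far K b v : (0 < K)%N -> 0 < v -> v <= nu b ->
  fejer K b <= 4 / (K%:R * v ^+ 2).
Proof.
move=> K0 v0 vb; have KR : 0 < K%:R :> R by rewrite ltr0n.
rewrite /fejer ler_pdivlMr ?mulr_gt0 ?exprn_gt0 //.
have -> : normc (dirichlet K b) ^+ 2 / K%:R * (K%:R * v ^+ 2) =
  (v * normc (dirichlet K b)) ^+ 2 by field; rewrite gt_eqF.
have h : v * normc (dirichlet K b) <= 2.
  by apply: le_trans (dirichlet_nu K b); rewrite ler_wpM2r ?normc_ge0.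
have -> : (4 : R) = 2 ^+ 2 by ring.
by apply: lerXn2r; rewrite ?nnegrE // mulr_ge0 ?normc_ge0 ?(ltW v0).
Qed.

Lemma fejerE K b : (fejer K b)%:C =
  (K%:R^-1)%:C * \sum_(p < K) \sum_(q < K) ex ((p%:R - q%:R) * b).
Proof.
rewrite /fejer mulrC realcM normc_sqr conjc_dirichlet; congr (_ * _).
rewrite mulr_suml; apply: eq_bigr => p _.
by rewrite mulr_sumr; apply: eq_bigr => q _; rewrite -exD; congr ex; ring.
Qed.

Lemma dirichlet_root M (k : int) : (0 < M)%N -> k != 0 -> (`|k|%N < M)%N ->
  dirichlet M (k%:~R / M%:R) = 0.
Proof.
move=> M0 k0 kM; have MR : 0 < M%:R :> R by rewrite ltr0n.
have := geom_ex M (k%:~R / M%:R); rewrite mulrC -[LHS]mulrC.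
rewrite [M%:R * _]mulrC divfK ?gt_eqF // ex_int subrr => /eqP.
rewrite mulf_eq0 => /orP[/eqP e0|/eqP//].
have /nu0_int /intrP[n en] : nu (k%:~R / M%:R : R) = 0 by rewrite /nu e0 normc0.
have : `|k%:~R / M%:R : R| < 1.
  by rewrite normrM normfV [`|M%:R|]ger0_norm ?(ltW MR) // ltr_pdivrMr // mul1r -intr_norm -abszE ltr_nat.
rewrite en -intr_norm -[1]/(1%:~R) ltr_int => n1.
have n0 : n = 0 by apply/eqP; rewrite -normr_le0; move: n1; lia.
move: en; rewrite n0 => /eqP; rewrite mulf_eq0 intr_eq0 (negbTE k0) invr_eq0 /=.
by rewrite gt_eqF.
Qed.

(** The grid version of having integral 1: all frequencies of the kernel are below K <= M in
    absolute value, so averaging over the M grid points keeps the constant term only. *)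
Lemma fejer_mean K M b : (0 < K)%N -> (K <= M)%N ->
  \sum_(j < M) fejer K (b - j%:R / M%:R) = M%:R.
Proof.
move=> K0 KM; have M0 := leq_trans K0 KM.
have MR : 0 < M%:R :> R by rewrite ltr0n.
have KR : 0 < K%:R :> R by rewrite ltr0n.
apply: (@complexI R); rewrite realc_sum.
under eq_bigr do rewrite fejerE.
rewrite -mulr_sumr exchange_big /=.
have H (p : 'I_K) : \sum_(j < M) \sum_(q < K) ex ((p%:R - q%:R) * (b - j%:R / M%:R)) =
    (M%:R)%:C :> R[i].
  rewrite exchange_big /= (bigD1 p) //= [X in _ + X]big1 ?addr0.
    under eq_bigr do rewrite subrr mul0r ex0.
    by rewrite sumr_const card_ord rmorph_nat.
  move=> q qp; have -> : \sum_(j < M) ex ((p%:R - q%:R) * (b - j%:R / M%:R)) =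
     ex ((p%:R - q%:R) * b) * dirichlet M (((q : nat)%:Z - (p : nat)%:Z)%:~R / M%:R).
    rewrite mulr_sumr; apply: eq_bigr => j _; rewrite -exD; congr ex.
    by rewrite intrD mulrNz; ring.
  rewrite dirichlet_root ?mulr0 // ?subr_eq0.
    by apply: contraNneq qp => -[/val_inj ->].
  have := ltn_ord p; have := ltn_ord q; clear -KM; lia.
under eq_bigr do rewrite H.
rewrite sumr_const card_ord.
have -> : (M%:R)%:C *+ K = (M%:R *+ K)%:C :> R[i] by rewrite [RHS]rmorphMn.
by rewrite -realcM -[M%:R *+ K]mulr_natr mulrCA mulVf ?mulr1 // gt_eqF.
Qed.

(** Discrete convolution of the Fejer kernel with the indicator function of an arc of A grid
    points. *)
Definition window K M b A : R := (\sum_(p < A) fejer K (b - p%:R / M%:R)) / M%:R.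

Lemma window_split K M b A : (0 < K)%N -> (K <= M)%N -> (A <= M)%N ->
  window K M b A + (\sum_(A <= p < M) fejer K (b - p%:R / M%:R)) / M%:R = 1.
Proof.
move=> K0 KM AM; have MR : 0 < M%:R :> R by rewrite ltr0n (leq_trans K0).
rewrite /window -mulrDl -(big_mkord xpredT (fun p => fejer K (b - p%:R / M%:R))).
rewrite -big_cat_nat //= big_mkord fejer_mean // divff // gt_eqF //.
Qed.

Lemma window_ge0 K M b A : 0 <= window K M b A.
Proof. by rewrite divr_ge0 // sumr_ge0 // => p _; exact: fejer_ge0. Qed.

Lemma window_le1 K M b A : (0 < K)%N -> (K <= M)%N -> (A <= M)%N -> window K M b A <= 1.
Proof.
move=> K0 KM AM; rewrite -(window_split b K0 KM AM) lerDl divr_ge0 // sumr_ge0 // => p _.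
exact: fejer_ge0.
Qed.

Lemma window_out K M b A v : (0 < K)%N -> (A <= M)%N -> 0 < v ->
  (forall p, (p < A)%N -> v <= nu (b - p%:R / M%:R)) ->
  window K M b A <= 4 / (K%:R * v ^+ 2).
Proof.
move=> K0 AM v0 Hv; have [M0|M0] := posnP M.
  by rewrite /window M0 invr0 mulr0; pos.
rewrite ler_pdivrMr ?ltr0n //; set c := _ / _.
apply: (@le_trans _ _ (\sum_(p < A) c)).
  by apply: ler_sum => p _; apply: fejer_far => //; exact: Hv.
rewrite sumr_const card_ord -[leLHS]mulr_natr; apply: ler_wpM2l; last by rewrite ler_nat.
by rewrite /c; pos.
Qed.

Lemma window_in K M b A v : (0 < K)%N -> (K <= M)%N -> (A <= M)%N -> 0 < v ->
  (forall p, (A <= p < M)%N -> v <= nu (b - p%:R / M%:R)) ->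
  1 - 4 / (K%:R * v ^+ 2) <= window K M b A.
Proof.
move=> K0 KM AM v0 Hv; rewrite lerBlDr -[leLHS](window_split b K0 KM AM) lerD2l.
have M0 := leq_trans K0 KM; rewrite ler_pdivrMr ?ltr0n //; set c := _ / _.
apply: (@le_trans _ _ (\sum_(A <= p < M) c)).
  by rewrite big_nat [leRHS]big_nat; apply: ler_sum => p hp; apply: fejer_far => //; exact: Hv.
rewrite sumr_const_nat -[leLHS]mulr_natr; apply: ler_wpM2l; last by rewrite ler_nat leq_subr.
by rewrite /c; pos.
Qed.

Lemma nu_gap b t : t <= b <= 1 - t -> 0 <= t -> 2 * t <= nu b.
Proof.
move=> /andP[h1 h2] t0; have [b2|b2] := leP b 2^-1.
  have h : `|b| <= 2^-1 by rewrite ger0_norm //; lra.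
  by have := nu_ge h; rewrite ger0_norm; lra.
have h : `|b + (- 1)%:~R| <= 2^-1 by rewrite ler_norml; apply/andP; split; lra.
by have := nu_ge h; rewrite nuDint ler0_norm; lra.
Qed.

(** Modulus of the k-th Fourier coefficient of [smooth_window], apart from the Fejer factor 1 - k /
    K, and cut off at K. *)
Definition kernel_coef M D A K k : R :=
  if (k < K)%N then normc (dirichlet D (k%:R / M%:R)) * normc (dirichlet A (k%:R / M%:R))
    / (D%:R * M%:R) else 0.

Lemma kernel_coef_ge0 M D A K k : 0 <= kernel_coef M D A K k.
Proof.
rewrite /kernel_coef; case: ifP => // _.
by rewrite divr_ge0 ?mulr_ge0 ?normc_ge0.
Qed.

Lemma kernel_coef0 M D A K : (A <= M)%N -> kernel_coef M D A K 0 <= 1.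
Proof.
rewrite /kernel_coef => AM; case: ifP => // _.
have [D0|D0] := posnP D; first by rewrite D0 (mul0r M%:R) invr0 mulr0.
have [M0|M0] := posnP M; first by rewrite M0 (mulr0 D%:R) invr0 mulr0.
rewrite ler_pdivrMr ?mulr_gt0 ?ltr0n // mul1r; apply: ler_pM; rewrite ?normc_ge0 ?dirichlet_le //.
by apply: le_trans (dirichlet_le _ _) _; rewrite ler_nat.
Qed.

(** A Dirichlet sum of length n at k / M is at most n and, since k / M <= 1/2, at most M / k. Using
    the first bound once gives 1 / k; using the second twice gives the quadratic decay. *)
Lemma kernel_coef_bound M D A K k : (0 < D)%N -> (2 * K <= M)%N -> (0 < k)%N ->
  kernel_coef M D A K k <= k%:R^-1 /\
  kernel_coef M D A K k <= M%:R / (D%:R * k%:R ^+ 2).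
Proof.
move=> D0 KM k0; rewrite /kernel_coef.
have kR : 0 < k%:R :> R by rewrite ltr0n.
have DR : 0 < D%:R :> R by rewrite ltr0n.
case: ifP => [kK|_]; last by split; pos.
have MR : 0 < M%:R :> R by rewrite ltr0n; apply: leq_trans KM; rewrite muln_gt0 /= (leq_trans k0) // ltnW.
have kM : 2 * k%:R <= M%:R :> R.
  by rewrite -natrM ler_nat; apply: leq_trans KM; rewrite leq_mul2l ltnW ?orbT.
have h : `|k%:R / M%:R : R| <= 2^-1.
  by rewrite ger0_norm; [rewrite ler_pdivrMr //; lra | pos].
have nuk : 2 * (k%:R / M%:R) <= nu (k%:R / M%:R : R).
  by have := nu_ge h; rewrite ger0_norm //; pos.
have Hd n : normc (dirichlet n (k%:R / M%:R)) <= M%:R / k%:R.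
  rewrite ler_pdivlMr //.
  have := dirichlet_nu n (k%:R / M%:R); have := normc_ge0 (dirichlet n (k%:R / M%:R)).
  move: (normc _) nuk => X nuk X0 H; have := ler_wpM2r X0 nuk => H2.
  have : 2 * (k%:R * X / M%:R) <= 2.
    by apply: le_trans H; apply: le_trans H2; rewrite le_eqVlt; apply/orP; left; apply/eqP; ring.
  move=> H3; have : k%:R * X / M%:R <= 1 by lra.
  by rewrite ler_pdivrMr // mul1r mulrC.
split; rewrite ler_pdivrMr ?mulr_gt0 //.
  have -> : k%:R^-1 * (D%:R * M%:R) = D%:R * (M%:R / k%:R) :> R by ring.
  by apply: ler_pM; rewrite ?normc_ge0 ?dirichlet_le.
have -> : M%:R / (D%:R * k%:R ^+ 2) * (D%:R * M%:R) = M%:R / k%:R * (M%:R / k%:R) :> R.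
  by field; rewrite !gt_eqF.
by apply: ler_pM; rewrite ?normc_ge0.
Qed.

(** Averaging D consecutive windows is a second convolution with an arc: the profile becomes a
    trapezium and the coefficients acquire a second Dirichlet factor. *)
Definition smooth_window K M D A c b : R :=
  (\sum_(q < D) window K M (b + (c%:R - q%:R) / M%:R) A) / D%:R.

Definition kernel_phase M D A c (p q : nat) : R[i] :=
  ((D%:R * M%:R)^-1)%:C * ex ((p%:R - q%:R) * (c%:R / M%:R)) *
  (dirichlet D (- ((p%:R - q%:R) / M%:R)) * dirichlet A (- ((p%:R - q%:R) / M%:R))).

Lemma kernel_phase_norm M D A c K p q : (p < K)%N -> (q < K)%N ->
  normc (kernel_phase M D A c p q) = kernel_coef M D A K ((p - q) + (q - p)).
Proof.
move=> pK qK; rewrite /kernel_phase /kernel_coef.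
have -> : (p - q + (q - p) < K)%N by clear -pK qK; lia.
rewrite !normcM normc_ex mulr1 normcR ger0_norm ?invr_ge0 ?mulr_ge0 //.
rewrite mulrC !dirichletN.
have [h|h] := leqP q p.
  have -> : (p - q + (q - p) = p - q)%N by clear -h; lia.
  by rewrite natrB.
have -> : (p - q + (q - p) = q - p)%N by clear -h; lia.
by rewrite natrB ?(ltnW h) // -[q%:R - _]opprB mulNr !dirichletN.
Qed.

Lemma smooth_windowE K M D A c b :
  (smooth_window K M D A c b)%:C = (K%:R^-1)%:C * \sum_(p < K) \sum_(q < K)
    kernel_phase M D A c p q * ex ((p%:R - q%:R) * b).
Proof.
rewrite /smooth_window mulrC realcM realc_sum.
under eq_bigr => i _.
  rewrite /window mulrC realcM realc_sum.
  under eq_bigr => j _ do rewrite fejerE.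
  rewrite -mulr_sumr exchange_big /=.
  under eq_bigr => p _ do rewrite exchange_big /=.
  over.
rewrite -!mulr_sumr exchange_big /=.
under eq_bigr => p _ do rewrite exchange_big /=.
set S := \sum_(p < K) _.
transitivity ((K%:R^-1)%:C * (((D%:R * M%:R)^-1)%:C * S)).
  by rewrite invfM [(_^-1 * _^-1)%:C]realcM; ring.
congr (_ * _); rewrite /S mulr_sumr; apply: eq_bigr => p _.
rewrite mulr_sumr; apply: eq_bigr => q _.
rewrite /kernel_phase -!mulrA; congr (_ * _).
rewrite [RHS]mulrCA /dirichlet mulr_suml; apply: eq_bigr => i _.
rewrite mulr_suml !mulr_sumr; apply: eq_bigr => j _; rewrite -!exD; congr ex.
by rewrite /=; ring.
Qed.

Lemma smooth_window_bounds K M D A c b : (0 < K)%N -> (K <= M)%N -> (A <= M)%N -> (0 < D)%N ->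
  0 <= smooth_window K M D A c b <= 1.
Proof.
move=> K0 KM AM D0; have DR : 0 < D%:R :> R by rewrite ltr0n.
apply/andP; split.
  by rewrite divr_ge0 // sumr_ge0 // => q _; exact: window_ge0.
rewrite ler_pdivrMr // mul1r -[leRHS]mulr1n -[D in leRHS]card_ord -sumr_const.
by apply: ler_sum => q _; exact: window_le1.
Qed.

(** The grid step [sg] is at most del / 8 and the averaging width D [sg] is between del / 8 and del
    / 4, so that the slope of the trapezium fits between s and s + del with a margin of del / 4 = t
    L. At that distance the Fejer kernel contributes at most eta. The period 4 U keeps the interval
    [0, U] away from wrapping around. *)
Lemma kernel_exists (del s U eta : R) : 0 < del -> 0 <= s -> s + del <= U -> 0 < eta ->
  exists K M D A c, let L := 4 * U in
  [/\ (0 < K)%N, kernel_coef M D A K 0 <= 1, freq_weight (8 / del) L (kernel_coef M D A K) &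
   forall u, 0 <= u <= U ->
     [/\ 0 <= smooth_window K M D A c (u / L) <= 1,
        u <= s -> 1 - eta <= smooth_window K M D A c (u / L) &
        s + del <= u -> smooth_window K M D A c (u / L) <= eta]].
Proof.
move=> del0 s0 sU eta0; pose L := 4 * U.
have U0 : 0 < U by lra.
have L0 : 0 < L by rewrite /L; lra.
have X0 : 0 < 4 * L / del by pos.
have Y0 : 0 < 16 * L ^+ 2 / (del ^+ 2 * eta) by pos.
(* The first summand makes the grid fine enough, the second the Fejer tail 4 / (K (2 t)^2) at most
   eta. *)
pose K := (Num.truncn (4 * L / del + 16 * L ^+ 2 / (del ^+ 2 * eta))).+1.
have Kb : 4 * L / del + 16 * L ^+ 2 / (del ^+ 2 * eta) < K%:R by exact: truncnS_gt.
have KR : 0 < K%:R :> R by rewrite ltr0n.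
pose M := (2 * K)%N; have MR : 0 < M%:R :> R by rewrite ltr0n.
pose sg := L / M%:R; have sg0 : 0 < sg by rewrite /sg; pos.
have sgM : sg * M%:R = L by rewrite /sg divfK // gt_eqF.
have sgd : sg <= del / 8.
  rewrite /sg ler_pdivrMr // /M natrM.
  have : 4 * L / del <= K%:R by lra.
  by rewrite ler_pdivrMr //; lra.
pose D := (Num.truncn (del / (8 * sg))).+1.
have D1 : del / 8 < D%:R * sg.
  have : del / (8 * sg) < D%:R by exact: truncnS_gt.
  by rewrite ltr_pdivrMr; [lra|pos].
have D2 : D%:R * sg <= del / 4.
  have : D%:R <= del / (8 * sg) + 1 by rewrite /D -natr1 lerD2r truncn_le; pos.
  have e : del / (8 * sg) * sg = del / 8 by field; rewrite gt_eqF.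
  move/(ler_wpM2r (ltW sg0)); rewrite mulrDl e mul1r; lra.
pose B := (Num.truncn ((s + del / 4) / sg)).+1.
have sd0 : 0 <= s + del / 4 by lra.
have B1 : s + del / 4 < B%:R * sg.
  have : (s + del / 4) / sg < B%:R by exact: truncnS_gt.
  by rewrite ltr_pdivrMr.
have B2 : B%:R * sg <= s + del / 4 + del / 8.
  have : B%:R <= (s + del / 4) / sg + 1.
    by rewrite /B -natr1 lerD2r truncn_le divr_ge0 // ltW.
  move/(ler_wpM2r (ltW sg0)); rewrite mulrDl divfK ?gt_eqF // mul1r; lra.
(* The arc starts 3 D steps before 0: after averaging over D of them, points u near 0 still keep a
   distance of at least 2 D steps from its lower end. B steps reach just beyond s + del / 4. *)
pose c := (3 * D)%N; pose A := (c + B)%N.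
have AM : (A <= M)%N.
  rewrite -(ler_nat R) -(ler_pM2r sg0) [M%:R * _]mulrC sgM /A /c natrD natrM /L; lra.
have KM : (K <= M)%N by rewrite /M leq_pmull.
have D0 : (0 < D)%N by [].
have K0 : (0 < K)%N by [].
pose t := del / (4 * L); have t0 : 0 < t by rewrite /t; pos.
have tL : t * L = del / 4 by rewrite /t; field; rewrite gt_eqF.
have eb : 4 / (K%:R * (2 * t) ^+ 2) <= eta.
  rewrite ler_pdivrMr; last by pos.
  have -> : eta * (K%:R * (2 * t) ^+ 2) = 4 * (K%:R * (del ^+ 2 * eta) / (16 * L ^+ 2)).
    by rewrite /t; field; rewrite gt_eqF.
  rewrite -[leLHS]mulr1 ler_pM2l // ler_pdivlMr; last by pos.
  by rewrite mul1r -ler_pdivrMr; [lra|pos].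
exists K, M, D, A, c; split => //.
- exact: kernel_coef0.
- move=> k k0; have [h1 h2] := kernel_coef_bound A D0 (leqnn M) k0; split => //.
    exact: kernel_coef_ge0.
  apply: le_trans h2 _; have kR : 0 < k%:R :> R by rewrite ltr0n.
  have DR : 0 < D%:R :> R by rewrite ltr0n.
  have -> : M%:R / (D%:R * k%:R ^+ 2) = M%:R / D%:R / k%:R ^+ 2 :> R by rewrite invfM mulrA.
  apply: ler_wpM2r; first by pos.
  rewrite ler_pdivrMr // -/L -sgM.
  have -> : 8 / del * (sg * M%:R) * D%:R = M%:R * (8 / del * (D%:R * sg)) by ring.
  rewrite ler_peMr ?(ltW MR) // mulrAC ler_pdivlMr //; lra.
move=> u /andP[u0 uU]; rewrite -/L; split; first exact: smooth_window_bounds.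
  move=> us; rewrite ler_pdivlMr ?ltr0n // [leLHS]mulr_natr -[D in _ *+ D]card_ord -sumr_const.
  apply: ler_sum => q _; apply: (@le_trans _ _ (1 - 4 / (K%:R * (2 * t) ^+ 2))); first by lra.
  apply: window_in => //; first by pos.
  move=> p /andP[Ap pM]; rewrite -nuN; apply: nu_gap; last exact: ltW.
  have E : - (u / L + (c%:R - q%:R) / M%:R - p%:R / M%:R) =
    ((q%:R + p%:R - c%:R) * sg - u) / L by rewrite /sg; field; rewrite !gt_eqF.
  have pA : A%:R * sg <= p%:R * sg by rewrite ler_pM2r // ler_nat.
  have pM' : p%:R * sg <= L by rewrite -sgM mulrC ler_pM2l // ler_nat ltnW.
  have qD : q%:R * sg <= D%:R * sg by rewrite ler_pM2r // ler_nat ltnW.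
  have q0 : 0 <= q%:R * sg by pos.
  move: pA; rewrite E /A natrD /c natrM => pA; apply/andP; split.
    by rewrite ler_pdivlMr // tL; lra.
  by rewrite ler_pdivrMr // [(1 - t) * L]mulrBl mul1r tL; lra.
move=> us; rewrite ler_pdivrMr ?ltr0n //.
have -> : eta * D%:R = \sum_(q < D) eta by rewrite sumr_const card_ord mulr_natr.
apply: ler_sum => q _; apply: (@le_trans _ _ (4 / (K%:R * (2 * t) ^+ 2))) => //.
apply: window_out => //; first by pos.
move=> p pA; apply: nu_gap; last exact: ltW.
have E : u / L + (c%:R - q%:R) / M%:R - p%:R / M%:R =
  (u + (c%:R - q%:R - p%:R) * sg) / L by rewrite /sg; field; rewrite !gt_eqF.
have pA' : p%:R * sg <= A%:R * sg by rewrite ler_pM2r // ler_nat ltnW.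
have qD : q%:R * sg <= D%:R * sg by rewrite ler_pM2r // ler_nat ltnW.
have q0 : 0 <= q%:R * sg by pos.
have p0 : 0 <= p%:R * sg by pos.
move: pA'; rewrite E /A natrD /c natrM => pA'; apply/andP; split.
  by rewrite ler_pdivlMr // tL; lra.
by rewrite ler_pdivrMr // [(1 - t) * L]mulrBl mul1r tL /L; lra.
Qed.

End Fejer.


(** * Positive definite forms *)

Section PositiveDefinite.
Context {R : realType} {d : nat}.
Variable (Q : 'M[R]_d).
Hypothesis (Qpos : posdefmx Q).
Implicit Types (x y : 'cV[R]_d).

Let Qs : Q^T = Q. Proof. by case: Qpos. Qed.

Lemma qform_ge0 x : 0 <= qform Q x.
Proof.
have [->|x0] := eqVneq x 0; first by rewrite /qform mulmx0 mxE.
by case: Qpos => _ /(_ x x0) /ltW.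
Qed.

Lemma posdef_unitmx : Q \in unitmx.
Proof.
rewrite -row_free_unit -kermx_eq0; apply/rowV0P => v /sub_kermxP vQ.
apply: trmx_inj; rewrite trmx0; apply/eqP/negPn/negP => v0.
have Qv : Q *m v^T = 0 by rewrite -{1}Qs -trmx_mul vQ trmx0.
by case: Qpos => _ /(_ _ v0); rewrite /qform Qv trmx0 mul0mx mxE ltxx.
Qed.

Lemma bil_cauchy x y : bil Q x y ^+ 2 <= qform Q x * qform Q y.
Proof.
have [y0|y0] := eqVneq y 0.
  have B0 : bil Q x 0 = 0 by rewrite /bil big1 // => j _; rewrite [X in _ * X]mxE mulr0.
  by rewrite y0 B0 [qform Q 0]/qform mulmx0 [X in _ * X]mxE mulr0 expr0n.
have q0 : 0 < qform Q y by case: Qpos => _; apply.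
have := qform_ge0 (x + (- (bil Q x y / qform Q y)) *: y).
have qZ k : qform Q (k *: y) = k * (k * qform Q y).
  by rewrite qform_bil bilZr (bilC (k *: y) y Qs) bilZr -qform_bil.
rewrite qformD // bilZr qZ.
move: (bil Q x y) (qform Q x) => b X.
have -> : X + 2 * (- (b / qform Q y) * b) +
  - (b / qform Q y) * (- (b / qform Q y) * qform Q y) = (X * qform Q y - b ^+ 2) / qform Q y.
  by field; rewrite gt_eqF.
by rewrite pmulr_lge0 ?invr_gt0 // subr_ge0.
Qed.

(** The coordinate x_i is the Q-inner product of x with Q^(-1) e_i, to which the Cauchy inequality
    applies. *)
Lemma coord_bound : exists2 c : R, 1 <= c & forall x i, x i 0 ^+ 2 <= c * qform Q x.
Proof.
pose e i : 'cV[R]_d := invmx Q *m delta_mx i 0.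
exists (1 + \sum_i qform Q (e i)) => [|x i].
  by rewrite lerDl sumr_ge0 // => i _; exact: qform_ge0.
have -> : x i 0 = bil Q (e i) x.
  rewrite /bil /e mulKVmx ?posdef_unitmx // (bigD1 i) //= big1 ?addr0.
    by rewrite mxE !eqxx mul1r.
  by move=> j ji; rewrite mxE (negbTE ji) mul0r.
apply: le_trans (bil_cauchy _ _) _; apply: ler_wpM2r; first exact: qform_ge0.
rewrite (bigD1 i) //= addrCA lerDl addr_ge0 // sumr_ge0 // => j _; exact: qform_ge0.
Qed.

End PositiveDefinite.

(** * Lattice points in two translates of an ellipsoid *)

Section Comparison.
Context {R : realType} {d : nat}.
Variable (Q : 'M[R]_d).
Implicit Types (x a b : 'cV[R]_d) (N L s t u : R).

Lemma qform_upper : exists2 C : R, 1 <= C & forall N x, (forall i, `|x i 0| <= 5 * N) ->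
  qform Q x <= C * N ^+ 2.
Proof.
exists (1 + \sum_j \sum_k 25 * `|Q j k|) => [|N x Hx].
  by rewrite lerDl; do 2 apply: sumr_ge0 => ? _; rewrite mulr_ge0.
rewrite qform_bil /bil mulrDl mul1r; apply: (@le_trans _ _ ((\sum_j \sum_k 25 * `|Q j k|) * N ^+ 2)).
  rewrite mulr_suml; apply: ler_sum => j _; rewrite mxE mulr_suml mulr_suml; apply: ler_sum => k _.
  apply: le_trans (ler_norm _) _; rewrite !normrM.
  have -> : 25 * `|Q j k| * N ^+ 2 = `|Q j k| * (5 * N) * (5 * N) by ring.
  apply: ler_pM => //.
  exact: ler_wpM2l.
by rewrite lerDr sqr_ge0.
Qed.

Definition ecount N a s : R :=
  \sum_(n <- box (ctr a) (brad N)) (qform Q (emb n - a) <= s)%R%:R.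

Definition wsum N a (G : R -> R) : R :=
  \sum_(n <- box (ctr a) (brad N)) wt N (emb n - a) * G (qform Q (emb n - a)).

Lemma conjc_theta N a t : conjc (theta Q N a t) = theta Q N a (- t).
Proof.
rewrite /theta raddf_sum; apply: eq_bigr => n _.
by rewrite /theta_term; apply: etrans (conjcM _ _) _; rewrite mulNr exN conjc_real.
Qed.

(** In truncated subtraction (p - q) + (q - p) is |p - q|; for fixed p the distance 0 occurs once
    and every other one at most twice. *)
Lemma sum_distance (T : nat -> R) K : (0 < K)%N -> (forall k, 0 <= T k) ->
  (\sum_(p < K) \sum_(q < K) T ((p - q) + (q - p))%N) / K%:R <= T 0%N + 2 * \sum_(1 <= k < K) T k.
Proof.
move=> K0 T0; rewrite ler_pdivrMr ?ltr0n //.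
set X := _ + _; have -> : X * K%:R = \sum_(p < K) X by rewrite sumr_const card_ord mulr_natr.
apply: ler_sum => p _; have pK := ltn_ord p.
rewrite -(big_mkord xpredT (fun q => T (p - q + (q - p))%N)).
rewrite (big_cat_nat (leq0n p) (ltnW pK)) /= (big_ltn pK).
rewrite subnn addn0 addrCA lerD2l mulr_natl mulr2n; apply: lerD.
  rewrite big_nat_rev /= add0n; apply: (@le_trans _ _ (\sum_(1 <= k < p.+1) T k)).
    rewrite big_add1 /= le_eqVlt; apply/orP; left; apply/eqP; rewrite big_nat [RHS]big_nat.
    by apply: eq_bigr => k /andP[_ kp]; congr T; clear -kp; lia.
  rewrite [leRHS](@big_cat_nat _ _ _ p.+1) //= lerDl sumr_ge0 //.
apply: (@le_trans _ _ (\sum_(1 <= k < K - p) T k)).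
  rewrite -{1}[p.+1]add0n big_addn subnS [leRHS]big_add1.
  rewrite le_eqVlt; apply/orP; left; apply/eqP; apply: eq_bigr => k _.
  by congr T; clear; lia.
have [h|h] := leqP 1 (K - p); last by rewrite big_geq ?sumr_ge0 // ltnW.
by rewrite [leRHS](@big_cat_nat _ _ _ (K - p)) ?leq_subr //= lerDl sumr_ge0.
Qed.

Lemma wsum_window N a K M D A c L :
  (wsum N a (fun u => smooth_window K M D A c (u / L)))%:C =
  (K%:R^-1)%:C * \sum_(p < K) \sum_(q < K)
    kernel_phase M D A c p q * theta Q N a ((p%:R - q%:R) / L).
Proof.
rewrite /wsum realc_sum.
under eq_bigr => n _.
  rewrite realcM smooth_windowE mulrCA mulr_sumr.
  under eq_bigr => p _ do rewrite mulr_sumr.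
  over.
rewrite -mulr_sumr exchange_big /=; congr (_ * _); apply: eq_bigr => p _.
rewrite exchange_big /=; apply: eq_bigr => q _; rewrite /theta mulr_sumr.
apply: eq_bigr => n _; rewrite /theta_term mulrCA; congr (_ * (_ * ex _)).
by ring.
Qed.

Lemma wsum_diff N a b K M D A c L : (0 < K)%N -> kernel_coef M D A K 0 <= 1 :> R ->
  `|wsum N a (fun u => smooth_window K M D A c (u / L)) -
    wsum N b (fun u => smooth_window K M D A c (u / L))| <=
  2 * (normc (theta Q N b 0 - theta Q N a 0) + \sum_(1 <= k < K) kernel_coef M D A K k *
    normc (theta Q N b (k%:R / L) - theta Q N a (k%:R / L))).
Proof.
move=> K0 g0.
pose T k := kernel_coef M D A K k *
  normc (theta Q N b (k%:R / L) - theta Q N a (k%:R / L)).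
have T0 k : 0 <= T k by rewrite mulr_ge0 ?normc_ge0 ?kernel_coef_ge0.
have EB (x y : R) : (x - y)%:C = x%:C - y%:C by rewrite rmorphB.
rewrite -normcR EB !wsum_window -mulrBr normcM normcR ger0_norm ?invr_ge0 //.
apply: (@le_trans _ _ ((\sum_(p < K) \sum_(q < K) T ((p - q) + (q - p))%N) / K%:R)).
  rewrite mulrC; apply: ler_wpM2r; first by rewrite invr_ge0.
  rewrite -sumrB; apply: le_trans (normc_sum _ _ _) _; apply: ler_sum => p _.
  rewrite -sumrB; apply: le_trans (normc_sum _ _ _) _; apply: ler_sum => q _.
  rewrite -mulrBr normcM (@kernel_phase_norm _ _ _ _ _ K) // /T normcB.
  rewrite le_eqVlt; apply/orP; left; apply/eqP; congr (_ * _).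
  have [h|h] := leqP q p.
    have -> : (p - q + (q - p) = p - q)%N by clear -h; lia.
    by rewrite natrB.
  have -> : (p - q + (q - p) = q - p)%N by clear -h; lia.
  rewrite natrB ?(ltnW h) // -[p%:R - _]opprB mulNr -!conjc_theta -rmorphB.
  exact: normc_conj.
apply: le_trans (sum_distance K0 T0) _.
have h : T 0%N <= normc (theta Q N b 0 - theta Q N a 0).
  by rewrite /T mul0r -[leRHS]mul1r; apply: ler_wpM2r => //; exact: normc_ge0.
have -> : \sum_(1 <= k < K) kernel_coef M D A K k *
  normc (theta Q N b (k%:R / L) - theta Q N a (k%:R / L)) = \sum_(1 <= k < K) T k by [].
have := normc_ge0 (theta Q N b 0 - theta Q N a 0); move: h.
by move: (T 0%N) (normc _) (\sum_(1 <= k < K) T k) => x y z; lra.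
Qed.

Hypotheses (d9 : (9 <= d)%N) (Qpos : posdefmx Q).

Lemma om_supp5 N x : 0 < N -> wt N x != 0 -> forall i, `|x i 0| <= 5 * N.
Proof.
move=> N0 w0 i; have [//|h] := leP `|x i 0| (5 * N); move: w0.
rewrite /wt (bigD1 i) //= om_out ?mul0r ?eqxx // normrM normfV (gtr0_norm N0).
by rewrite ler_pdivlMr // ltW.
Qed.

Lemma wt_ge0 N x : 0 <= wt N x.
Proof. by apply: prodr_ge0 => i _; exact: om_ge0. Qed.

Lemma wt_in N x c s : (forall (y : 'cV[R]_d) i, y i 0 ^+ 2 <= c * qform Q y) -> 0 < N -> 0 <= c ->
  c * s <= N ^+ 2 -> qform Q x <= s -> wt N x = 1.
Proof.
move=> Hc N0 c0 cs xs; apply: big1 => i _; apply: om_in.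
rewrite normrM normfV (gtr0_norm N0) ler_pdivrMr // mul1r.
rewrite -(@ler_pXn2r _ 2) ?nnegrE ?(ltW N0) // real_normK ?num_real //.
by apply: le_trans (Hc _ _) (le_trans _ cs); exact: ler_wpM2l.
Qed.

(** Up to eta, the smoothed indicator G lies between the indicator functions of [0, s] and
    [0, s + del]; its weighted sums at a and b are compared by [wsum_diff] and [freq_diff]. The
    choice of N makes the weight equal to 1 on both ellipsoids. *)
Lemma ecount_compare (c del eps : R) : irrational_mx Q ->
  1 <= c -> (forall (y : 'cV[R]_d) i, y i 0 ^+ 2 <= c * qform Q y) -> 0 < del -> 0 < eps ->
  exists s0 : R, forall s a b N, s0 <= s -> 0 <= s -> N = Num.sqrt (c * (s + del)) ->
    ecount N a s <= ecount N b (s + del) + eps * N ^+ d / N ^+ 2.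
Proof.
move=> irr c1 Hc del0 eps0; have Qs : Q^T = Q by case: Qpos.
have Qu := posdef_unitmx Qpos.
have [CQ CQ1 HCQ] := qform_upper.
have [Cup Cup0 Hup] := theta_upper Q.
have cL0 : 0 < 4 * CQ by lra.
have be0 : 0 <= 8 / del by rewrite divr_ge0 // ltW.
have e40 : 0 < eps / 4 by rewrite divr_gt0.
have [N0 HN] := freq_diff d9 Qs Qu irr cL0 be0 e40.
exists (1 + `|N0| ^+ 2) => s a b N s0s s0 NE.
have P0 : 0 <= `|N0| ^+ 2 by rewrite exprn_ge0.
have sd0 : 0 < s + del by lra.
have NN : N ^+ 2 = c * (s + del) by rewrite NE sqr_sqrtr // mulr_ge0 //; lra.
have sN : s + del <= N ^+ 2 by rewrite NN ler_peMl // ltW.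
have N1 : 1 <= N.
  by rewrite -(@ler_pXn2r _ 2) ?nnegrE ?NE ?sqrtr_ge0 // expr1n -NE; lra.
have NN0 : N0 <= N.
  apply: le_trans (ler_norm _) _.
  by rewrite -(@ler_pXn2r _ 2) ?nnegrE ?NE ?sqrtr_ge0 // -NE; lra.
have Np : 0 < N by lra.
pose U := CQ * N ^+ 2.
have sU : s + del <= U by apply: le_trans sN _; rewrite ler_peMl // exprn_ge0 // ltW.
(* The total weight is at most (Cup N)^d, so the pointwise error eta adds up to at most (eps / 4)
   N^(d - 2). *)
pose eta := eps / (4 * Cup ^+ d * N ^+ 2).
have eta0 : 0 < eta by rewrite /eta; pos.
have [K [M [D [A [cc]]]]] := kernel_exists del0 s0 sU eta0.
set L := 4 * U => /= -[K0 g0 gw HG].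
have LE : L = 4 * CQ * N ^+ 2 by rewrite /L /U mulrA.
pose G u := smooth_window K M D A cc (u / L).
have Wd : `|wsum N a G - wsum N b G| <= eps / 2 * N ^+ d / N ^+ 2.
  apply: le_trans (wsum_diff N a b cc L K0 g0) _.
  apply: le_trans (ler_wpM2l (ler0n R 2) (HN N L a b _ K NN0 N1 LE gw)) _.
  by rewrite le_eqVlt; apply/orP; left; apply/eqP; field; rewrite gt_eqF.
have wU n x : wt N (emb n - x) != 0 -> 0 <= qform Q (emb n - x) <= U.
  move=> w0; rewrite qform_ge0 //=; apply: HCQ; exact: om_supp5.
have W1 x : \sum_(n <- box (ctr x) (brad N)) wt N (emb n - x) <= (Cup * N) ^+ d.
  have := Hup N x 0 N1; have -> : theta Q N x 0 =
     (\sum_(n <- box (ctr x) (brad N)) wt N (emb n - x))%:C.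
    by rewrite realc_sum; apply: eq_bigr => n _; rewrite /theta_term mul0r ex0 mulr1.
  by rewrite normcR ger0_norm // sumr_ge0 // => n _; exact: wt_ge0.
have eW x : eta * \sum_(n <- box (ctr x) (brad N)) wt N (emb n - x) <= eps / 4 * N ^+ d / N ^+ 2.
  apply: le_trans (ler_wpM2l (ltW eta0) (W1 x)) _.
  rewrite le_eqVlt; apply/orP; left; apply/eqP; rewrite /eta exprMn; field.
  by rewrite !gt_eqF ?exprn_gt0.
have cd : c * (s + del) <= N ^+ 2 by rewrite NN.
have c0 : 0 <= c := le_trans ler01 c1.
have cs : c * s <= N ^+ 2 by apply: le_trans cd; rewrite ler_wpM2l // lerDl ltW.
have lo : ecount N a s <= wsum N a G +
    eta * \sum_(n <- box (ctr a) (brad N)) wt N (emb n - a).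
  rewrite mulr_sumr -big_split /=; apply: ler_sum => n _.
  have [w0|w0] := eqVneq (wt N (emb n - a)) 0.
    rewrite w0 mul0r mulr0 addr0; case: (leP (qform Q (emb n - a)) s) => // h.
    by have := wt_in Hc Np c0 cs h; rewrite w0 => /eqP; rewrite eq_sym oner_eq0.
  have [/andP[g1 g2] g3 _] := HG _ (wU _ _ w0).
  case: (leP (qform Q (emb n - a)) s) => h; last first.
    by rewrite mulr0n /G; apply: addr_ge0; apply: mulr_ge0; rewrite ?wt_ge0 ?(ltW eta0).
  rewrite (wt_in Hc Np c0 cs h) mul1r mulr1 mulr1n; have := g3 h; rewrite /G; lra.
have hi : wsum N b G <= ecount N b (s + del) +
    eta * \sum_(n <- box (ctr b) (brad N)) wt N (emb n - b).
  rewrite mulr_sumr -big_split /=; apply: ler_sum => n _.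
  have [w0|w0] := eqVneq (wt N (emb n - b)) 0.
    by rewrite w0 mul0r mulr0 addr0.
  have [/andP[g1 g2] _ g3] := HG _ (wU _ _ w0).
  case: (leP (qform Q (emb n - b)) (s + del)) => h.
    rewrite (wt_in Hc Np c0 cd h) mul1r mulr1 mulr1n; rewrite /G; lra.
  by rewrite mulr0n add0r mulrC; apply: ler_wpM2r; [exact: wt_ge0|exact: g3 (ltW h)].
have := eW a; have := eW b; move: Wd; rewrite ler_norml => /andP[_ Wd].
have E (x : R) : x * N ^+ d / N ^+ 2 = x * (N ^+ d / N ^+ 2) by rewrite mulrA.
move: Wd; rewrite !E; move: (N ^+ d / N ^+ 2) lo hi => Y; lra.
Qed.

End Comparison.


(** * Lebesgue measure and averages over translates *)

Section SigmaFinite.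
Context {R : realType} d (X : measurableType d) (M : {measure set X -> \bar R}).
Hypothesis sf : sigma_finite [set: X] M.

Let M' : set X -> \bar R := M.

HB.instance Definition _ := Measure.on M'.
HB.instance Definition _ := @Measure_isSigmaFinite.Build d X R M' sf.

Lemma sigma_finite_packed :
  exists mu : {sigma_finite_measure set X -> \bar R}, (mu : set X -> \bar R) = M.
Proof. by exists M'. Qed.

End SigmaFinite.

Section TupleMeasure.
Context {R : realType}.
Local Notation T n := (n.-tuple (measurableTypeR R)).
Implicit Types (n : nat) (a b c v x : R).
Local Open Scope ereal_scope.

Lemma lebesgue_tupleS n (A : set (T n.+1)) :
  lebesgue_tuple A =
  \int[lebesgue_measure]_x lebesgue_tuple [set t : T n | A [tuple of x :: t]].
Proof.
rewrite /= /pushforward /product_measure1; apply: eq_integral => x _ /=; congr lebesgue_tuple.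
by apply/seteqP; split => t /=; rewrite /xsection /= inE.
Qed.

Lemma lebesgue_tuple0 n : lebesgue_tuple (set0 : set (T n)) = 0.
Proof.
elim: n => [|n IH]; first by rewrite /= dirac0.
rewrite lebesgue_tupleS; apply: integral0_eq => x _; rewrite -[RHS]IH; congr lebesgue_tuple.
Qed.

(** Half-open, so that the integer translates of the unit cube tile the space exactly. *)
Definition cube n a b : set (T n) := [set t | forall i, (a <= tnth t i < b)%R].

Lemma cube_cons n a b x (t : T n) :
  cube a b [tuple of x :: t] <-> (a <= x < b)%R /\ cube a b t.
Proof.
split=> [H|[hx ht] i].
  split; first by have := H ord0; rewrite (tnth_nth x).
  by move=> i; have := H (lift ord0 i); rewrite tnthS.
by have [j ->|->] := unliftP ord0 i; rewrite ?tnthS ?tnth0.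
Qed.

Lemma lebesgue_cube n a b : (a <= b)%R ->
  lebesgue_tuple (@cube n a b) = ((b - a) ^+ n)%:E.
Proof.
move=> ab; have ba0 : (0 <= b - a)%R by rewrite subr_ge0.
elim: n => [|n IH]; first by rewrite /= diracE mem_set // => -[].
rewrite lebesgue_tupleS.
transitivity (\int[@lebesgue_measure R]_x (((b - a) ^+ n)%:E * (\1_(`[a, b[%classic : set R) x)%:E)); last first.
  rewrite ge0_integralZl_EFin ?exprn_ge0 //; last first.
    by apply/measurable_EFinP; exact: measurable_indic.
  rewrite integral_indic // setIT exprSr EFinM; congr (_ * _).
  transitivity (lebesgue_measure [set` `[a, b[]). by [].
  rewrite lebesgue_measure_itv /= lte_fin; case: ltP => [//|h].
  have -> : b = a by apply/eqP; rewrite eq_le h.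
  by rewrite subrr.
apply: eq_integral => x _; rewrite indicE; case: (boolP (x \in `[a, b[)) => hx.
  rewrite mem_set // mule1 -IH; congr lebesgue_tuple; rewrite in_itv /= in hx.
  by apply/seteqP; split => t /=; rewrite cube_cons => // -[].
rewrite memNset /=; last by move=> h; rewrite /= h in hx.
rewrite mule0 -[RHS](@lebesgue_tuple0 n); congr lebesgue_tuple.
apply/seteqP; split => t //=; rewrite cube_cons => -[hx' _].
by rewrite in_itv /= hx' in hx.
Qed.

Definition affine n c (v : 'I_n -> R) (t : T n) : T n :=
  [tuple (c * tnth t i + v i)%R | i < n].

Lemma affine_cons n c (v : 'I_n.+1 -> R) x (t : T n) :
  affine c v [tuple of x :: t] =
  [tuple of (c * x + v ord0)%R :: affine c (fun i => v (lift ord0 i)) t].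
Proof.
apply: eq_from_tnth => i; rewrite tnth_mktuple.
by have [j ->|->] := unliftP ord0 i; rewrite ?tnthS ?tnth0 ?tnth_mktuple.
Qed.

Lemma measurable_affine n c (v : 'I_n -> R) : measurable_fun [set: T n] (affine c v).
Proof.
apply/measurable_fun_tnthP => i.
rewrite (_ : _ \o _ = fun t : T n => (c * tnth t i + v i)%R).
  apply: measurable_funD => //; apply: measurable_funM => //; exact: measurable_tnth.
by apply/funext => t /=; rewrite tnth_mktuple.
Qed.

Lemma measurable_cube n a b : measurable (@cube n a b).
Proof.
rewrite (_ : cube a b = \bigcap_(i in [set: 'I_n]) ((fun t : T n => tnth t i) @^-1` `[a, b[%classic)).
  apply: fin_bigcap_measurable; first exact: finite_finset.
  by move=> i _; rewrite -[X in measurable X]setTI; exact: measurable_tnth.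
apply/seteqP; split => t /= H i => [_|]; first by rewrite /= in_itv; exact: H.
by have := H i I; rewrite /= in_itv.
Qed.

(** [lebesgue_tuple] is by definition a mere set function. Sigma-finiteness is carried along the
    induction because the next product requires it of its second factor; growing cubes witness
    it. *)
Lemma lebesgue_tuple_measure n :
  exists mu : {sigma_finite_measure set (T n) -> \bar R}, @lebesgue_tuple R n = mu.
Proof.
elim: n => [|n [mu E]]; first by exists (\d_([tuple] : T 0)).
pose f (p : measurableTypeR R * T n) : T n.+1 := [tuple of p.1 :: p.2].
have mf : measurable_fun setT f by exact: measurable_cons.
have E1 : @lebesgue_tuple R n.+1 = pushforward (@lebesgue_measure R \x mu) f.
  by rewrite /= E.
(* Named explicitly: unification cannot find the argument [mf] of the instance. *)
pose M : {measure set (T n.+1) -> \bar R} :=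
  measure_function_pushforward__canonical__measure_function_Measure
   (@lebesgue_measure R \x mu) mf.
have sf : sigma_finite [set: T n.+1] M.
  exists (fun k => cube (- k%:R) k%:R).
    apply/seteqP; split => // t _ /=.
    exists (Num.truncn (\sum_i `|tnth t i|)%R).+1 => // i.
    have h : (`|tnth t i| < (Num.truncn (\sum_i `|tnth t i|)%R).+1%:R)%R.
      apply: le_lt_trans (truncnS_gt _); rewrite (bigD1 i) //= lerDl sumr_ge0 //.
    by move: h; rewrite ltr_norml => /andP[/ltW -> ->].
  move=> k; split; first exact: measurable_cube.
  have -> : M (cube (- k%:R) k%:R) = lebesgue_tuple (@cube n.+1 (- k%:R) k%:R) by rewrite E1.
  by rewrite lebesgue_cube ?ltry //; apply: (@le_trans _ _ 0%R); rewrite ?oppr_le0.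
have [mu' E'] := sigma_finite_packed sf.
by exists mu'; rewrite E' E1.
Qed.

Lemma measurable_section n (A : set (T n.+1)) x : measurable A ->
  measurable [set t : T n | A [tuple of x :: t]].
Proof.
move=> mA; have mc : measurable_fun setT (fun t : T n => [tuple of x :: t] : T n.+1).
  by apply: measurable_cons => //; exact: measurable_cst.
by rewrite -[X in measurable X]setTI; exact: mc.
Qed.

Lemma measurable_section_measure n (A : set (T n.+1)) : measurable A ->
  measurable_fun setT (fun x : measurableTypeR R =>
    lebesgue_tuple [set t : T n | A [tuple of x :: t]]).
Proof.
move=> mA; have [mu E] := lebesgue_tuple_measure n.
pose f (p : measurableTypeR R * T n) : T n.+1 := [tuple of p.1 :: p.2].
have mf : measurable_fun setT f by exact: measurable_cons.
have mB : measurable (f @^-1` A) by rewrite -[X in measurable X]setTI; exact: mf.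
rewrite E; have := @measurable_fun_xsection _ _ _ _ _ mu _ mB.
congr measurable_fun; apply/funext => x /=; congr (mu _).
by apply/seteqP; split => t; rewrite /xsection /= inE.
Qed.

Lemma lebesgue_tuple_ge0 n (A : set (T n)) : 0 <= lebesgue_tuple A.
Proof. by have [mu ->] := lebesgue_tuple_measure n; exact: measure_ge0. Qed.

(** By uniqueness of Lebesgue measure it suffices to compare it with c times its image measure on
    intervals ]a, b]. *)
Lemma integral_affine (g : measurableTypeR R -> \bar R) c v : (0 < c)%R ->
  measurable_fun setT g -> (forall x, 0 <= g x) ->
  \int[lebesgue_measure]_x g x = c%:E * \int[lebesgue_measure]_x g (c * x + v)%R.
Proof.
move=> c0 mg g0; pose phi (x : measurableTypeR R) : measurableTypeR R := (c * x + v)%R.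
have mphi : measurable_fun setT phi.
  by apply: measurable_funD => //; exact: measurable_funM.
pose P : {measure set (measurableTypeR R) -> \bar R} :=
  measure_function_pushforward__canonical__measure_function_Measure
    (@lebesgue_measure R) mphi.
pose k : {nonneg R} := NngNum (ltW c0).
have H A : measurable A -> lebesgue_measure A = mscale k P A.
  apply: lebesgue_measure_unique => _ [[a b]] _ <-.
  transitivity (c%:E * lebesgue_measure (phi @^-1` `]a, b]%classic)); last by [].
  rewrite /=.
  have -> : phi @^-1` `]a, b]%classic = `](a - v) / c, (b - v) / c]%classic%R.
    apply/seteqP; split => x /=; rewrite !in_itv /= ltr_pdivrMr // ler_pdivlMr //
      [(x * c)%R]mulrC ltrBlDr lerBrDr //.
  rewrite !lebesgue_measure_itv /= !lte_fin ltr_pM2r ?invr_gt0 // ltrD2r.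
  case: ifP => _; last by rewrite mule0.
  by rewrite -!EFinD -EFinM; congr EFin; field; rewrite gt_eqF.
rewrite (@eq_measure_integral _ _ _ _ (mscale k P)); last by move=> A mA _; exact: H.
rewrite ge0_integral_mscale //; congr (_ * _).
by rewrite /P /= ge0_integral_pushforward.
Qed.

Lemma lebesgue_affine n (A : set (T n)) c (v : 'I_n -> R) : (0 < c)%R -> measurable A ->
  lebesgue_tuple A = (c ^+ n)%:E * lebesgue_tuple (affine c v @^-1` A).
Proof.
move=> c0; elim: n A v => [|n IH] A v mA.
  rewrite expr0 mul1e; congr lebesgue_tuple.
  have e (t : T 0) : affine c v t = t by apply: eq_from_tnth => -[].
  by apply/seteqP; split => t /=; rewrite e.
rewrite !lebesgue_tupleS (integral_affine (v ord0) c0) //; last 2 first.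
- exact: measurable_section_measure.
- by move=> x; exact: lebesgue_tuple_ge0.
rewrite exprS EFinM -muleA; congr (_ * _).
rewrite -ge0_integralZl_EFin ?exprn_ge0 ?(ltW c0) //.
- apply: eq_integral => x _; rewrite (IH _ (fun i => v (lift ord0 i))).
    congr (_ * _); congr lebesgue_tuple; apply/seteqP.
    by split => t /=; rewrite affine_cons.
  exact: measurable_section.
- by move=> x _; exact: lebesgue_tuple_ge0.
- apply: (@measurable_section_measure _ (affine c v @^-1` A)).
  by rewrite -[X in measurable X]setTI; exact: measurable_affine.
Qed.

Definition intv n (m : 'cV[int]_n) : 'I_n -> R := fun i => (m i 0)%:~R.

(** The measure of A is the integral over t in the unit cube of the number of points of A in t +
    Z^n; pointwise bounds on that number thus pass to the measure. *)
Lemma lattice_average n (A : set (T n)) (r : seq 'cV[int]_n) (K1 K2 : R) :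
  measurable A -> uniq r -> (0 <= K1)%R ->
  (forall t, A t -> \col_j Num.floor (tnth t j) \in r) ->
  (forall t, cube 0 1 t -> (K1 <= \sum_(m <- r) \1_A (affine 1 (intv m) t) <= K2)%R) ->
  K1%:E <= lebesgue_tuple A <= K2%:E.
Proof.
move=> mA ur K10 Ar HK; have [mu E] := lebesgue_tuple_measure n.
pose C := @cube n 0 1; have mC : measurable C by exact: measurable_cube.
have muC : mu C = 1 by rewrite -E lebesgue_cube ?subr0 ?expr1n.
pose D (m : 'cV[int]_n) := affine 1 (fun i => - intv m i)%R @^-1` C.
have mpre (v : 'I_n -> R) (B : set (T n)) : measurable B -> measurable (affine 1 v @^-1` B).
  by move=> mB; rewrite -[X in measurable X]setTI; exact: measurable_affine.
have mD m : measurable (A `&` D m) by apply: measurableI => //; exact: mpre.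
have mI m B : measurable_fun B (fun t : T n => \1_A (affine 1 (intv m) t) : R).
  by have := mpre (intv m) A mA; exact: measurable_indic.
have DE m t : D m t <-> \col_j Num.floor (tnth t j) = m.
  split=> [H|<- i].
    apply/colP => j; rewrite mxE; have := H j; rewrite tnth_mktuple mul1r /intv.
    rewrite subr_ge0 ltrBlDl -[X in (_ < _ + X)%R]/(1%:~R) -intrD => h.
    exact: floor_def.
  rewrite tnth_mktuple mul1r /intv mxE subr_ge0 ltrBlDl -[X in (_ < _ + X)%R]/(1%:~R) -intrD.
  exact: floor_itv.
(* The sets [D m] are the unit cubes with integer corner m; those indexed by r suffice to partition
   A. *)
have split1 t : (\1_A t : R)%:E = \sum_(m <- r) (\1_(A `&` D m) t)%:E.
  rewrite sumEFin; congr EFin; rewrite !indicE; have [At|At] := pselect (A t); last first.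
    rewrite memNset // big1_seq // => m _; rewrite indicE memNset // => -[]//.
  rewrite mem_set // (bigD1_seq _ (Ar t At) ur) /= indicE mem_set; last first.
    by split => //; apply/DE.
  rewrite big1_seq ?addr0 // => m /andP[nm _]; rewrite indicE memNset // => -[_ /DE e].
  by rewrite e eqxx in nm.
have muA : lebesgue_tuple A = \int[mu]_(t in C) (\sum_(m <- r) \1_A (affine 1 (intv m) t))%:E.
  rewrite E -[in LHS](setIT A) -integral_indic //.
  under eq_integral do rewrite split1.
  rewrite ge0_integral_sum //; last first.
    by move=> m; apply/measurable_EFinP; exact: measurable_indic.
  under [RHS]eq_integral do rewrite -sumEFin.
  rewrite ge0_integral_sum //; last first.
    by move=> m; apply/measurable_EFinP; exact: mI.
  apply: eq_bigr => m _; transitivity (lebesgue_tuple (A `&` D m)).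
    by rewrite E integral_indic // setIT.
  rewrite (lebesgue_affine (intv m) ltr01) // expr1n mul1e E.
  transitivity (\int[mu]_(t in C) (\1_(affine 1 (intv m) @^-1` A) t)%:E).
    rewrite integral_indic //; last exact: mpre.
    congr (mu _); apply/seteqP.
    have aff t : affine 1 (fun i => - intv m i)%R (affine 1 (intv m) t) = t.
      by apply: eq_from_tnth => i; rewrite !tnth_mktuple !mul1r addrK.
    by split => t [h1 h2]; split => //; move: h2; rewrite /D /= aff.
  by apply: eq_integral => t _; rewrite !indicE.
have mS : measurable_fun C (fun t => (\sum_(m <- r) \1_A (affine 1 (intv m) t) : R)%:E).
  have H : measurable_fun C (fun t : T n => (\sum_(m <- r) (\1_A (affine 1 (intv m) t) : R)%:E)%E).
    by apply: emeasurable_sum => m; apply/measurable_EFinP; exact: mI.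
  by move: H; congr measurable_fun; apply/funext => t; rewrite sumEFin.
have cstE (k : R) : \int[mu]_(t in C) (cst k%:E t) = k%:E.
  by rewrite integral_cst // muC mule1.
rewrite muA -(cstE K1) -(cstE K2); apply/andP.
split; apply: ge0_le_integral => // t Ct; rewrite lee_fin.
all: by [|case/andP: (HK t Ct)|apply: sumr_ge0].
Qed.

End TupleMeasure.


(** * Volume as an average of lattice point counts *)

Section Volume.
Context {R : realType} {d : nat}.
Variable (Q : 'M[R]_d) (c : R).
Hypotheses (Qpos : posdefmx Q) (c1 : 1 <= c).
Hypothesis Hc : forall (y : 'cV[R]_d) i, y i 0 ^+ 2 <= c * qform Q y.
Implicit Types (x a : 'cV[R]_d) (s N : R) (n m : 'cV[int]_d).

Let Qs : Q^T = Q. Proof. by case: Qpos. Qed.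

Let c0 : 0 <= c. Proof. exact: le_trans ler01 c1. Qed.

Lemma emb_inj : injective (@emb R d).
Proof. by move=> n m /colP h; apply/colP => i; have := h i; rewrite !mxE => /intr_inj. Qed.

Lemma volZ_sum (B : set 'cV[R]_d) (r : seq 'cV[int]_d) : uniq r ->
  (forall n, B (emb n) -> n \in r) -> volZ B = \sum_(n <- r) \1_B (emb n).
Proof.
move=> ur Br; pose l : seq 'cV[R]_d := [seq emb n | n <- r & emb n \in B].
have E : B `&` @int_lattice R d = [set` l].
  apply/seteqP; split => x /=; last first.
    move=> /mapP[n]; rewrite mem_filter => /andP[/set_mem Bn _] ->; split => //.
    by move=> i; rewrite embE intr_int.
  move=> [Bx Zx]; apply/mapP.
  have xE : x = emb (\col_i Num.floor (x i 0)).
    by apply/colP => i; rewrite embE mxE floorK //; exact: Zx.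
  exists (\col_i Num.floor (x i 0)) => //; rewrite mem_filter -xE.
  by apply/andP; split; [exact/mem_set|apply: Br; rewrite -xE].
rewrite /volZ /counting E asboolT /=; last exact: finite_seq.
have -> : fset_set [set` l] = finmap.seq_fset tt l.
  apply/finmap.fsetP => x; rewrite in_fset_set; last exact: finite_seq.
  by rewrite finmap.seq_fsetE; apply/idP/idP => [/set_mem|h] //; exact/mem_set.
rewrite finmap.size_seq_fset undup_id; last first.
  by rewrite map_inj_uniq ?filter_uniq //; exact: emb_inj.
rewrite size_map size_filter -sum1_count natr_sum big_mkcond /=.
by apply: eq_bigr => n _; rewrite indicE; case: ifP.
Qed.

Definition lcount a s : R := volZ [set x + a | x in ellipsoid Q s].

Lemma lcount_sum a s (r : seq 'cV[int]_d) : uniq r ->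
  (forall n, qform Q (emb n - a) <= s -> n \in r) ->
  lcount a s = \sum_(n <- r) (qform Q (emb n - a) <= s)%R%:R.
Proof.
move=> ur Hr.
have BE n : [set x + a | x in ellipsoid Q s] (emb n) <-> qform Q (emb n - a) <= s.
  split=> [[x /= xs <-]|h]; first by rewrite addrK.
  by exists (emb n - a) => //; rewrite subrK.
rewrite /lcount (volZ_sum ur); last by move=> n /BE; exact: Hr.
apply: eq_bigr => n _; rewrite indicE; congr (_ %:R); congr nat_of_bool.
by apply/idP/idP => [/set_mem/BE //|h]; apply/mem_set/BE.
Qed.

Lemma lcountE a s N : 0 < N -> c * s <= N ^+ 2 -> lcount a s = ecount Q N a s.
Proof.
move=> N0 cs; rewrite (lcount_sum (box_uniq (ctr a) (brad N))) // => n h.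
apply: wt_supp => //; rewrite (wt_in Hc N0 c0 cs h) oner_eq0 //.
Qed.

Definition ctuple s : set (d.-tuple (measurableTypeR R)) :=
  [set t | ellipsoid Q s (\col_i tnth t i)].

Lemma measurable_ctuple s : measurable (ctuple s).
Proof.
pose f (t : d.-tuple (measurableTypeR R)) : R := qform Q (\col_i tnth t i).
have fE t : f t = \sum_j (\sum_k Q j k * tnth t k) * tnth t j.
  rewrite /f qform_bil /bil; apply: eq_bigr => j _; rewrite !mxE; congr (_ * _).
  by apply: eq_bigr => k _; rewrite mxE.
have mf : measurable_fun setT f.
  rewrite (_ : f = fun t => \sum_j (\sum_k Q j k * tnth t k) * tnth t j); last first.
    by apply/funext => t; exact: fE.
  apply: measurable_sum => j; apply: measurable_funM; last exact: measurable_tnth.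
  apply: measurable_sum => k; apply: measurable_funM => //; exact: measurable_tnth.
rewrite (_ : ctuple s = f @^-1` `]-oo, s]%classic).
  by rewrite -[X in measurable X]setTI; exact: mf.
by apply/seteqP; split => t /=; rewrite in_itv.
Qed.

Lemma coord_le x s i : qform Q x <= s -> `|x i 0| <= 1 + `|c * s|.
Proof.
move=> h; have h2 : x i 0 ^+ 2 <= `|c * s|.
  apply: le_trans (Hc x i) _; apply: le_trans (ler_norm _); exact: ler_wpM2l.
rewrite -real_normK ?num_real // in h2; have := normr_ge0 (x i 0).
move: h2; move: `|x i 0| => y h2 y0; nra.
Qed.

Lemma vol_average s (K1 K2 : R) : 0 <= K1 -> (forall a, K1 <= lcount a s <= K2) ->
  K1 <= vol (ellipsoid Q s) <= K2.
Proof.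
move=> K10 HK; pose X := 1 + `|c * s|; have X1 : 1 <= X by rewrite lerDl.
pose B := (Num.truncn X).+2.
have XB : X + 1 <= B%:R by rewrite /B -natr1 lerD2r ltW // truncnS_gt.
have big n : (forall i, `|(n i 0)%:~R : R| <= B%:R) -> n \in box 0 B.
  move=> h; apply/mem_box => i; rewrite mxE subr0 -(ler_int R) intr_norm; exact: h.
have := @lattice_average R d (ctuple s) (box 0 B) K1 K2 (measurable_ctuple s) (box_uniq _ _) K10.
have HA t : ctuple s t -> \col_j Num.floor (tnth t j) \in box 0 B.
  move=> At; apply: big => i; rewrite mxE.
  have := coord_le i At; rewrite mxE -/X; have /andP[f1 f2] := floor_itv (tnth t i).
  rewrite !ler_norml => /andP[h1 h2]; rewrite intrD in f2.
  by apply/andP; split; rewrite -?[1%:~R]/(1 : R) in f2; lra.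
move=> /(_ HA) H.
(* The points m + t in E_s correspond to the lattice points m in E_s - t. *)
have HS (t : d.-tuple (measurableTypeR R)) : cube 0 1 t ->
    \sum_(m <- box 0 B) \1_(ctuple s) (affine 1 (intv m) t) = lcount (- \col_i tnth t i) s.
  move=> Ct; have aE m : (\col_i tnth (affine 1 (intv m) t) i : 'cV[R]_d) = emb m - (- \col_i tnth t i).
    by apply/colP => i; rewrite !mxE tnth_mktuple mul1r opprK addrC.
  rewrite (@lcount_sum _ _ (box 0 B)) ?box_uniq //.
    apply: eq_bigr => m _; rewrite indicE; congr (_ %:R); congr nat_of_bool.
    apply/idP/idP => [/set_mem|h]; first by rewrite /ctuple /= /ellipsoid /= aE.
    by apply/mem_set; rewrite /ctuple /= /ellipsoid /= aE.
  move=> m h; apply: big => i; have := coord_le i h; rewrite -/X opprK !mxE.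
  have := Ct i; rewrite !ler_norml => /andP[t0 t1] /andP[h1 h2].
  by apply/andP; split; lra.
have {H} : (K1%:E <= lebesgue_tuple (ctuple s) <= K2%:E)%E.
  by apply: H => t Ct; rewrite HS.
rewrite /vol -/(ctuple s); case: (lebesgue_tuple _) => [r| |] //=.
by rewrite leye_eq andbF.
Qed.

Lemma vol_scale s : 0 < s -> vol (ellipsoid Q s) = Num.sqrt s ^+ d * vol (ellipsoid Q 1).
Proof.
move=> s0; have r0 : 0 < Num.sqrt s by rewrite sqrtr_gt0.
rewrite /vol -!/(ctuple _) (lebesgue_affine (fun=> 0) r0 (measurable_ctuple s)).
have -> : affine (Num.sqrt s) (fun=> 0) @^-1` ctuple s = ctuple 1; last first.
  have r1 : (0 < (Num.sqrt s ^+ d)%:E)%E by rewrite lte_fin exprn_gt0.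
  (* In the infinite cases both sides are 0, as [fine] sends infinite values there. *)
  case: (lebesgue_tuple (ctuple 1)) => [r| |] //=.
    by rewrite gt0_muley // mulr0.
  by rewrite gt0_muleNy // mulr0.
have qE t : qform Q (\col_i tnth (affine (Num.sqrt s) (fun=> 0) t) i) = s * qform Q (\col_i tnth t i).
  have -> : \col_i tnth (affine (Num.sqrt s) (fun=> 0) t) i = Num.sqrt s *: \col_i tnth t i.
    by apply/colP => i; rewrite !mxE tnth_mktuple addr0.
  rewrite !qform_bil bilZr (bilC _ (\col_i tnth t i) Qs) bilZr mulrA -expr2 sqr_sqrtr //.
  exact: ltW.
by apply/seteqP; split => t; rewrite /ctuple /ellipsoid /= qE -ler_pdivlMl // mulVf ?gt_eqF.
Qed.

Lemma lcount_ge0 a s : 0 <= lcount a s.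
Proof. by rewrite /lcount /volZ /counting; case: ifP => _ //=. Qed.

Lemma lcount_upper s : exists K : R, forall a, lcount a s <= K.
Proof.
pose N := 1 + `|c * s|; have N1 : 1 <= N by rewrite lerDl.
exists ((2 * brad N).+1 ^ d)%:R => a; rewrite (@lcountE a s N) //; last 2 first.
- lra.
- apply: le_trans (ler_norm _) _; rewrite /N; move: `|c * s| (normr_ge0 (c * s)) => y y0; nra.
rewrite /ecount -(size_box (ctr a)) -sumr_size; apply: ler_sum => n _.
by rewrite -[leRHS]/(1%:R) ler_nat; case: (_ <= _).
Qed.

(** For C large, E_C + a always contains the lattice point [ctr a], so that every count is at least
    1 and so is the volume; scaling carries this to radius 1. *)
Lemma vol1_gt0 : 0 < vol (ellipsoid Q 1).
Proof.
have [C C1 HC] := qform_upper Q.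
have [K HK] := lcount_upper C.
have H a : 1 <= lcount a C <= K.
  rewrite HK andbT; pose N := 1 + `|c * C|; have N1 : 1 <= N by rewrite lerDl.
  rewrite (@lcountE a C N) //; last 2 first.
  - lra.
  - apply: le_trans (ler_norm _) _; rewrite /N; move: `|c * C| (normr_ge0 (c * C)) => y y0; nra.
  have q0 : qform Q (emb (ctr a) - a) <= C.
    rewrite -[C]mulr1 -(expr1n R 2); apply: HC => i; rewrite !mxE mulr1.
    have /andP[f1 f2] := floor_itv (a i 0); rewrite intrD in f2.
    by rewrite ler_norml; apply/andP; split; rewrite -?[1%:~R]/(1 : R) in f2; lra.
  have cb : ctr a \in box (ctr a) (brad N) by apply/mem_box => i; rewrite subrr normr0.
  rewrite /ecount (bigD1_seq (ctr a)) ?box_uniq //= q0 lerDl.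
  by apply: sumr_ge0 => n _.
have /andP[h _] := vol_average ler01 H.
have C0 : 0 < C by lra.
move: h; rewrite (vol_scale C0) => h.
have S0 : 0 < Num.sqrt C ^+ d by rewrite exprn_gt0 // sqrtr_gt0.
by rewrite -(pmulr_rgt0 _ S0); lra.
Qed.

End Volume.


(** * The discrepancy *)

Section Discrepancy.
Context {R : realType} {d : nat}.
Variable (Q : 'M[R]_d).
Hypotheses (d9 : (9 <= d)%N) (Qpos : posdefmx Q).
Implicit Types (x a b : 'cV[R]_d) (s eps del : R).

Lemma DeltaE s a : Delta s Q a =
  `|lcount Q a s - vol (ellipsoid Q s)| / vol (ellipsoid Q s).
Proof.
rewrite /Delta normrM normfV; congr (_ / _).
by apply/ger0_norm; rewrite /vol fine_ge0 // lebesgue_tuple_ge0.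
Qed.

Lemma pow1D_le (n : nat) (x : R) : 0 <= x <= 1 -> (1 + x) ^+ n <= 1 + 3 ^+ n * x.
Proof.
move=> /andP[x0 x1]; elim: n => [|n IH]; first by rewrite !expr0; lra.
rewrite !exprS; apply: le_trans (ler_wpM2l _ IH) _; first by lra.
have : 1 <= 3 ^+ n :> R by rewrite exprn_ege1 // ler1n.
move: (3 ^+ n) => y y1.
have h1 : x <= y * x by rewrite ler_peMl.
have h2 : y * x * x <= y * x by rewrite ler_piMr // mulr_ge0 //; lra.
have -> : (1 + x) * (1 + y * x) = 1 + y * x + x + y * x * x by ring.
by rewrite -mulrA; lra.
Qed.

Lemma sqrt_shift s del n : 0 < s -> 0 <= del <= s ->
  Num.sqrt (s + del) ^+ n <= Num.sqrt s ^+ n * (1 + 3 ^+ n * (del / s)).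
Proof.
move=> s0 /andP[d0 ds].
have x0 : 0 <= del / s by rewrite divr_ge0 // ltW.
have x1 : del / s <= 1 by rewrite ler_pdivrMr // mul1r.
have x01 : 0 <= del / s <= 1 by rewrite x0.
apply: le_trans (ler_wpM2l _ (pow1D_le n x01)); last by rewrite exprn_ge0 // sqrtr_ge0.
rewrite -exprMn; apply: lerXn2r; rewrite ?nnegrE ?mulr_ge0 ?sqrtr_ge0 //; first by lra.
rewrite -(@ler_pXn2r _ 2) ?nnegrE ?mulr_ge0 ?sqrtr_ge0 //; last by lra.
rewrite exprMn !sqr_sqrtr ?(ltW s0) //; last by lra.
have -> : s + del = s * (1 + del / s) by field; rewrite gt_eqF.
apply: ler_wpM2l; first exact: ltW.
by rewrite expr2 ler_peMl; lra.
Qed.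

(** The comparison holds for all translates b of the other ellipsoid, so averaging over b replaces
    its count by its volume. Applied to the pairs (s, s + del) and (s - del, s), it encloses the
    count between the volumes of E_(s - del) and E_(s + del) up to [Er]. *)
Lemma irrational_Delta eps : irrational_mx Q -> 0 < eps ->
  exists s0 : R, forall s a, s0 <= s -> 0 < s -> Delta s Q a <= eps / s.
Proof.
move=> irr eps0; have [c c1 Hc] := coord_bound Qpos.
pose V := vol (ellipsoid Q 1); have V0 : 0 < V := vol1_gt0 Qpos c1 Hc.
pose T : R := 3 ^+ d; have T1 : 1 <= T by rewrite exprn_ege1 // ler1n.
(* By [sqrt_shift], enlarging s by del raises the volume by a proportion of at most 3^d del / s =
   eps / (8 s). *)
pose del := eps / (8 * T); have del0 : 0 < del by rewrite divr_gt0 // mulr_gt0 //; lra.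
have delT : del * T = eps / 8 by rewrite /del; field; rewrite gt_eqF //; lra.
pose H := Num.sqrt (2 * c) ^+ d; have H0 : 0 < H by rewrite exprn_gt0 // sqrtr_gt0; lra.
(* Since N^2 <= 2 c s, one has N^d <= H sqrt(s)^d, which makes the comparison error a small multiple
   of eps vol(E_s) / s. *)
pose e1 := eps * V / (8 * H).
have e10 : 0 < e1 by rewrite divr_gt0 // mulr_gt0.
have [s0 Hs0] := ecount_compare d9 Qpos irr c1 Hc del0 e10.
exists (`|s0| + 3 * del + 1) => s a s0s s_gt0.
have S0 : s0 <= s - del by have := ler_norm s0; lra.
have Sd : 3 * del <= s by have := normr_ge0 s0; lra.
have sd0 : 0 < s - del by lra.
pose S r := Num.sqrt r ^+ d : R.
have Sp r : 0 < r -> 0 < S r by move=> r0; rewrite exprn_gt0 // sqrtr_gt0.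
have VE r : 0 < r -> vol (ellipsoid Q r) = S r * V by move=> r0; exact: (vol_scale Qpos).
have cmp r x y : s - del <= r -> r <= s ->
    lcount Q x r <= lcount Q y (r + del) + eps / 4 * (S s * V) / s.
  move=> r1 r2; pose N := Num.sqrt (c * (r + del)).
  have r0 : 0 < r by lra.
  have N2 : N ^+ 2 = c * (r + del) by rewrite sqr_sqrtr // mulr_ge0 //; lra.
  have N0 : 0 < N by rewrite sqrtr_gt0 mulr_gt0 //; lra.
  rewrite (lcountE c1 Hc x N0) ?N2; last by apply: ler_wpM2l; lra.
  rewrite (lcountE c1 Hc y N0) ?N2 //.
  apply: le_trans (Hs0 r x y N _ _ erefl) _; [lra|lra|rewrite lerD2l].
  have NH : N ^+ d <= H * S s.
    rewrite /H /S -exprMn -sqrtrM; last by lra.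
    apply: lerXn2r; rewrite ?nnegrE ?sqrtr_ge0 // ler_wsqrtr //.
    by rewrite -mulrA [2 * (c * s)]mulrCA; apply: ler_wpM2l; lra.
  have Ns : s <= N ^+ 2 by rewrite N2; apply: le_trans (_ : r + del <= _); [lra|rewrite ler_peMl; lra].
  rewrite ler_pdivrMr ?exprn_gt0 //.
  apply: (@le_trans _ _ (e1 * (H * S s))); first by apply: ler_wpM2l => //; exact: ltW.
  have -> : e1 * (H * S s) = eps / 8 * (S s * V) / s * s.
    by rewrite /e1; field; rewrite !gt_eqF.
  have P0 : 0 <= (S s * V) / s by rewrite divr_ge0 ?mulr_ge0 ?(ltW (Sp s s_gt0)) ?(ltW V0) ?(ltW s_gt0).
  have -> : eps / 8 * (S s * V) / s * s = eps * (S s * V / s) * (s / 8) by ring.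
  have -> : eps / 4 * (S s * V) / s * N ^+ 2 = eps * (S s * V / s) * (N ^+ 2 / 4) by ring.
  by apply: ler_wpM2l; [rewrite mulr_ge0 // ltW|lra].
set Er := eps / 4 * (S s * V) / s in cmp.
have Er0 : 0 <= Er by rewrite divr_ge0 ?mulr_ge0 ?(ltW (Sp s s_gt0)) ?(ltW V0) ?(ltW s_gt0) //; lra.
have [K HK] := lcount_upper c1 Hc (s + del).
have up : lcount Q a s - Er <= vol (ellipsoid Q (s + del)).
  (* [vol_average] wants a nonnegative lower bound, hence the maximum with 0. *)
  have hv b : Num.max 0 (lcount Q a s - Er) <= lcount Q b (s + del) <= K.
    rewrite HK andbT ge_max lcount_ge0 /= lerBlDr; apply: cmp; lra.
  have m0 : 0 <= Num.max 0 (lcount Q a s - Er) by rewrite le_max lexx.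
  have /andP[h _] := vol_average c1 Hc m0 hv.
  by apply: le_trans h; rewrite le_max lexx orbT.
have lo : vol (ellipsoid Q (s - del)) <= lcount Q a s + Er.
  have hv b : 0 <= lcount Q b (s - del) <= lcount Q a s + Er.
    rewrite lcount_ge0 /=; have := cmp (s - del) b a (lexx _); rewrite subrK; apply; lra.
  by have /andP[_] := vol_average c1 Hc (lexx 0) hv.
have Vs : 0 < S s * V by rewrite mulr_gt0 ?Sp.
rewrite DeltaE (VE s) // ler_pdivrMr //.
have V1 : vol (ellipsoid Q (s + del)) <= S s * V + eps / 8 * (S s * V) / s.
  rewrite VE; last by lra.
  have := @sqrt_shift s del d s_gt0; rewrite -!/(S _) -/T => h.
  have {}h := ler_wpM2r (ltW V0) (h (ltac:(apply/andP; split; lra))).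
  apply: le_trans h _; rewrite le_eqVlt; apply/orP; left; apply/eqP; rewrite -delT; field.
  by rewrite gt_eqF.
have V2 : S s * V - eps / 4 * (S s * V) / s <= vol (ellipsoid Q (s - del)).
  rewrite VE //; have := @sqrt_shift (s - del) del d sd0; rewrite subrK -!/(S _) -/T => h.
  have {}h := ler_wpM2r (ltW V0) (h (ltac:(apply/andP; split; lra))).
  have mono : S (s - del) * V <= S s * V.
    apply: ler_wpM2r; first exact: ltW.
    by apply: lerXn2r; rewrite ?nnegrE ?sqrtr_ge0 // ler_wsqrtr //; lra.
  have k : S (s - del) * (1 + T * (del / (s - del))) * V <=
      S (s - del) * V + S s * V * (eps / 4 / s).
    have -> : S (s - del) * (1 + T * (del / (s - del))) * V =
      S (s - del) * V + S (s - del) * V * (del * T / (s - del)) by ring.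
    rewrite lerD2l; apply: ler_pM => //; first by rewrite mulr_ge0 ?(ltW V0) ?(ltW (Sp _ sd0)).
      have T0 : 0 < T by lra.
      by apply: divr_ge0; [apply: mulr_ge0; exact: ltW|exact: ltW].
    rewrite delT ler_pdivrMr // mulrAC ler_pdivlMr //.
    have : del <= s / 2 by lra.
    by move: eps0 s_gt0; clear; nra.
  have e : eps / 4 * (S s * V) / s = S s * V * (eps / 4 / s) by ring.
  by rewrite e; have := le_trans h k; lra.
have e8 : eps / 8 * (S s * V) / s = Er / 2 by rewrite /Er; field; rewrite gt_eqF.
have eE : eps / s * (S s * V) = 4 * Er by rewrite /Er; field; rewrite gt_eqF.
rewrite -/Er in V2; rewrite e8 in V1; rewrite eE ler_norml; apply/andP; split; lra.
Qed.

Lemma rational_Delta : rational_mx Q -> exists2 eps : R, 0 < eps &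
  forall s0 : R, exists2 s, s0 <= s & 0 < s /\ eps / s < Delta s Q 0.
Proof.
move=> [M M0 MQ]; have [c c1 Hc] := coord_bound Qpos.
pose V := vol (ellipsoid Q 1); have V0 : 0 < V := vol1_gt0 Qpos c1 Hc.
pose mu := `|M|; have mu0 : 0 < mu by rewrite normr_gt0.
have qint (n : 'cV[int]_d) : mu * qform Q (emb n - 0) \is a Num.int.
  have h : M * qform Q (emb n) \is a Num.int.
    rewrite qform_bil /bil mulr_sumr; apply: rpred_sum => j _; rewrite mxE mulr_suml mulr_sumr.
    apply: rpred_sum => k _; rewrite !mulrA.
    by apply: rpredM; [apply: rpredM; [exact: MQ|]|]; rewrite embE intr_int.
  rewrite subr0 /mu; case: (ger0P M) => _ //; by rewrite mulNr rpredN.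
(* With t this constant, s2 - s1 = 8 t, so the volume grows by a proportion of at least 8 t / s2 of
   v2, while two discrepancies at most t / s would confine the growth to 2 t / s2. *)
exists (16 * mu)^-1; first by rewrite invr_gt0 mulr_gt0.
move=> s0; pose k := (Num.truncn (mu * `|s0|)).+1.
(* The values of the form on Z^d are multiples of 1 / mu, and none lies in ]s1, s2]. Stopping
   halfway stays clear of the next value. *)
pose s1 := k%:R / mu; pose s2 := (k%:R + 2^-1) / mu.
have kR : 1 <= k%:R :> R by rewrite ler1n.
have s10 : 0 < s1 by rewrite divr_gt0 //; lra.
have s12 : s1 < s2 by rewrite ltr_pM2r ?invr_gt0 //; lra.
have s20 : 0 < s2 := lt_trans s10 s12.
have s01 : s0 <= s1.
  apply: le_trans (ler_norm _) _; rewrite ler_pdivlMr // mulrC ltW //; exact: truncnS_gt.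
have [//|h1] := ltP ((16 * mu)^-1 / s1) (Delta s1 Q 0); first by exists s1.
have [//|h2] := ltP ((16 * mu)^-1 / s2) (Delta s2 Q 0).
  by exists s2 => //; apply: le_trans s01 (ltW s12).
exfalso.
have nE : lcount Q 0 s1 = lcount Q 0 s2.
  pose N := 1 + `|c * s2|.
  have N1 : 1 <= N by rewrite lerDl.
  have cN : c * s2 <= N ^+ 2.
    apply: le_trans (ler_norm _) _; rewrite /N; move: `|c * s2| (normr_ge0 (c * s2)) => y y0; nra.
  have N0 : 0 < N by lra.
  rewrite (lcountE c1 Hc 0 N0 cN) (lcountE c1 Hc 0 N0); last first.
    by apply: le_trans cN; apply: ler_wpM2l; [lra|exact: ltW].
  apply: eq_bigr => n _; congr (_ %:R); congr nat_of_bool.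
  rewrite !ler_pdivlMr // ![_ * mu]mulrC; have /intrP[z ->] := qint n.
  apply/idP/idP => [h|h]; first by lra.
  have : (z%:~R : R) < (k%:Z + 1)%:~R by rewrite intrD -[(k%:Z)%:~R]/(k%:R) -[1%:~R]/(1 : R); lra.
  by rewrite ltr_int ltzD1 -(ler_int R).
pose v1 := vol (ellipsoid Q s1); pose v2 := vol (ellipsoid Q s2).
have vE r : 0 < r -> vol (ellipsoid Q r) = Num.sqrt r ^+ d * V by move=> r0; exact: (vol_scale Qpos).
have v10 : 0 < v1 by rewrite /v1 vE // mulr_gt0 // exprn_gt0 // sqrtr_gt0.
have v20 : 0 < v2 by rewrite /v2 vE // mulr_gt0 // exprn_gt0 // sqrtr_gt0.
(* The volume grows at least linearly in s, since d >= 2. *)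
have v12 : v1 * s2 <= v2 * s1.
  rewrite /v1 /v2 !vE // ![_ * V * _]mulrAC; apply: ler_wpM2r; first exact: ltW.
  rewrite -[s2 in leLHS]sqr_sqrtr ?(ltW s20) // -[s1 in leRHS]sqr_sqrtr ?(ltW s10) //.
  set x := Num.sqrt s1; set y := Num.sqrt s2.
  have x0 : 0 <= x by exact: sqrtr_ge0.
  have xy : x <= y by rewrite ler_wsqrtr // ltW.
  have E (z : R) : z ^+ d = z ^+ (d - 2) * z ^+ 2.
    by rewrite -exprD subnK // (leq_trans _ d9).
  rewrite !E -![_ ^+ (d - 2) * _ * _]mulrA [y ^+ 2 * x ^+ 2]mulrC.
  apply: ler_wpM2r; first by rewrite mulr_ge0 ?sqr_ge0.
  by apply: lerXn2r; rewrite ?nnegrE // (le_trans x0).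
rewrite DeltaE -/v1 ler_pdivrMr // in h1; rewrite DeltaE -/v2 ler_pdivrMr // in h2.
rewrite -nE in h2; move: h1 h2; set n := lcount Q 0 s1.
rewrite !ler_norml => /andP[h1 h1'] /andP[h2 h2'].
have e : s2 - s1 = (2 * mu)^-1 by rewrite /s1 /s2; field; rewrite gt_eqF.
have s21 : s2 <= 2 * s1.
  by rewrite /s1 /s2 mulrA ler_wpM2r ?invr_ge0 ?(ltW mu0) //; lra.
pose t := (16 * mu)^-1; have t0 : 0 < t by rewrite invr_gt0 mulr_gt0.
have te : s2 - s1 = 8 * t by rewrite e /t; field; rewrite gt_eqF.
rewrite -/t in h1 h1' h2 h2'.
have H : v2 - v1 <= t / s1 * v1 + t / s2 * v2 by lra.
have A1 : t / s1 * v1 <= t / s2 * v2.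
  have h : v1 / s1 <= v2 / s2 by rewrite ler_pdivrMr // mulrAC ler_pdivlMr.
  by have := ler_wpM2l (ltW t0) h; rewrite !mulrA [t * v1 / s1]mulrAC [t * v2 / s2]mulrAC.
have A2 : v2 - v1 <= 2 * t * v2 / s2.
  have -> : 2 * t * v2 / s2 = t / s2 * v2 + t / s2 * v2 by ring.
  lra.
rewrite ler_pdivlMr // in A2.
have A3 : v2 * (8 * t) <= (v2 - v1) * s2 by rewrite -te; lra.
have : 0 < t * v2 by rewrite mulr_gt0.
lra.
Qed.

End Discrepancy.

Theorem theorem1p1 (R : realType) (d : nat) (hd : (9 <= d)%N)
    (Q : 'M[R]_d) (hQ : posdefmx Q) :
  (fun s : R => sup [set Delta s Q a | a in [set: 'cV[R]_d]] : R^o)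
      =o_ (pinfty_filter_on R) (fun s : R => s^-1 : R^o)
  <-> irrational_mx Q.
Proof.
have ne s : [set Delta s Q a | a in [set: 'cV[R]_d]] !=set0 by exists (Delta s Q 0); exists 0.
split=> [/eqoP H|irr].
  move=> /(rational_Delta hd hQ)[eps eps0 Hs].
  have := H _ (divr_gt0 eps0 (ltr0n R 2)); rewrite /= => -[A [_ HA]].
  have [s sA [s0 Ds]] := Hs (`|A| + 1).
  have As : A < s by apply: lt_le_trans sA; have := ler_norm A; lra.
  have := HA s As; rewrite /=; apply/negP; rewrite -ltNge.
  have [c c1 Hc] := coord_bound hQ.
  have [K HK] := lcount_upper c1 Hc s.
  (* The supremum of an unbounded set is 0 by convention, so boundedness must be known before it can
     be compared with one of its members. *)
  have ub : has_ubound [set Delta s Q a | a in [set: 'cV[R]_d]].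
    exists ((K + `|vol (ellipsoid Q s)|) / vol (ellipsoid Q s)) => _ [a _ <-].
    rewrite DeltaE; apply: ler_wpM2r.
      by rewrite invr_ge0 /vol fine_ge0 // lebesgue_tuple_ge0.
    apply: le_trans (ler_normB _ _) _; rewrite lerD2r ger0_norm ?lcount_ge0 //.
  have sD : Delta s Q 0 <= sup [set Delta s Q a | a in [set: 'cV[R]_d]].
    by apply: ub_le_sup => //; exists 0.
  rewrite [`|s^-1|]ger0_norm ?invr_ge0 ?(ltW s0) //.
  apply: lt_le_trans (ler_norm _); apply: lt_le_trans sD; apply: le_lt_trans Ds.
  by rewrite ler_pM2r ?invr_gt0 //; lra.
apply/eqoP => eps eps0; have [s0 Hs0] := irrational_Delta hd hQ irr eps0.
exists (`|s0|); split; first exact: num_real.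
move=> s s0s /=; have s_gt0 : 0 < s := le_lt_trans (normr_ge0 _) s0s.
have le_s : s0 <= s by apply: le_trans (ler_norm _) (ltW s0s).
rewrite [`|s^-1|]ger0_norm ?invr_ge0 ?(ltW s_gt0) // ger0_norm.
  by apply: ge_sup => // _ [a _ <-]; exact: Hs0.
apply: le_trans (_ : Delta s Q 0 <= _); first by rewrite /Delta.
apply: ub_le_sup; last by exists 0.
by exists (eps / s) => _ [a _ <-]; exact: Hs0.
Qed.
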